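(* Let $0<\alpha<n$ and let $b$ be a locally integrable function on $\mathbb{Q}_p^n$. The following assertions are equivalent: (T.1) $b\in \mathrm{BMO}(\mathbb{Q}_p^n)$ and $b^-\in L^\infty(\mathbb{Q}_p^n)$. (T.2) $[b,\mathcal{M}^p_\alpha]$ is bounded from $L^{r(\cdot)}(\mathbb{Q}_p^n)$ to $L^{q(\cdot)}(\mathbb{Q}_p^n)$ for all $r(\cdot),q(\cdot)\in\mathscr{C}^{\log}(\mathbb{Q}_p^n)$ with $r(\cdot)\in\mathscr{P}(\mathbb{Q}_p^n)$, $r_+<n/\alpha$ and $1/q(\cdot)=1/r(\cdot)-\alpha/n$. (T.3) $[b,\mathcal{M}^p_\alpha]$ is bounded from $L^{r(\cdot)}(\mathbb{Q}_p^n)$ to $L^{q(\cdot)}(\mathbb{Q}_p^n)$ for some $r(\cdot),q(\cdot)\in\mathscr{C}^{\log}(\mathbb{Q}_p^n)$ with $r(\cdot)\in\mathscr{P}(\mathbb{Q}_p^n)$, $r_+<n/\alpha$ and $1/q(\cdot)=1/r(\cdot)-\alpha/n$. (T.4) For some $r(\cdot),q(\cdot)\in\mathscr{C}^{\log}(\mathbb{Q}_p^n)$ with $r(\cdot)\in\mathscr{P}(\mathbb{Q}_p^n)$, $r_+<n/\alpha$ and $1/q(\cdot)=1/r(\cdot)-\alpha/n$, one has $$\sup_{\gamma\in\mathbb{Z},\,x\in\mathbb{Q}_p^n}\frac{\big\|\big(b-|B_\gamma(x)|_h^{-\alpha/n}\mathcal{M}^p_{\alpha,B_\gamma(x)}(b)\big)\chi_{B_\gamma(x)}\big\|_{L^{q(\cdot)}(\mathbb{Q}_p^n)}}{\|\chi_{B_\gamma(x)}\|_{L^{q(\cdot)}(\mathbb{Q}_p^n)}}<\infty.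 \quad ( * )$$ (T.5) $( * )$ holds for all $r(\cdot),q(\cdot)\in\mathscr{C}^{\log}(\mathbb{Q}_p^n)$ with $r(\cdot)\in\mathscr{P}(\mathbb{Q}_p^n)$, $r_+<n/\alpha$ and $1/q(\cdot)=1/r(\cdot)-\alpha/n$.
   Context: Fix a prime $p$. $\mathbb{Q}_p$ is the field of $p$-adic numbers with absolute value $|\cdot|_p$; on $\mathbb{Q}_p^n$ put $|x|_p=\max_{1\le j\le n}|x_j|_p$. For $\gamma\in\mathbb{Z}$, $x\in\mathbb{Q}_p^n$, the ($p$-adic) ball is $B_\gamma(x)=\{y\in\mathbb{Q}_p^n:|y-x|_p\le p^\gamma\}$. $dx$ is the Haar measure on $\mathbb{Q}_p^n$ normalized by $|B_0(0)|_h=1$, where $|E|_h$ denotes the Haar measure of $E$; thus $|B_\gamma(x)|_h=p^{n\gamma}$. $\chi_E$ is the characteristic function of $E$, and $f_B=|B|_h^{-1}\int_B f$. For $0\le\alpha<n$ and $f$ locally integrable: $\mathcal{M}^p_\alpha(f)(x)=\sup_{\gamma\in\mathbb{Z}}|B_\gamma(x)|_h^{\alpha/n-1}\int_{B_\gamma(x)}|f(y)|\,dy$; $\mathcal{M}^p=\mathcal{M}^p_0$. For a fixed ball $B_*$ and $x\in B_*$: $\mathcal{M}^p_{\alpha,B_*}(f)(x)=\sup\{|B_\gamma(x)|_h^{\alpha/n-1}\int_{B_\gamma(x)}|f(y)|dy:\ \gamma\in\mathbb{Z},\ B_\gamma(x)\subset B_*\}$. The nonlinear commutator is $[b,\mathcal{M}^p_\alpha](f)(x)=b(x)\mathcal{M}^p_\alpha(f)(x)-\mathcal{M}^p_\alpha(bf)(x)$.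 $\mathrm{BMO}(\mathbb{Q}_p^n)$ is the set of locally integrable $b$ with $\|b\|_{*}=\sup_{\gamma,x}|B_\gamma(x)|_h^{-1}\int_{B_\gamma(x)}|b(y)-b_{B_\gamma(x)}|dy<\infty$. $b^-=-\min\{b,0\}$. Variable exponents: for measurable $q(\cdot)$, $q_-=\operatorname{ess\,inf} q$, $q_+=\operatorname{ess\,sup}q$, and for a ball $B$, $q_\pm(B)$ are the ess inf/sup over $B$. $\mathscr{P}(\mathbb{Q}_p^n)$ is the set of measurable $q:\mathbb{Q}_p^n\to(1,\infty)$ with $1<q_-\le q_+<\infty$. $L^{q(\cdot)}(\mathbb{Q}_p^n)$ is the space of measurable $f$ with $\int(|f|/\eta)^{q(x)}dx<\infty$ for some $\eta>0$, normed by $\|f\|_{L^{q(\cdot)}}=\inf\{\eta>0:\int(|f(x)|/\eta)^{q(x)}dx\le1\}$. $\mathscr{C}^{\log}_0$: there is $C$ with $\gamma\big(q_-(B_\gamma(x))-q_+(B_\gamma(x))\big)\le C$ for all $\gamma\in\mathbb{Z}$, $x$. $\mathscr{C}^{\log}_\infty$: there is $C$ with $|q(x)-q(y)|\le C/\log_p(p+\min\{|x|_p,|y|_p\})$ for all $x,y$. $\mathscr{C}^{\log}=\mathscr{C}^{\log}_0\cap\mathscr{C}^{\log}_\infty$. *)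

(* Defs.v *)
From HB Require Import structures.
From mathcomp Require Import all_boot all_order all_algebra.
From mathcomp Require Import all_classical all_reals all_analysis.
From mathcomp Require Import ess_sup_inf measurable_realfun.
Set Implicit Arguments. Unset Strict Implicit. Unset Printing Implicit Defensive.
Import Order.TTheory GRing.Theory Num.Theory.
Import numFieldNormedType.Exports.
Local Open Scope classical_set_scope.
Local Open Scope ring_scope.

(* p-adic numbers, represented by their canonical p-adic expansions     *)
(*   x = \sum_{k >= m} a_k p^k,   a_k in {0,...,p-1},                   *)
(* (every element of Q_p has exactly one such expansion).               *)
Definition padic_digits (p : nat) (a : int -> nat) : Prop :=
  (forall k, (a k == 0)%N || (a k < p)%N) /\
  exists m : int, forall k : int, k < m -> a k = 0%N.

Record Qp (p : nat) := MkQp { digit : int -> nat ; digitP : padic_digits p digit }.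

Lemma padic_digits0 p : padic_digits p (fun _ => 0%N).
Proof. by split => //; exists 0. Qed.

Definition Qp0 p : Qp p := MkQp (padic_digits0 p).

HB.instance Definition _ p := gen_eqMixin (Qp p).
HB.instance Definition _ p := gen_choiceMixin (Qp p).
HB.instance Definition _ p := isPointed.Build (Qp p) (Qp0 p).

Definition Qpn (p n : nat) := 'I_n -> Qp p.

Section Padic.
Variables (R : realType) (p n : nat).

(* |x - y|_p = p^{-v}, v the first index where the expansions differ:
   |x - y|_p <= p^g  iff  x = y mod p^{-g} Z_p  iff  the digits of x and y
   agree at every index k < -g.  We take the infimum of such p^g. *)
Definition qp_agree (x y : Qp p) (g : int) : Prop :=
  forall k : int, k < - g -> digit x k = digit y k.

Definition padic_dist (x y : Qp p) : R :=
  inf [set (p%:R : R) ^ g | g in [set g : int | qp_agree x y g]].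

Definition qpn_dist (x y : Qpn p n) : R :=
  \big[Num.max/0]_(j < n) padic_dist (x j) (y j).

Definition qpn_norm (x : Qpn p n) : R := qpn_dist x (fun _ => Qp0 p).

Definition pball (x : Qpn p n) (g : int) : set (Qpn p n) :=
  [set y | qpn_dist y x <= (p%:R : R) ^ g].

Definition pballs : set (set (Qpn p n)) :=
  [set B | exists x g, B = pball x g].

End Padic.



(* Q_p^n with its Borel sigma-algebra (generated by the balls) *)
Definition QpnT (R : realType) (p n : nat) :=
  g_sigma_algebraType (@pballs R p n).

Section Analysis.
Variables (R : realType) (p n : nat).
Local Notation X := (QpnT R p n).
Variable mu : {measure set X -> \bar R}.

Definition qball (x : X) (g : int) : set X := @pball R p n x g.

Definition hmeas (B : set X) : R := fine (mu B).

Definition qp_locint (b : X -> R) : Prop :=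
  forall x g, mu.-integrable (qball x g) (EFin \o b).

Definition avg (B : set X) (f : X -> R) : R :=
  (hmeas B)^-1 * fine (\int[mu]_(y in B) (f y)%:E).

Definition bmo_seminorm (b : X -> R) : \bar R :=
  ereal_sup [set (((hmeas (qball x g))^-1)%:E *
                 \int[mu]_(y in qball x g) (`|b y - avg (qball x g) b|)%:E)%E
            | x in [set: X] & g in [set: int]].

Definition in_BMO (b : X -> R) : Prop :=
  qp_locint b /\ (bmo_seminorm b < +oo)%E.

Definition negpart (b : X -> R) : X -> R := fun x => - Num.min (b x) 0.

Definition in_Linfty (f : X -> R) : Prop :=
  measurable_fun [set: X] f /\ (ess_sup mu ((fun x => (`|f x|)%:E)) < +oo)%E.

Definition frac_max (alpha : R) (f : X -> R) (x : X) : \bar R :=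
  ereal_sup [set (((hmeas (qball x g)) `^ (alpha / n%:R - 1))%:E *
                 \int[mu]_(y in qball x g) (`|f y|)%:E)%E | g in [set: int]].

Definition frac_max_in (alpha : R) (Bs : set X) (f : X -> R) (x : X) : \bar R :=
  ereal_sup [set (((hmeas (qball x g)) `^ (alpha / n%:R - 1))%:E *
                 \int[mu]_(y in qball x g) (`|f y|)%:E)%E
            | g in [set g : int | qball x g `<=` Bs]].

Definition commutator (alpha : R) (b f : X -> R) (x : X) : \bar R :=
  ((b x)%:E * frac_max alpha f x - frac_max alpha (fun y => (b y * f y)%R) x)%E.

Definition esup_on (A : set X) (q : X -> R) : \bar R :=
  ereal_inf [set y : \bar R | \forall x \ae mu, A x -> ((q x)%:E <= y)%E].
Definition einf_on (A : set X) (q : X -> R) : \bar R :=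
  ereal_sup [set y : \bar R | \forall x \ae mu, A x -> (y <= (q x)%:E)%E].

Definition modular (q : X -> R) (f : X -> \bar R) (eta : R) : \bar R :=
  \int[mu]_x ((`|f x| * (eta^-1)%:E) `^ (q x))%E.

Definition in_Lvar (q : X -> R) (f : X -> \bar R) : Prop :=
  measurable_fun [set: X] f /\
  exists eta : R, 0 < eta /\ (modular q f eta < +oo)%E.

Definition Lvar_norm (q : X -> R) (f : X -> \bar R) : \bar R :=
  ereal_inf [set eta%:E | eta in [set eta : R | 0 < eta /\ (modular q f eta <= 1)%E]].

Definition exponent_P (q : X -> R) : Prop :=
  [/\ measurable_fun [set: X] q, (forall x, 1 < q x),
      (1%:E < einf_on [set: X] q)%E & (esup_on [set: X] q < +oo)%E].

Definition Clog0 (q : X -> R) : Prop :=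
  exists C : R, forall (g : int) (x : X),
    ((g%:~R)%:E * (einf_on (qball x g) q - esup_on (qball x g) q) <= C%:E)%E.

Definition Cloginf (q : X -> R) : Prop :=
  exists C : R, forall x y : X,
    `|q x - q y| <= C / (ln (p%:R + Num.min (@qpn_norm R p n x) (@qpn_norm R p n y)) / ln p%:R).

Definition Clog (q : X -> R) : Prop := Clog0 q /\ Cloginf q.

Definition admissible (alpha : R) (r q : X -> R) : Prop :=
  [/\ Clog r, Clog q, exponent_P r, (esup_on [set: X] r < (n%:R / alpha)%:E)%E
    & forall x, (q x)^-1 = (r x)^-1 - alpha / n%:R].

Definition comm_bounded (alpha : R) (b : X -> R) (r q : X -> R) : Prop :=
  exists C : R, 0 <= C /\ forall f : X -> R, in_Lvar r (EFin \o f) ->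
    in_Lvar q (commutator alpha b f) /\
    (Lvar_norm q (commutator alpha b f) <= C%:E * Lvar_norm r (EFin \o f))%E.

Definition star_quantity (alpha : R) (b : X -> R) (q : X -> R) (x : X) (g : int) : \bar R :=
  let B := qball x g in
  (Lvar_norm q (fun y => if `[< B y >] then
        ((b y)%:E - ((hmeas B) `^ (- alpha / n%:R))%:E * frac_max_in alpha B b y)%E
      else 0%E) *
   ((fine (Lvar_norm q (fun y => (\1_B y)%:E)))^-1)%:E)%E.

Definition star_condition (alpha : R) (b : X -> R) (q : X -> R) : Prop :=
  (ereal_sup [set star_quantity alpha b q x g | x in [set: X] & g in [set: int]] < +oo)%E.

End Analysis.

(* Main.v *)
Require Import Defs.
From HB Require Import structures.
From mathcomp Require Import all_boot all_order all_algebra.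
From mathcomp Require Import all_classical all_reals all_analysis measurable_realfun.
From mathcomp Require Import ess_sup_inf.
From mathcomp Require Import zify ring lra.
Set Implicit Arguments. Unset Strict Implicit. Unset Printing Implicit Defensive.
Import Order.TTheory GRing.Theory Num.Theory.
Import numFieldNormedType.Exports.
Local Open Scope classical_set_scope.
Local Open Scope ring_scope.

(** The bound on the commutator comes from a single estimate (key_estimate): for
    [b] in BMO and [f >= 0] with modular at most 1, the supremum over [g] of
    [(|B|^(alpha/n) avg_B ((1 + |b x - b|) f)) ^ q x], [B] the ball of level [g]
    at [x], has a bounded integral.  Hoelder's inequality and the log-Hoelder
    conditions bound each term by [(1 + |b x - b_B|) ^ q+] times
    [(avg_B G) ^ rho], where [G] is [f ^ (r / rho)] plus a fixed function
    decaying at infinity, up to an integrable error.  The maximal function of the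
    weights [(1 + |b x - b_B|) ^ N] satisfies a Carleson condition, by the
    John-Nirenberg inequality, and the Carleson embedding theorem (balls being
    nested, the maximal ones where an average exceeds a level are disjoint)
    concludes.

    Conversely, on a ball [B] the commutator of [1_B] is
    [|B|^(alpha/n) b - M_(alpha,B) b].  If the norms in the star condition are
    bounded then so are the means over [B] of [h = (avg_B |b| - b)^+], by the key
    estimate with [b = 0] applied to multiples of [h 1_B].  Now
    [|b - avg_B |b|| + avg_B |b| <= |b| + 2 h] gives [b] in BMO, and
    [|b| - b + avg_B |b| <= |b| + h] bounds the means of [|b| - b = 2 b^-], which
    is therefore bounded by differentiation. *)

(** The obstacle is that the weight [(1 + |b x - b_B|) ^ q+] has no bound uniform in [B] and cannot
    be pulled out of the supremum over balls. What survives is that inside a fixed ball the supremum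
    of the weights of the smaller balls has a bounded mean, and this is exactly what the Carleson
    embedding needs to treat weights and averages together. The auxiliary exponent [rho > 1] has
    [rho ^ 2] at most the lower bound of [r]: one factor [rho] leaves room for Hoelder's inequality
    against [1 + |b y - b_B|], the other puts [G] into [L^rho], where the embedding holds. The
    estimates concern modulars, and norms enter through scaling, so the dual of [q] never appears:
    taken with [b = 0], the key estimate bounds the averaging operators, and this replaces the usual
    duality bound for the norm of an indicator. The p-adic structure enters through an abstract
    ultrametric space, in which a ball of given level is an atom of a countable partition;
    measurability, stopping arguments and differentiation all come from these partitions. *)

Section Integral.
Context {R : realType} d {X : measurableType d} (mu : {measure set X -> \bar R}).
Local Open Scope ereal_scope.

(** The integral of a nonnegative function is a supremum over the simple functions below it, and
    this supremum is monotone for arbitrary functions. *)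
Lemma le_int (D : set X) (f1 f2 : X -> \bar R) :
  (forall x, D x -> 0 <= f1 x) -> (forall x, D x -> f1 x <= f2 x) ->
  \int[mu]_(x in D) f1 x <= \int[mu]_(x in D) f2 x.
Proof.
move=> f10 f12.
have f20 x : D x -> 0 <= f2 x by move=> Dx; exact: le_trans (f10 _ Dx) (f12 _ Dx).
rewrite !ge0_integralE//; apply: le_ereal_sup => _ [h hf <-]; exists h => //= x.
by apply: (le_trans (hf x)); rewrite !patchE; case: ifPn => // /set_mem; exact: f12.
Qed.

(** Raising [f2] to [+oo] on the exceptional null set keeps its integral and makes the inequality
    hold everywhere; measurability is asked of the larger function alone, so that the smaller one
    may be a supremum. *)
Lemma le_int_ae (D : set X) (f1 f2 : X -> \bar R) : measurable D ->
  (forall x, D x -> 0 <= f1 x) -> (forall x, D x -> 0 <= f2 x) ->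
  measurable_fun D f2 -> {ae mu, forall x, D x -> f1 x <= f2 x} ->
  \int[mu]_(x in D) f1 x <= \int[mu]_(x in D) f2 x.
Proof.
move=> mD f10 f20 mf2 [N [mN N0 subN]].
have m1 : measurable_fun D (fun x => +oo * (\1_N x)%:E : \bar R).
  by apply: measurable_funeM; apply/measurable_EFinP; exact: measurable_indic.
apply: (@le_trans _ _ (\int[mu]_(x in D) (f2 x + +oo * (\1_N x)%:E))).
  apply: le_int => // x Dx; rewrite indicE.
  case: (boolP (x \in N)) => xN /=.
    by rewrite mule1 addey ?leey// gt_eqF// (lt_le_trans _ (f20 _ Dx)).
  rewrite mule0 adde0; apply: contrapT => nle; move/negP : xN; apply.
  by apply/mem_set/subN => /= /(_ Dx).
rewrite ge0_integralD// ge0_integralZl//; last first.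
  by apply/measurable_EFinP; exact: measurable_indic.
rewrite integral_indic// (_ : mu (N `&` D) = 0) ?mule0 ?adde0//.
by apply: (subset_measure0 _ mN _ N0) => //; exact: measurableI.
Qed.

End Integral.

(** * Ultrametric measure spaces and unions of balls *)

Section Ultra.
Context {R : realType} {d} {X : measurableType d}.
Variables (mu : {measure set X -> \bar R}) (ball : X -> int -> set X) (Q : R).

(** For the p-adic space [Q] is [p ^ n]. By [us_eq] and [us_count] the balls of one level form a
    countable partition; [us_gen] is what allows measurable sets to be approximated by unions of
    balls. *)
Structure ultra_space : Prop := {
  us_Q1 : 1 < Q ;
  us_refl : forall x g, ball x g x ;
  us_eq : forall x y g, ball x g y -> ball y g = ball x g ;
  us_le : forall x g g', g <= g' -> ball x g `<=` ball x g' ;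
  us_meas : forall x g, measurable (ball x g) ;
  us_mu : forall x g, mu (ball x g) = (Q ^ g)%:E ;
  us_count : exists c : int -> nat -> X, forall g x, exists i, ball (c g i) g x ;
  us_join : forall x y, exists g, ball x g y ;
  us_gen : forall A, d.-measurable A -> <<s [set B | exists x g, B = ball x g] >> A }.

Hypothesis us : ultra_space.

(** The sets measurable for the partition of level [g]; as [g] decreases they form a filtration. *)
Definition binv (g : int) (U : set X) := forall x y, U x -> ball x g y -> U y.

Lemma us_sym x y g : ball x g y -> ball y g x.
Proof. by move=> /(us_eq us) ->; exact: us_refl. Qed.

Lemma Q0 : 0 < Q. Proof. by rewrite (lt_trans _ (us_Q1 us)). Qed.

Lemma Qg0 g : 0 < Q ^ g. Proof. by rewrite exprz_gt0// Q0. Qed.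

Lemma binv_cover g U : binv g U ->
  exists F : nat -> set X, [/\ U = \bigcup_i F i, trivIset setT F &
   forall i, F i = set0 \/ exists x, U x /\ F i = ball x g].
Proof.
move=> iU; have [c cE] := us_count us.
pose G i := if `[< U (c g i) >] then ball (c g i) g else set0.
have GT i : U (c g i) -> G i = ball (c g i) g by move=> Ui; rewrite /G asboolT.
have GF i : ~ U (c g i) -> G i = set0 by move=> Ui; rewrite /G asboolF.
(* The enumeration of centres may repeat balls. Two balls of one level coincide or are disjoint, so
   subtracting the earlier ones leaves a whole ball or nothing. *)
exists (seqDU G); split; last 2 first.
- exact: trivIset_seqDU.
- move=> i; rewrite /seqDU; have [Ui|Ui] := pselect (U (c g i)); last first.
    by left; rewrite GF// set0D.
  rewrite GT//; have [[k [ki [Uk bk]]]|nk] := pselect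
      (exists k, (k < i)%N /\ U (c g k) /\ ball (c g k) g (c g i)).
    left; rewrite -subset0 => y [iy]; apply; rewrite -bigcup_mkord; exists k => //.
    by rewrite GT// -(us_eq us bk).
  right; exists (c g i); split => //; apply/seteqP; split; first by move=> y [].
  move=> y iy; split => //; rewrite -bigcup_mkord => -[k /= ki].
  have [Uk|Uk] := pselect (U (c g k)); last by rewrite GF.
  rewrite GT// => ky; apply: nk; exists k; split => //; split => //.
  by rewrite -(us_eq us ky) (us_eq us iy); exact: us_refl.
rewrite -seqDU_bigcup_eq; apply/seteqP; split => [x Ux|x [i _]].
  by have [i ix] := cE g x; exists i => //; rewrite GT//; exact: iU Ux (us_sym ix).
by have [Ui|Ui] := pselect (U (c g i)); [rewrite GT//; exact: iU|rewrite GF].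
Qed.

Lemma binv_measurable g U : binv g U -> measurable U.
Proof.
move=> /binv_cover[F [-> _ FE]]; apply: bigcupT_measurable => i.
by have [->//|[x [_ ->]]] := FE i; exact: us_meas.
Qed.

Lemma binv_le g g' U : g' <= g -> binv g U -> binv g' U.
Proof. by move=> gg' iU x y Ux xy; apply: (iU x) => //; exact: us_le xy. Qed.

Lemma binv_setC g U : binv g U -> binv g (~` U).
Proof. by move=> iU x y Ux xy Uy; apply: Ux; exact: iU Uy (us_sym xy). Qed.

Lemma locconst_measurable {d'} {Y : measurableType d'} g (F : X -> Y) :
  (forall x y, ball x g y -> F x = F y) -> measurable_fun setT F.
Proof.
move=> FE _ A mA; rewrite setTI; apply: (@binv_measurable g) => x y /= Fx xy.
by rewrite /preimage/= -(FE _ _ xy).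
Qed.

Local Open Scope ereal_scope.

Lemma binv_integral_le g U (H H' : X -> \bar R) : binv g U ->
  (forall x, 0 <= H x) -> (forall x, 0 <= H' x) ->
  measurable_fun setT H -> measurable_fun setT H' ->
  (forall x, U x -> \int[mu]_(y in ball x g) H y <= \int[mu]_(y in ball x g) H' y) ->
  \int[mu]_(x in U) H x <= \int[mu]_(x in U) H' x.
Proof.
move=> iU H0 H'0 mH mH' HH'; have [F [UE tF FE]] := binv_cover iU.
have mF i : measurable (F i).
  by have [->//|[x [_ ->]]] := FE i; exact: us_meas.
rewrite UE !ge0_integral_bigcup//; try exact: measurable_funTS.
apply: lee_nneseries => [i _ _|i _]; first exact: integral_ge0.
by have [->|[x [Ux ->]]] := FE i; [rewrite !integral_set0|exact: HH'].
Qed.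

(** A stopping-time argument. The points whose first index is [n] still form a union of balls of
    level [lv n], since the earlier sets are unions of balls at least as large. *)
Lemma stop_le (lv : nat -> int) (Z : nat -> set X) (H H' : X -> \bar R) :
  (forall n, binv (lv n) (Z n)) -> (forall m n, (m <= n)%N -> (lv n <= lv m)%R) ->
  (forall x, 0 <= H x) -> (forall x, 0 <= H' x) ->
  measurable_fun setT H -> measurable_fun setT H' ->
  (forall n x, Z n x -> (forall k, (k < n)%N -> ~ Z k x) ->
    \int[mu]_(y in ball x (lv n)) H y <= \int[mu]_(y in ball x (lv n)) H' y) ->
  \int[mu]_(x in \bigcup_n Z n) H x <= \int[mu]_(x in \bigcup_n Z n) H' x.
Proof.
move=> iZ lvn H0 H'0 mH mH' HH'; rewrite seqDU_bigcup_eq.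
have nZ n x : seqDU Z n x -> Z n x /\ (forall k, (k < n)%N -> ~ Z k x).
  by rewrite /seqDU -bigcup_mkord => -[Zn nZ]; split => // k kn Zk; apply: nZ; exists k.
have iD n : binv (lv n) (seqDU Z n).
  move=> x y /nZ[Zx nZx] xy; split; first exact: iZ xy.
  rewrite -bigcup_mkord => -[k /= kn Zk]; apply: (nZx k) => //.
  by apply: iZ Zk _; apply: us_le (us_sym xy) => //; apply: lvn; exact: ltnW.
have mZ n : measurable (seqDU Z n) by exact: binv_measurable (iD n).
rewrite !ge0_integral_bigcup//; try exact: measurable_funTS;
  try exact: trivIset_seqDU.
apply: lee_nneseries => [i _ _|i _]; first exact: integral_ge0.
by apply: (binv_integral_le (iD i)) => // x /nZ[Zx nZx]; exact: HH'.
Qed.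

End Ultra.

Section SupInt.
Context {R : realType} {d} {X : measurableType d}.

Lemma measurable_ereal_sup_int (u : int -> X -> \bar R) (S : set int) :
  (forall g, S g -> measurable_fun setT (u g)) ->
  measurable_fun setT (fun x => ereal_sup [set u g x | g in S]).
Proof.
move=> mu_ mT; apply: (measurability _ (ErealGenOInfty.measurableE R)) => //.
move=> _ [_ [y ->] <-]; rewrite setTI.
rewrite (_ : _ @^-1` _ = \bigcup_g (if `[< S g >] then u g @^-1` `]y%:E, +oo[ else set0)).
  apply: countable_bigcupT_measurable => [|g]; first exact: countableP.
  case: asboolP => // Sg; rewrite -[_ @^-1` _]setTI; apply: mu_ => //.
  exact: emeasurable_itv.
apply/seteqP; split => x /=.
  rewrite in_itv/= andbT => /ereal_sup_gt[_ [g Sg <-] yg]; exists g => //.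
  by rewrite asboolT//= in_itv/= andbT.
move=> [g _]; case: asboolP => //= Sg; rewrite !in_itv/= !andbT => /lt_le_trans.
by apply; apply: ereal_sup_ubound; exists g.
Qed.

End SupInt.

(** * Approximation of measurable sets by unions of balls *)

Section Ultra.
Context {R : realType} {d} {X : measurableType d}.
Variables (mu : {measure set X -> \bar R}) (ball : X -> int -> set X) (Q : R).
Hypothesis us : ultra_space mu ball Q.
Local Open Scope ereal_scope.

Let sd (A U : set X) := (A `\` U) `|` (U `\` A).

Let approx (K A : set X) := measurable A /\ forall e : R, (0 < e)%R ->
  exists g U, binv ball g U /\ mu (K `&` sd A U) < e%:E.

Let sd_meas A U : measurable A -> measurable U -> measurable (sd A U).
Proof. by move=> mA mU; apply: measurableU; exact: measurableD. Qed.

Let approx_setU K A B : measurable K -> approx K A -> approx K B -> approx K (A `|` B).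
Proof.
move=> mK [mA aA] [mB aB]; split; first exact: measurableU.
move=> e e0; have e20 : (0 < e / 2)%R by rewrite divr_gt0.
have [g [U [iU UA]]] := aA _ e20; have [k [V [iV VB]]] := aB _ e20.
have mU := binv_measurable us iU; have mV := binv_measurable us iV.
exists (Order.min g k), (U `|` V); split.
  move=> x y [Ux|Vx] xy; [left|right].
    by apply: (binv_le us _ iU) Ux xy; rewrite ge_min lexx.
  by apply: (binv_le us _ iV) Vx xy; rewrite ge_min lexx orbT.
apply: (@le_lt_trans _ _ (mu (K `&` sd A U) + mu (K `&` sd B V))).
  apply: (le_trans _ (measureU2 _ _ _)); last 2 first.
  - by apply: measurableI => //; exact: sd_meas.
  - by apply: measurableI => //; exact: sd_meas.
  apply: le_measure; rewrite ?inE.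
  - by apply: measurableI => //; apply: sd_meas; exact: measurableU.
  - by apply: measurableU; apply: measurableI => //; exact: sd_meas.
  by move=> x; rewrite /sd/=; tauto.
by rewrite [e]splitr EFinD lteD.
Qed.

(** The sets that can be approximated inside a ball of finite measure form a sigma-algebra
    containing the balls: a finite union takes the smaller of the two levels, a countable one uses
    continuity of the measure from above. *)
Lemma approx_measurable z m A : measurable A -> forall e : R, (0 < e)%R ->
  exists g U, binv ball g U /\ mu (ball z m `&` ((A `\` U) `|` (U `\` A))) < e%:E.
Proof.
move=> mA; suff [] : approx (ball z m) A by [].
have mK := us_meas us z m; set K := ball z m in mK *.
move: A mA; suff H : <<s [set B | exists x g, B = ball x g] >> `<=` approx K.
  by move=> A /(us_gen us)/H.
have sd0 A : K `&` sd A A = set0 by rewrite /sd setDv setU0 setI0.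
apply: smallest_sub; last first.
  move=> _ [x [g ->]]; split; first exact: (us_meas us).
  move=> e e0; exists g, (ball x g); rewrite sd0 measure0 lte_fin; split => //.
  by move=> y y' xy yy'; rewrite -(us_eq us xy).
split.
- split=> // e e0; exists 0%R, set0; rewrite sd0 measure0 lte_fin; split => //.
- move=> A [mA aA]; split; first exact: measurableD.
  move=> e /aA[g [U [iU UA]]]; exists g, (~` U); split; first exact: (binv_setC us iU).
  rewrite (_ : sd _ _ = sd A U)//; apply/seteqP.
  by split => x; rewrite /sd/= => ?; have [?|?] := pselect (A x);
    have [?|?] := pselect (U x); tauto.
- move=> A aA; have mA k : measurable (A k) by have [] := aA k.
  split; first exact: bigcupT_measurable.
  pose B N := \big[setU/set0]_(k < N) A k.
  have aB N : approx K (B N).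
    rewrite /B; elim: N => [|N ih].
      rewrite big_ord0; split=> // e e0; exists 0%R, set0.
      by rewrite sd0 measure0 lte_fin; split.
    by rewrite big_ord_recr/=; exact: approx_setU.
  have mB N : measurable (B N) by have [] := aB N.
  move=> e e0; have e20 : (0 < e / 2)%R by rewrite divr_gt0.
  have mT : measurable (\bigcup_k A k) by exact: bigcupT_measurable.
  pose F N := K `&` (\bigcup_k A k `\` B N).
  have mF N : measurable (F N) by apply: measurableI => //; exact: measurableD.
  have F0 : \bigcap_n F n = set0.
    rewrite -subset0 => x Fx; have [_ [[k _ Ak] _]] := Fx 0%N Logic.I.
    have [_ [_]] := Fx k.+1 Logic.I; apply; rewrite /B -bigcup_mkord.
    by exists k => /=.
  have cF : mu \o F @ \oo --> 0.
    rewrite -(measure0 mu) -F0; apply: nonincreasing_cvg_mu => //.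
    - apply: (@le_lt_trans _ _ (mu K)); last by rewrite (us_mu us) ltry.
      by apply: le_measure; rewrite ?inE//; exact: subIsetl.
    - exact: bigcap_measurable.
    - move=> N N' NN'; apply/subsetPset => x [Kx [Ax nB]]; split => //; split => //.
      apply: contra_not nB; rewrite /B -!bigcup_mkord => -[k /= kN Ak].
      by exists k => //=; exact: leq_trans NN'.
  have [N FN] : exists N, mu (F N) < (e / 2)%:E.
    apply: contrapT => /forallNP h.
    have : (e / 2)%:E <= 0.
      rewrite -(cvg_lim _ cF)//; apply: lime_ge; first by apply/cvg_ex; exists 0.
      by apply: nearW => N; rewrite leNgt; apply/negP/h.
    by rewrite lee_fin leNgt e20.
  have [g [U [iU UB]]] := (aB N).2 _ e20; exists g, U; split => //.
  have mU := binv_measurable us iU.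
  apply: (@le_lt_trans _ _ (mu (F N) + mu (K `&` sd (B N) U))).
    apply: (le_trans _ (measureU2 _ _ _)) => //; last first.
      by apply: measurableI => //; exact: sd_meas.
    apply: le_measure; rewrite ?inE.
    - by apply: measurableI => //; exact: sd_meas.
    - by apply: measurableU => //; apply: measurableI => //; exact: sd_meas.
    have sub : B N `<=` \bigcup_k A k.
      by rewrite /B -bigcup_mkord => x [k _ Ak]; exists k.
    move=> x; rewrite /sd/F/= => -[Kx [[Ax nU]|[Ux nA]]].
      by have [?|?] := pselect (B N x); tauto.
    by right; split => //; right; split => // /sub.
  by rewrite [e]splitr EFinD lteD.
Qed.

End Ultra.

(** * Averages over balls and differentiation *)

Section Ultra.
Context {R : realType} {d} {X : measurableType d}.
Variables (mu : {measure set X -> \bar R}) (ball : X -> int -> set X) (Q : R).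

Definition Ea (h : X -> \bar R) (g : int) (x : X) : \bar R :=
  (((Q ^ g)^-1)%:E * \int[mu]_(y in ball x g) h y)%E.

Hypothesis us : ultra_space mu ball Q.
Local Open Scope ereal_scope.

Lemma int_ball_cst x g (c : R) : \int[mu]_(y in ball x g) (cst c%:E y) = (c * Q ^ g)%:E.
Proof. by rewrite integral_cst ?(us_mu us)//; exact: (us_meas us). Qed.

(** This replaces Lebesgue's differentiation theorem. A set where [h] exceeds [lam] by a fixed
    amount is close to a union of balls, over which the integral of [h] is at most [lam] times the
    measure; a set of positive measure would contradict this. *)
Lemma ae_le_of_balls (h : X -> \bar R) (lam : R) : (0 <= lam)%R ->
  (forall x, 0 <= h x) -> measurable_fun setT h ->
  (forall x g, \int[mu]_(y in ball x g) h y <= (lam * Q ^ g)%:E) ->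
  {ae mu, forall x, h x <= lam%:E}.
Proof.
(* The truncation at [M] bounds the integral over the part missed by the union of balls; it lies
   above [lam + 1], hence above every level [lam + n.+1%:R^-1] tested below. *)
move=> lam0 h0 mh hB; pose M : R := (lam + 2)%R.
have M0 : (0 <= M)%R by rewrite /M; lra.
pose k x := Order.min (h x) M%:E.
have mk : measurable_fun setT k by apply: measurable_mine.
have k0 x : 0 <= k x by rewrite /k le_min h0 lee_fin.
have kM x : k x <= M%:E by rewrite /k ge_min lexx orbT.
have kB x g : \int[mu]_(y in ball x g) k y <= (lam * Q ^ g)%:E.
  apply: le_trans (hB x g); apply: le_int => y _; first exact: k0.
  by rewrite /k ge_min lexx.
pose o : X := point.
pose A (n m : nat) := ball o m `&` [set x | (lam + n.+1%:R^-1)%:E <= k x].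
have mA n m : measurable (A n m).
  apply: measurableI; first exact: (us_meas us).
  by rewrite -[X in measurable X]setTI; exact: emeasurable_fun_c_infty.
suff A0 n m : mu (A n m) = 0.
  have : {ae mu, forall x, forall n m, ~ A n m x}.
    apply: ae_foralln => n; apply: ae_foralln => m.
    by exists (A n m); split => // x /= /contrapT.
  apply: filterS => x nA; rewrite leNgt; apply/negP => lh.
  have [n nh] : exists n : nat, (lam + n.+1%:R^-1)%:E <= h x.
    case: (h x) lh (h0 x) => [r|_ _|//]; last by exists 0%N; rewrite leey.
    rewrite lte_fin => lr _; exists (Num.truncn (r - lam)^-1); rewrite lee_fin.
    rewrite addrC -lerBrDr -[leRHS]invrK lef_pV2 ?posrE ?invr_gt0 ?subr_gt0 ?ltr0n//.
    by rewrite ltW// truncnS_gt.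
  have [g og] := us_join us o x.
  apply: (nA n `|g|%N); split => /=.
    by apply: (us_le us _ og); rewrite abszE ler_norm.
  rewrite /k le_min nh/= lee_fin /M lerD2l (@le_trans _ _ 1%R)//; last by lra.
  by rewrite invf_le1 ?ltr0n// ler1n.
pose K := ball o m; have mK : measurable K by exact: (us_meas us).
have AK : A n m `<=` K by move=> x [].
have fin S : measurable S -> S `<=` K -> mu S \is a fin_num.
  move=> mS SK; rewrite ge0_fin_numE// (@le_lt_trans _ _ (mu K))//.
    by apply: le_measure; rewrite ?inE.
  by rewrite (us_mu us) ltry.
pose a := fine (mu (A n m)); have aE : mu (A n m) = a%:E by rewrite fineK// fin.
have a0 : (0 <= a)%R by rewrite fine_ge0.
rewrite aE; congr EFin; apply/eqP; rewrite eq_le a0 andbT leNgt; apply/negP => agt0.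
pose e : R := (n.+1%:R^-1)%R; have e0 : (0 < e)%R by rewrite invr_gt0.
(* Small enough that [(lam + M) * de < e * a], which is the final contradiction. *)
pose de := (e * a / (2 * (lam + M + 1)))%R.
have lM0 : (0 < 2 * (lam + M + 1))%R by lra.
have de0 : (0 < de)%R by rewrite divr_gt0// mulr_gt0.
have [g [U [iU UA]]] := approx_measurable us o m (mA n m) de0.
have mU := binv_measurable us iU.
pose U' := U `&` K.
have iU' : binv ball (Order.min g m) U'.
  move=> x y [Ux Kx] xy; split.
    by apply: (binv_le us _ iU) Ux xy; rewrite ge_min lexx.
  rewrite /K -(us_eq us Kx); apply: (us_le us _ xy); by rewrite ge_min lexx orbT.
have mU' : measurable U' by exact: measurableI.
have IU' : \int[mu]_(x in U') k x <= lam%:E * mu U'.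
  rewrite -integral_cst//; apply: (binv_integral_le us iU') => //.
  by move=> x _; rewrite int_ball_cst.
have mD : measurable (A n m `\` U) by exact: measurableD.
pose S := K `&` ((A n m `\` U) `|` (U `\` A n m)).
have mS : measurable S.
  by apply: measurableI => //; apply: measurableU => //; exact: measurableD.
have fU' : mu U' <= (a + de)%:E.
  apply: (@le_trans _ _ (mu (A n m) + mu S)); last by rewrite aE EFinD leeD2l// ltW.
  apply: (le_trans _ (measureU2 _ _ _)) => //.
  apply: le_measure; rewrite ?inE//; first exact: measurableU.
  by move=> x [Ux Kx]; have [Ax|nAx] := pselect (A n m x); [left|right; split => //; right].
have fD : mu (A n m `\` U) <= de%:E.
  apply: (@le_trans _ _ (mu S)); last exact: ltW.
  by apply: le_measure; rewrite ?inE// => x [Ax Ux]; split; [exact: AK|left].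
have I1 : (lam + e)%:E * mu (A n m) <= \int[mu]_(x in A n m) k x.
  rewrite -integral_cst//; apply: le_int => x [_] //=.
  by move=> _; rewrite lee_fin addr_ge0// ltW.
have I2 : \int[mu]_(x in A n m) k x <= \int[mu]_(x in U') k x + \int[mu]_(x in A n m `\` U) k x.
  rewrite -ge0_integral_setU//; last 2 first.
  - exact: measurable_funTS.
  - apply/disj_setPS => x [[Ux _] [_]] //.
  apply: ge0_subset_integral => //; [exact: measurableU|exact: measurable_funTS|].
  by move=> x Ax; have [Ux|Ux] := pselect (U x); [left; split => //; exact: AK|right].
have I3 : \int[mu]_(x in A n m `\` U) k x <= M%:E * mu (A n m `\` U).
  by rewrite -integral_cst//; exact: le_int.
have : ((lam + e) * a)%:E <= (lam * (a + de) + M * de)%:E.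
  rewrite EFinM -aE; apply: (le_trans I1); apply: (le_trans I2).
  rewrite EFinD !EFinM; apply: leeD.
    by apply: (le_trans IU'); apply: lee_wpmul2l; rewrite ?lee_fin.
  by apply: (le_trans I3); apply: lee_wpmul2l; rewrite ?lee_fin.
rewrite lee_fin leNgt => /negP; apply.
have -> : ((lam + e) * a = lam * a + e * a)%R by rewrite mulrDl.
have -> : (e * a = de * (2 * (lam + M + 1)))%R by rewrite /de divfK// gt_eqF.
by rewrite mulrDr -addrA ltrD2l -mulrDl mulrC ltr_pM2l//; lra.
Qed.

Lemma Ea_ge0 h g x : (forall y, 0 <= h y) -> 0 <= Ea h g x.
Proof.
move=> h0; rewrite mule_ge0 ?integral_ge0// lee_fin invr_ge0 ltW//; exact: Qg0 us g.
Qed.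

Lemma Ea_ball h g x y : ball x g y -> Ea h g x = Ea h g y.
Proof. by rewrite /Ea => xy; rewrite (us_eq us xy). Qed.

Lemma Ea_int h g x : \int[mu]_(y in ball x g) h y = (Q ^ g)%:E * Ea h g x.
Proof. by rewrite /Ea muleA -EFinM divff ?mul1e// gt_eqF//; exact: Qg0 us g. Qed.

Lemma Ea_measurable h g : measurable_fun setT (Ea h g).
Proof. by apply: (locconst_measurable us (g := g)) => x y; exact: Ea_ball. Qed.

Lemma Ea_le h h' g x : (forall y, ball x g y -> 0 <= h y) ->
  (forall y, ball x g y -> h y <= h' y) -> Ea h g x <= Ea h' g x.
Proof.
move=> h0 hh'; apply: lee_wpmul2l; last exact: le_int.
by rewrite lee_fin invr_ge0 ltW//; exact: Qg0 us g.
Qed.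

Lemma Ea_leP h g x (c : R) :
  (Ea h g x <= c%:E) = (\int[mu]_(y in ball x g) h y <= (c * Q ^ g)%:E).
Proof.
by rewrite Ea_int mulrC EFinM lee_pmul2l// ?lte_fin; exact: Qg0 us g.
Qed.

Lemma Ea_ltP h g x (c : R) :
  (c%:E < Ea h g x) = ((c * Q ^ g)%:E < \int[mu]_(y in ball x g) h y).
Proof. by rewrite !ltNge Ea_leP. Qed.

(** Cut [h] to the set where the maximal function is at most an integer [n]: a ball of level at most
    [m] meeting this set at [y] has its average among those at [y], so all averages of the cut
    function are at most [n]. Rounding up to an integer costs the [1]. *)
Lemma ae_le_maximal (h : X -> \bar R) z (m : int) : (forall x, 0 <= h x) ->
  measurable_fun setT h ->
  {ae mu, forall x, ball z m x ->
    h x <= ereal_sup [set Ea h g x | g in [set g | (g <= m)%R]] + 1}.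
Proof.
move=> h0 mh; pose S x := ereal_sup [set Ea h g x | g in [set g | (g <= m)%R]].
have mS : measurable_fun setT S.
  by apply: measurable_ereal_sup_int => g _; exact: Ea_measurable.
pose D n := ball z m `&` [set x | S x <= n%:R%:E].
have mD n : measurable (D n).
  apply: measurableI; first exact: (us_meas us).
  by rewrite -[X in measurable X]setTI; exact: emeasurable_fun_infty_c.
have hD n : {ae mu, forall x, (h \_ (D n)) x <= n%:R%:E}.
  apply: ae_le_of_balls => //.
  - by move=> x; apply: erestrict_ge0.
  - by apply/(measurable_restrictT _ (mD n)).1; exact: measurable_funTS.
  move=> x g; rewrite -integral_mkcondr.
  have [[y [xy [zy Sy]]]|none] := pselect (exists y, ball x g y /\ D n y); last first.
    rewrite (_ : _ `&` _ = set0) ?integral_set0 ?lee_fin ?mulr_ge0//.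
      exact/ltW/(Qg0 us).
    by rewrite -subset0 => y [xy Dy]; apply: none; exists y.
  have EaS k : (k <= m)%R -> \int[mu]_(t in ball y k) h t <= (n%:R * Q ^ k)%:E.
    move=> km; rewrite -Ea_leP; apply: le_trans Sy; apply: ereal_sup_ubound.
    by exists k.
  have mB w k := us_meas us w k.
  have [gm|mg] := leP g m.
    apply: le_trans (EaS _ gm); rewrite (us_eq us xy).
    apply: ge0_subset_integral => //; [exact: measurableI|exact: measurable_funTS].
  apply: (@le_trans _ _ (n%:R * Q ^ m)%:E); last first.
    rewrite lee_fin ler_wpM2l//; apply: ler_weXz2l; last exact: ltW.
    by rewrite ltW// (us_Q1 us).
  apply: le_trans (EaS _ (lexx _)); rewrite (us_eq us zy).
  apply: ge0_subset_integral => //; [exact: measurableI|exact: measurable_funTS|].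
  by move=> t [_ []].
have := ae_foralln hD; apply: filterS => x hx zx.
rewrite -/(S x); have S0 : 0 <= S x.
  by apply: le_trans (Ea_ge0 m x h0) _; apply: ereal_sup_ubound; exists m => /=.
move: S0; case sE : (S x) => [s| |//]; last by rewrite addye ?leey.
rewrite lee_fin => s0; have := hx (Num.truncn s).+1; rewrite patchE mem_set; last first.
  by split => //=; rewrite sE lee_fin ltW// truncnS_gt.
move=> /le_trans; apply; rewrite -natr1 EFinD leeD2r// lee_fin.
by rewrite truncn_le.
Qed.

End Ultra.

Lemma nneseries_ge_term {R : realType} (u : nat -> \bar R) k :
  (forall n, 0 <= u n)%E -> (u k <= \sum_(n <oo) u n)%E.
Proof.
move=> u0; apply: (@le_trans _ _ (\sum_(0 <= n < k.+1) u n)%E).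
  by rewrite big_nat_recr//= leeDr// sume_ge0.
by apply: nneseries_lim_ge => n _ _.
Qed.

Lemma nneseries_le_bound {R : realType} (u : nat -> \bar R) (B : \bar R) :
  (forall n, 0 <= u n)%E -> (forall n, \sum_(0 <= k < n) u k <= B)%E ->
  (\sum_(n <oo) u n <= B)%E.
Proof.
move=> u0 uB; apply: lime_le; first exact: is_cvg_nneseries.
by apply: nearW => n; exact: uB.
Qed.

(** * Mean oscillation and the John-Nirenberg inequality *)

Section BMO.
Context {R : realType} {d} {X : measurableType d}.
Variables (mu : {measure set X -> \bar R}) (ball : X -> int -> set X) (Q : R).
Hypothesis us : ultra_space mu ball Q.
Variable b : X -> R.

Definition bavg (g : int) (x : X) : R :=
  (Q ^ g)^-1 * fine (\int[mu]_(y in ball x g) (b y)%:E).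

(** The level [m] of the subtracted mean is kept apart from the level [g] of the averaging ball, so
    that stopping arguments can follow the oscillation around one fixed mean through smaller
    balls. *)
Definition bosc (m g : int) (x : X) : \bar R :=
  Ea mu ball Q (fun y => (`|b y - bavg m x|)%:E) g x.

Definition bosc_max (m : int) (x : X) : \bar R :=
  ereal_sup [set bosc m g x | g in [set g | (g <= m)%R]].

Hypothesis mb : measurable_fun setT b.
Hypothesis ib : forall x g, mu.-integrable (ball x g) (EFin \o b).
Variable K : R.
Hypothesis K0 : 0 < K.
Hypothesis bK : forall x g, (bosc g g x <= K%:E)%E.

Local Open Scope ereal_scope.
Notation Ea := (Ea mu ball Q).
Let mB x g := us_meas us x g.
Let Qg0 g := Qg0 us g.

Let mbc c : measurable_fun setT (fun y => `|b y - c|%:E).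
Proof.
by apply/measurable_EFinP; apply: measurableT_comp => //; exact: measurable_funB.
Qed.

Lemma bavg_ball g x y : ball x g y -> bavg g x = bavg g y.
Proof. by rewrite /bavg => xy; rewrite (us_eq us xy). Qed.

Lemma bavg_dist g x c : (`|bavg g x - c|)%:E <= Ea (fun y => `|b y - c|%:E) g x.
Proof.
have ic : mu.-integrable (ball x g) (EFin \o cst c).
  by apply: measurable_bounded_integrable => //=;
    [rewrite (us_mu us) ltry|exact: bounded_cst].
have fb := integrable_fin_num (mB x g) (ib x g).
have -> : (bavg g x - c = (Q ^ g)^-1 * fine (\int[mu]_(y in ball x g) (b y - c)%:E))%R.
  rewrite integralB_EFin// fineB//; last first.
    by rewrite (int_ball_cst us).
  by rewrite (int_ball_cst us)/= mulrBr mulrCA mulVf ?mulr1// gt_eqF// Qg0.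
rewrite normrM gtr0_norm ?invr_gt0 ?Qg0// EFinM; apply: lee_wpmul2l.
  by rewrite lee_fin invr_ge0 ltW// Qg0.
have fi : \int[mu]_(y in ball x g) (b y - c)%:E \is a fin_num.
  by rewrite integralB_EFin// fin_numB fb (int_ball_cst us).
rewrite -[leLHS]/(`|(fine _)%:E|) fineK//; apply: (le_trans (le_abse_integral _ _ _)) => //.
by apply/measurable_EFinP; apply: measurable_funB => //; exact: measurable_funTS.
Qed.

Lemma Ea_shift g x c c' :
  Ea (fun y => `|b y - c'|%:E) g x <= Ea (fun y => `|b y - c|%:E) g x + `|c - c'|%:E.
Proof.
have -> : `|c - c'|%:E = Ea (cst `|c - c'|%:E) g x.
  by rewrite /Ea (int_ball_cst us) -EFinM mulrCA mulVf ?mulr1// gt_eqF// Qg0.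
rewrite -ge0_muleDr ?integral_ge0//; last by move=> y _; rewrite lee_fin.
rewrite -ge0_integralD//; [|exact/measurable_funTS/mbc|by move=> y _; rewrite lee_fin].
apply: Ea_le => // y _; rewrite lee_fin.
by rewrite (le_trans _ (ler_normD _ _))// addrA subrK.
Qed.

Lemma Ea_parent h g x : (forall y, 0 <= h y) -> measurable_fun setT h ->
  Ea h g x <= Q%:E * Ea h (g + 1) x.
Proof.
move=> h0 mh; rewrite /Ea muleA -EFinM expfzDr ?gt_eqF ?(Q0 us)// expr1z invfM.
rewrite mulrCA divff ?mulr1 ?gt_eqF ?(Q0 us)//; apply: lee_wpmul2l.
  by rewrite lee_fin invr_ge0 ltW// Qg0.
apply: ge0_subset_integral => //; first exact: measurable_funTS.
by apply: (us_le us); rewrite lerDl.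
Qed.

Lemma bosc_max_measurable m : measurable_fun setT (bosc_max m).
Proof.
apply: measurable_ereal_sup_int => g gm.
apply: (locconst_measurable us (g := g)) => x y xy.
rewrite /bosc (bavg_ball (g := m) (y := y)); first exact: Ea_ball.
exact: (us_le us gm).
Qed.

(** Induction on [k], stopping at the largest balls on which the mean of [|b - c|] exceeds [2 * K];
    together they fill at most half of the ball. By comparison with its parent, such a ball has a
    mean of [b] within [2 * Q * K] of [c], so passing [k + 1] steps around [c] forces passing [k]
    steps around the local mean. *)
Lemma john_nirenberg k z m :
  mu (ball z m `&` [set x | (k%:R * (2 * Q * K))%:E < bosc_max m x]) <=
  ((2 ^+ k)^-1 * Q ^ m)%:E.
Proof.
set c0 := (2 * Q * K)%R.
have mL k' m' : measurable [set x | (k'%:R * c0)%:E < bosc_max m' x].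
  rewrite -[X in measurable X]setTI; apply: emeasurable_fun_o_infty => //.
  exact: bosc_max_measurable.
elim: k z m => [|k ih] z m.
  rewrite expr0 invr1 mul1r -(us_mu us z m); apply: le_measure; rewrite ?inE//.
    exact: measurableI.
set T := (X in mu X).
have mT : measurable T by exact: measurableI.
pose c := bavg m z; pose h y := (`|b y - c|)%:E : \bar R.
have h0 y : 0 <= h y by rewrite lee_fin.
have Q1 := us_Q1 us.
have c00 : (0 < c0)%R by rewrite /c0 !mulr_gt0// (Q0 us).
have Kc0 : (2 * K <= c0)%R.
  by rewrite /c0 mulrAC -[leLHS]mulr1 ler_wpM2l ?mulr_ge0 ?ltW.
have c0k : (c0 <= k.+1%:R * c0)%R by rewrite ler_peMl ?ler1n// ltW.
have boscE g x : ball z m x -> bosc m g x = Ea h g x.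
  by move=> zx; rewrite /bosc -(bavg_ball zx).
pose Z (n : nat) := ball z m `&` [set x | (2 * K)%:E < Ea h (m - n%:Z) x].
have iZ n : binv ball (m - n%:Z) (Z n).
  move=> x y [zx Zx] xy; split; last by rewrite /= -(Ea_ball us _ xy).
  by rewrite -(us_eq us zx); apply: (us_le us _ xy); lia.
have TZ : T `<=` \bigcup_n Z n.
  move=> x [zx /= /ereal_sup_gt[_ [g gm <-]]]; rewrite boscE// => lt.
  exists `|m - g|%N => //; split => //=.
  have -> : (m - `|m - g|%N%:Z = g)%R by move: gm => /=; lia.
  by apply: le_lt_trans lt; rewrite lee_fin (le_trans Kc0).
have -> : mu T = \int[mu]_(x in \bigcup_n Z n) (\1_T x)%:E.
  rewrite integral_indic//; last first.
    by apply: bigcupT_measurable => n; exact: (binv_measurable us (iZ n)).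
  by congr (mu _); apply/seteqP; split => x; [move=> Tx; split => //; exact: TZ|case].
(* On a stopping ball of level [i] the induction hypothesis gives [(2 ^+ k)^-1 * Q ^ i], and
   [2 * K * Q ^ i] is less than the integral of [h] there. *)
pose e := ((2 ^+ k)^-1 * (2 * K)^-1)%R.
have e0 : (0 <= e)%R by rewrite mulr_ge0 ?invr_ge0 ?exprn_ge0 ?mulr_ge0// ltW.
apply: (@le_trans _ _ (\int[mu]_(x in \bigcup_n Z n) (e%:E * h x))).
  apply: (stop_le us iZ).
  - by move=> i j ij; lia.
  - by [].
  - by move=> x; rewrite mule_ge0// lee_fin.
  - by apply/measurable_EFinP; exact: measurable_indic.
  - by apply: measurable_funeM; exact: mbc.
  move=> n x [zx /= Znx] first.
  have hx : Ea h m x <= K%:E by rewrite -boscE.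
  (* The initial ball is not selected, so each selected ball has a parent that was examined and
     rejected. *)
  have n0 : (0 < n)%N.
    case: n Znx {first} => // ; rewrite subr0 => /lt_le_trans/(_ hx).
    by rewrite lte_fin ltNge ler_peMl ?ler1n// ltW.
  set i := (m - n%:Z)%R in Znx *.
  have im : (i <= m)%R by rewrite /i lerBlDr lerDl.
  have nZ g y : ball x i y -> (i < g)%R -> (g <= m)%R -> Ea h g y <= (2 * K)%:E.
    move=> xy ig gm; rewrite leNgt; apply/negP => lt.
    apply: (first `|m - g|%N); first by rewrite /i in ig; lia.
    split => //=; have -> : (m - `|m - g|%N%:Z = g)%R by lia.
    by rewrite (Ea_ball us _ (y := y))//; apply: (us_le us _ xy); exact: ltW.
  rewrite integral_indic//.
  apply: (@le_trans _ _ ((2 ^+ k)^-1 * Q ^ i)%:E).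
    apply: le_trans (ih x i); apply: le_measure; rewrite ?inE; [exact: measurableI..|].
    move=> y [[zy /= /ereal_sup_gt[_ [g gm <-] lt]] xy].
    move: lt; rewrite boscE// => lt; split => //=.
    have gi : (g <= i)%R.
      rewrite leNgt; apply/negP => ig; move: lt.
      rewrite ltNge => /negP; apply; apply: (le_trans (nZ _ _ xy ig gm)).
      by rewrite lee_fin (le_trans Kc0).
    have ci : `|bavg i y - c|%:E <= c0%:E.
      apply: (le_trans (bavg_dist _ _ _)); rewrite -/h.
      apply: (le_trans (Ea_parent _ _ _ _)) => //; first exact: mbc.
      rewrite /c0 mulrAC mulrC EFinM; apply: lee_wpmul2l.
        by rewrite lee_fin ltW// (Q0 us).
      by apply: nZ => //; rewrite /i; lia.
    apply: (@lt_le_trans _ _ (bosc i g y)); last first.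
      by apply: ereal_sup_ubound; exists g.
    have := lt_le_trans lt (Ea_shift g y (bavg i y) c).
    move=> /lt_le_trans/(_ (leeD2l _ ci)).
    by rewrite -natr1 mulrDl mul1r EFinD lteD2rE.
  rewrite ge0_integralZl//; last exact/measurable_funTS/mbc.
  rewrite /e [X in _ <= X * _]EFinM -muleA [leLHS]EFinM; apply: lee_wpmul2l.
    by rewrite lee_fin invr_ge0 exprn_ge0.
  rewrite (_ : (Q ^ i)%:E = ((2 * K)^-1)%:E * (2 * K * Q ^ i)%:E); last first.
    by rewrite -EFinM mulrA mulVf ?mul1r// gt_eqF// mulr_gt0.
  apply: lee_wpmul2l; first by rewrite lee_fin invr_ge0 mulr_ge0// ltW.
  by apply: ltW; rewrite -(Ea_ltP us).
apply: (@le_trans _ _ (\int[mu]_(x in ball z m) (e%:E * h x))).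
  apply: ge0_subset_integral => //.
  - by apply: bigcupT_measurable => n; exact: (binv_measurable us (iZ n)).
  - by apply: measurable_funTS; apply: measurable_funeM; exact: mbc.
  - by move=> x _; rewrite mule_ge0// lee_fin.
  - by move=> x [n _ []].
rewrite ge0_integralZl//; last exact/measurable_funTS/mbc.
rewrite (Ea_int us) muleA.
apply: (@le_trans _ _ (e%:E * (Q ^ m)%:E * K%:E)).
  apply: lee_wpmul2l; last exact: bK.
  by rewrite -EFinM lee_fin mulr_ge0//ltW// Qg0.
rewrite -!EFinM lee_fin /e exprS.
rewrite le_eqVlt; apply/orP; left; apply/eqP; field.
by rewrite !gt_eqF// exprn_gt0.
Qed.

End BMO.

Lemma ler_powR2 {R : realType} (a a' t : R) :
  0 <= t -> 0 <= a -> a <= a' -> a `^ t <= a' `^ t.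
Proof.
by move=> t0 a0 aa'; apply: ge0_ler_powR; rewrite ?nnegrE//; exact: le_trans aa'.
Qed.

Lemma powR_le_exp {R : realType} (th A N : R) : 1 < th -> 0 <= A -> 0 < N ->
  exists2 C, 0 <= C & forall k : nat, (A * k%:R) `^ N <= C * th ^+ k.
Proof.
move=> th1 A0 N0; pose t : R := ln th / N.
have t0 : 0 < t by rewrite divr_gt0// ln_gt0.
exists ((A / t) `^ N); first exact: powR_ge0.
move=> k; have -> : th ^+ k = expR (k%:R * t) `^ N :> R.
  have e : expR (ln th) = th :> R by rewrite lnK// posrE; lra.
  by rewrite -expRM /t -mulrA divfK ?gt_eqF// -{1}e -expRM_natr mulrC.
have At0 : 0 <= A / t by rewrite divr_ge0// ltW.
rewrite -powRM ?expR_ge0//; apply: ler_powR2; [exact: ltW|by rewrite mulr_ge0|].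
rewrite -mulrA ler_wpM2l// mulrC ler_pdivlMr// (le_trans _ (expR_ge1Dx _))//.
by rewrite lerDr.
Qed.

Lemma sum_geom34 {R : realType} n : \sum_(0 <= k < n) (3 / 4) ^+ k <= 4 :> R.
Proof.
suff -> : \sum_(0 <= k < n) (3 / 4) ^+ k = 4 - 4 * (3 / 4) ^+ n :> R.
  by rewrite gerBl mulr_ge0// exprn_ge0//; lra.
elim: n => [|n ih]; first by rewrite big_geq// expr0; lra.
by rewrite big_nat_recr//= ih exprS; lra.
Qed.

(** * The Carleson condition for the weights of a BMO function *)

Section BMO.
Context {R : realType} {d} {X : measurableType d}.
Variables (mu : {measure set X -> \bar R}) (ball : X -> int -> set X) (Q : R).
Hypothesis us : ultra_space mu ball Q.
Variable b : X -> R.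
Hypothesis mb : measurable_fun setT b.
Hypothesis ib : forall x g, mu.-integrable (ball x g) (EFin \o b).
Variable K : R.
Hypothesis K0 : 0 < K.
Hypothesis bK : forall x g, (bosc mu ball Q b g g x <= K%:E)%E.

Local Open Scope ereal_scope.
Let mB x g := us_meas us x g.
Let Qg0 g := Qg0 us g.
Notation bavg := (bavg mu ball Q b).
Notation bosc := (bosc mu ball Q b).
Notation bosc_max := (bosc_max mu ball Q b).

Definition bweight (N : R) (g : int) (x : X) : \bar R :=
  ((1 + `|b x - bavg g x|) `^ N)%:E.

Lemma bweight_measurable N g : measurable_fun setT (bweight N g).
Proof.
apply/measurable_EFinP.
apply: (measurableT_comp (measurable_powR _)).
apply: measurable_funD => //; apply: measurableT_comp => //.
apply: measurable_funB => //; apply: (locconst_measurable us (g := g)) => x y.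
exact: bavg_ball.
Qed.

(** For almost every [x] the function [bosc_max m] controls both [|b x - b_m|] (up to [1], by
    differentiation) and all [|b_g - b_m|]. The supremum of the weights is thus a power of
    [bosc_max], whose level sets decay geometrically. *)
Lemma carleson_bmo (N : R) : (1 <= N)%R -> exists2 C, (0 <= C)%R & forall z m,
  \int[mu]_(x in ball z m) ereal_sup [set bweight N g x | g in [set g | (g <= m)%R]]
   <= (C * Q ^ m)%:E.
Proof.
move=> N1; have N0 : (0 < N)%R by lra.
set c0 := (2 * Q * K)%R.
have c00 : (0 < c0)%R by rewrite /c0 !mulr_gt0// (Q0 us).
pose A := (2 + 2 * c0)%R; have A0 : (0 <= A)%R by rewrite /A; lra.
have A1 : (1 <= A)%R by rewrite /A; lra.
(* Any base between 1 and 2 would do: growth [(3 / 2) ^+ k] against decay [2 ^- k] leaves a series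
   of ratio [3 / 4]. *)
have [|C C0 CP] := @powR_le_exp R (3 / 2) A N _ A0 N0; first by lra.
exists (2 * C * (3 / 2) * 4)%R; first by rewrite !mulr_ge0//; lra.
move=> z m.
(* The shift by one makes [D 0] the whole space, so that points with [bosc_max] equal to 0 are
   covered despite the strict inequality. *)
pose D k := if k is k'.+1 then [set x | (k'%:R * c0)%:E < bosc_max m x] else setT.
have mL k : measurable [set x | (k%:R * c0)%:E < bosc_max m x].
  rewrite -[X in measurable X]setTI; apply: emeasurable_fun_o_infty => //.
  exact: (bosc_max_measurable us).
have mD k : measurable (D k) by case: k => [|k]; [exact: measurableT|exact: mL].
have muD k : mu (ball z m `&` D k) <= (2 * (2 ^+ k)^-1 * Q ^ m)%:E.
  case: k => [|k] /=.
    rewrite setIT (us_mu us) lee_fin expr0 invr1 mulr1 ler_peMl//; last by lra.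
    exact/ltW/Qg0.
  apply: (le_trans (john_nirenberg us mb ib K0 bK k z m)); rewrite lee_fin.
  by rewrite exprS invfM mulrA divff// mul1r.
pose T k x : \bar R := ((A * k.+1%:R) `^ N * \1_(D k) x)%:E.
have T0 k x : 0 <= T k x by rewrite lee_fin mulr_ge0// powR_ge0.
have mT k : measurable_fun setT (T k).
  apply/measurable_EFinP; apply: measurable_funM => //.
have mTS : measurable_fun setT (fun x => \sum_(k <oo) T k x).
  by apply: ge0_emeasurable_sum => //.
have TS k x : D k x -> ((A * k.+1%:R) `^ N)%:E <= \sum_(k <oo) T k x.
  move=> Dx; apply: le_trans (nneseries_ge_term k _); last by [].
  by rewrite /T indicE mem_set// mulr1.
apply: (@le_trans _ _ (\int[mu]_(x in ball z m) \sum_(k <oo) T k x)).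
  apply: le_int_ae => //.
  - move=> x _; apply: (@le_trans _ _ (bweight N m x)).
      by rewrite lee_fin powR_ge0.
    by apply: ereal_sup_ubound; exists m => /=.
  - by move=> x _; exact: nneseries_ge0.
  - exact: measurable_funTS.
  pose h y := (`|b y - bavg m z|)%:E : \bar R.
  have mh : measurable_fun setT h.
    by apply/measurable_EFinP; apply: measurableT_comp => //; exact: measurable_funB.
  have h0 y : 0 <= h y by rewrite lee_fin.
  have := ae_le_maximal us z m h0 mh; apply: filterS => x + zx => /(_ zx).
  have bE g : Ea mu ball Q h g x = bosc m g x.
    by rewrite /bosc -(bavg_ball us b zx).
  rewrite (_ : [set Ea mu ball Q h g x | g in _] = [set bosc m g x | g in [set g | (g <= m)%R]]); last first.
    by apply/seteqP; split => _ [g gm <-]; exists g; rewrite ?bE.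
  rewrite -/(bosc_max m x) => hx.
  have W1 g : (g <= m)%R -> `|bavg g x - bavg m x|%:E <= bosc_max m x.
    move=> gm; apply: (le_trans (bavg_dist us mb ib g x _)).
    by apply: ereal_sup_ubound; exists g.
  apply: ge_ereal_sup => _ [g gm <-].
  case sE : (bosc_max m x) => [s| |]; last first.
  - by have := W1 _ (lexx m); rewrite sE leeNy_eq.
  (* Where [bosc_max] is infinite every term of the series is present, and a late enough one exceeds
     the weight. *)
  - pose w := ((1 + `|b x - bavg g x|) `^ N)%R.
    apply: le_trans (TS (Num.truncn w).+1 x _); last by rewrite /= sE ltry.
    rewrite lee_fin (@le_trans _ _ (A * (Num.truncn w).+2%:R)%R)//; last first.
      by apply: le1r_powR => //; rewrite -[leLHS]mulr1 ler_pM// ler1n.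
    rewrite -[leLHS]mul1r ler_pM// ?powR_ge0// ltW// (lt_trans (truncnS_gt _))//.
    by rewrite ltr_nat.
  have s0 : (0 <= s)%R.
    by rewrite -lee_fin -sE; apply: le_trans (W1 _ (lexx m)); rewrite lee_fin.
  pose k := Num.truncn (s / c0).
  have /andP[k1 k2] : (k%:R <= s / c0 < k.+1%:R)%R.
    by apply: truncn_itv; rewrite divr_ge0// ltW.
  apply: le_trans (TS k x _); last first.
    rewrite /D; case: k k1 {k2} => [//|k k1] /=; rewrite sE lte_fin.
    move: k1; rewrite ler_pdivlMr//; apply: lt_le_trans.
    by rewrite ltr_pM2r// ltr_nat.
  rewrite lee_fin; apply: ler_powR2; first exact: ltW.
    by rewrite addr_ge0.
  have h1 : (`|b x - bavg m x| <= s + 1)%R.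
    by rewrite -lee_fin EFinD -sE -(bavg_ball us b zx).
  have h2 : (`|bavg m x - bavg g x| <= s)%R by rewrite distrC -lee_fin -sE; exact: W1.
  have h3 : (`|b x - bavg g x| <= (s + 1) + s)%R.
    rewrite (le_trans _ (lerD h1 h2))// (le_trans _ (ler_normD _ _))//.
    by rewrite addrA subrK.
  apply: (@le_trans _ _ (2 + 2 * (c0 * k.+1%:R))%R).
    by move: k2; rewrite ltr_pdivrMr// => k2; rewrite [(c0 * _)%R]mulrC; lra.
  have k3 : (1 <= k.+1%:R :> R)%R by rewrite ler1n.
  rewrite /A mulrDl; lra.
rewrite integral_nneseries//; last by move=> n; exact: measurable_funTS.
have IT k : \int[mu]_(x in ball z m) T k x <= (2 * C * (3 / 2) * (3 / 4) ^+ k * Q ^ m)%:E.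
  rewrite /T; under eq_integral do rewrite EFinM.
  rewrite ge0_integralZl ?lee_fin ?powR_ge0//; last first.
    by apply/measurable_EFinP; exact: measurable_indic.
  rewrite integral_indic// setIC.
  apply: (@le_trans _ _ ((C * (3 / 2) ^+ k.+1)%:E * (2 * (2 ^+ k)^-1 * Q ^ m)%:E)).
    by apply: lee_pmul => //; rewrite lee_fin ?powR_ge0.
  rewrite -EFinM lee_fin le_eqVlt; apply/orP; left; apply/eqP.
  have -> : ((3 / 4) ^+ k = (3 / 2) ^+ k / 2 ^+ k :> R)%R.
    by rewrite -expr_div_n; congr (_ ^+ _)%R; field.
  by rewrite exprS; ring.
apply: nneseries_le_bound => [n|n]; first exact: integral_ge0.
apply: (@le_trans _ _ (\sum_(0 <= k < n) (2 * C * (3 / 2) * (3 / 4) ^+ k * Q ^ m)%:E)).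
  by apply: lee_sum => k _; exact: IT.
rewrite sumEFin lee_fin -mulr_suml; apply: ler_wpM2r; first exact/ltW/Qg0.
rewrite -mulr_sumr; apply: ler_wpM2l; last exact: sum_geom34.
by rewrite !mulr_ge0//; lra.
Qed.

End BMO.

Lemma exprn_unbounded {R : realType} (q : R) : 1 < q ->
  forall Y : R, exists n : nat, Y <= q ^+ n.
Proof.
move=> q1 Y; have bern n : 1 + n%:R * (q - 1) <= q ^+ n.
  elim: n => [|n ih]; first by rewrite mul0r addr0 expr0.
  rewrite exprS -natr1; have n0 : 0 <= n%:R :> R by [].
  have : q * (1 + n%:R * (q - 1)) <= q * q ^+ n by rewrite ler_pM2l//; lra.
  apply: le_trans; rewrite -subr_ge0.
  rewrite (_ : _ - _ = n%:R * (q - 1) ^+ 2); last by ring.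
  by rewrite mulr_ge0// sqr_ge0.
exists (Num.truncn (Y / (q - 1))).+1; apply: le_trans (bern _).
have : Y / (q - 1) < (Num.truncn (Y / (q - 1))).+1%:R by exact: truncnS_gt.
by rewrite ltr_pdivrMr ?subr_gt0// => /ltW h; rewrite (le_trans h)// lerDr.
Qed.

Lemma sum_geom_below {R : realType} (th Y : R) (a : nat -> R) n : 1 < th -> 0 <= Y ->
  (forall j, 0 < a j) -> (forall j, a j.+1 = th * a j) ->
  \sum_(0 <= j < n) (if a j < Y then a j else 0) <= Y * th / (th - 1).
Proof.
move=> th1 Y0 a0 aS; have th10 : 0 < th - 1 by lra.
have S m : \sum_(0 <= j < m) a j <= a m / (th - 1).
  elim: m => [|m ih]; first by rewrite big_geq// divr_ge0// ltW.
  rewrite big_nat_recr//= aS -lerBrDr; apply: (le_trans ih).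
  rewrite le_eqVlt; apply/orP; left; apply/eqP; field; lra.
elim: n => [|n ih]; first by rewrite big_geq// divr_ge0 ?mulr_ge0// ltW//; lra.
rewrite big_nat_recr//=; case: ifPn => [aY|_]; last by rewrite addr0.
apply: (@le_trans _ _ (a n.+1 / (th - 1))).
  apply: le_trans (S n.+1); rewrite big_nat_recr//= lerD2r; apply: ler_sum => j _.
  by case: ifP => // _; exact: ltW.
by rewrite aS ler_pM2r ?invr_gt0// mulrC ler_pM2r ?ltW//; lra.
Qed.

(** Rearranges the folded sum over the integers into one whose consecutive terms keep a constant
    ratio, as [sum_geom_below] requires. *)
Lemma sum_int_sym {V : nmodType} (T : int -> V) n :
  \sum_(0 <= i < n) (T (Posz i) + T (Negz i)) = \sum_(0 <= j < n + n) T (j%:Z - n%:Z)%R.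
Proof.
elim: n => [|n ih]; first by rewrite !big_geq.
rewrite big_nat_recr//= ih addSn addnS big_nat_recr//= big_nat_recl//=.
rewrite addrA addrC addrA; congr (_ + _ + _).
- by congr T; lia.
- by apply: eq_bigr => j _; congr T; lia.
- by congr T; lia.
Qed.

(** * The Carleson embedding theorem *)

Section Carleson.
Context {R : realType} {d} {X : measurableType d}.
Variables (mu : {measure set X -> \bar R}) (ball : X -> int -> set X) (Q : R).
Hypothesis us : ultra_space mu ball Q.
Variables (W : int -> X -> \bar R) (K rho : R).
Hypothesis W0 : forall g x, (0 <= W g x)%E.
Hypothesis mW : forall g, measurable_fun setT (W g).
Hypothesis K0 : 0 <= K.
Hypothesis rho1 : 1 < rho.
Hypothesis WK : forall z m,
  (\int[mu]_(x in ball z m) ereal_sup [set W g x | g in [set g | (g <= m)%R]]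
    <= (K * Q ^ m)%:E)%E.

Local Open Scope ereal_scope.
Let mB x g := us_meas us x g.
Let Qg0 g := Qg0 us g.
Let rho_gt0 : (0 < rho)%R := lt_trans ltr01 rho1.
Let rho1_ge0 : (0 <= rho - 1)%R. Proof. by rewrite subr_ge0 ltW. Qed.
Notation Ea := (Ea mu ball Q).

Section FixG.
Variable G : X -> R.
Hypothesis G0 : forall x, (0 <= G x)%R.
Hypothesis mG : measurable_fun setT G.
Hypothesis IG : \int[mu]_x (G x `^ rho)%:E < +oo.

Let EG g x := Ea (fun y => (G y)%:E) g x.

Let mGE : measurable_fun setT (fun y => (G y)%:E).
Proof. exact/measurable_EFinP. Qed.

Let mGr : measurable_fun setT (fun y => (G y `^ rho)%:E).
Proof. by apply/measurable_EFinP; exact: (measurableT_comp (measurable_powR _)). Qed.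

Let EG0 g x : 0 <= EG g x.
Proof. by apply: (Ea_ge0 us) => y; rewrite lee_fin. Qed.

(** From [G <= s + s ^ (1 - rho) * G ^ rho] the averages are small on all sufficiently large balls.
    This is why largest balls on which the average exceeds [t] exist. *)
Let EG_small (t : R) : (0 < t)%R -> exists m : int, forall j x, (m <= j)%R ->
  EG j x <= t%:E.
Proof.
move=> t0; pose s := (t / 2)%R; have s0 : (0 < s)%R by rewrite divr_gt0.
pose c := (s `^ (1 - rho))%R; have c0 : (0 <= c)%R by exact: powR_ge0.
pose I := fine (\int[mu]_x (G x `^ rho)%:E).
have IE : \int[mu]_x (G x `^ rho)%:E = I%:E.
  rewrite fineK// ge0_fin_numE//; apply: integral_ge0 => x _.
  by rewrite lee_fin powR_ge0.
have [n Yn] := exprn_unbounded (us_Q1 us) (c * I / s)%R.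
exists n%:Z => j x nj; rewrite (Ea_leP us).
have Gc y : (G y <= s + c * G y `^ rho)%R.
  have [Gs|sG] := leP (G y) s; first by rewrite ler_wpDr// mulr_ge0// powR_ge0.
  have Gy0 : (0 < G y)%R by exact: lt_trans sG.
  apply: ler_wpDl; first exact: ltW.
  rewrite -[leLHS](powRr1 (G0 y)) (_ : 1 = (1 - rho) + rho)%R; last by rewrite subrK.
  rewrite powRD; last by rewrite (gt_eqF Gy0) implybT.
  rewrite ler_wpM2r ?powR_ge0// /c -[(1 - rho)%R]opprK opprB !powRN lef_pV2 ?posrE ?powR_gt0//.
  apply: ler_powR2; [by rewrite subr_ge0 ltW|exact: ltW|exact: ltW].
apply: (@le_trans _ _ (\int[mu]_(y in ball x j) (s%:E + c%:E * (G y `^ rho)%:E))).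
  by apply: le_int => y _; rewrite -?EFinM -?EFinD lee_fin.
rewrite ge0_integralD//; last 3 first.
- by move=> y _; rewrite lee_fin ltW.
- by move=> y _; rewrite -EFinM lee_fin mulr_ge0// powR_ge0.
- exact/measurable_funTS/measurable_funeM.
rewrite (int_ball_cst us) ge0_integralZl//; last 2 first.
- exact: measurable_funTS.
- by move=> y _; rewrite lee_fin powR_ge0.
apply: (@le_trans _ _ ((s * Q ^ j)%:E + c%:E * I%:E)).
  apply: leeD2l; apply: lee_wpmul2l; rewrite ?lee_fin// -IE.
  by apply: ge0_subset_integral => // y _; rewrite lee_fin powR_ge0.
rewrite -EFinM -EFinD lee_fin.
have : (c * I <= s * Q ^ j)%R.
  rewrite -ler_pdivrMl// mulrC (le_trans Yn)// exprnP.
  by apply: ler_weXz2l nj; rewrite ltW// (us_Q1 us).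
have ts : (t = s + s)%R by rewrite /s; field.
by move=> h; rewrite [in leRHS]ts mulrDl lerD2l.
Qed.

Let V (t : R) (x : X) : \bar R :=
  ereal_sup [set W g x * (\1_[set y : X | (t%:E < EG g y)%E] x)%:E | g in [set: int]].

Let mlev (t : R) g : measurable [set y : X | (t%:E < EG g y)%E].
Proof.
rewrite -[X in measurable X]setTI; apply: emeasurable_fun_o_infty => //.
exact: Ea_measurable.
Qed.

Let mV t : measurable_fun setT (V t).
Proof.
apply: measurable_ereal_sup_int => g _; apply: emeasurable_funM => //.
by apply/measurable_EFinP; exact: measurable_indic.
Qed.

Let V0 t x : 0 <= V t x.
Proof.
apply: (@le_trans _ _ (W 0 x * (\1_[set y : X | (t%:E < EG 0%R y)%E] x)%:E)).
  by rewrite mule_ge0// lee_fin.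
by apply: ereal_sup_ubound; exists 0%R.
Qed.

(* Stopping at the largest balls on which the average of [G] exceeds [t]. *)
Let VK (t : R) : (0 < t)%R -> \int[mu]_x V t x <=
  \int[mu]_x (2 * K / t * (if (t / 2 < G x)%R then G x else 0))%:E.
Proof.
move=> t0; have [m mt] := EG_small t0.
pose Gt x := (if (t / 2 < G x)%R then G x else 0)%R.
have Gt0 x : (0 <= Gt x)%R by rewrite /Gt; case: ifP.
have mGt : measurable_fun setT Gt.
  by apply: measurable_fun_ifT => //; exact: measurable_fun_ltr.
pose Z (n : nat) := [set x | t%:E < EG (m - n%:Z) x].
have iZ n : binv ball (m - n%:Z) (Z n).
  by move=> x y; rewrite /Z/= /EG => Zx xy; rewrite -(Ea_ball us _ xy).
have mZ : measurable (\bigcup_n Z n) by apply: bigcupT_measurable => n; exact: mlev.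
have VZ x : ~ (\bigcup_n Z n) x -> V t x = 0.
  move=> nZ; apply/eqP; rewrite eq_le V0 andbT; apply: ge_ereal_sup => _ [g _ <-].
  rewrite indicE memNset ?mule0//= => lt.
  have gm : (g < m)%R.
    by rewrite ltNge; apply/negP => mg; move: lt; rewrite ltNge (mt _ _ mg).
  apply: nZ; exists `|m - g|%N => //=; rewrite /Z/=.
  by have -> : (m - `|m - g|%N%:Z = g)%R by lia.
have -> : \int[mu]_x V t x = \int[mu]_(x in \bigcup_n Z n) V t x.
  rewrite [RHS]integral_mkcond; apply: eq_integral => x _; rewrite patchE.
  by case: ifPn => // /negP nx; rewrite VZ// => Zx; apply: nx; rewrite inE.
pose H' x := (2 * K / t * Gt x)%:E : \bar R.
have H'0 x : 0 <= H' x.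
  by rewrite lee_fin mulr_ge0// divr_ge0 ?mulr_ge0// ltW.
have mH' : measurable_fun setT H'.
  by apply/measurable_EFinP; apply: measurable_funM.
apply: (@le_trans _ _ (\int[mu]_(x in \bigcup_n Z n) H' x)); last first.
  by apply: ge0_subset_integral.
apply: (stop_le us iZ) => //.
  by move=> i j ij; lia.
move=> n x Znx first; set i := (m - n%:Z)%R in Znx *.
apply: (@le_trans _ _ (K * Q ^ i)%:E).
  apply: le_trans (WK x i); apply: le_int => [y _|y xy]; first exact: V0.
  have S0 : 0 <= ereal_sup [set W g y | g in [set g | (g <= i)%R]].
    by apply: le_trans (W0 i y) _; apply: ereal_sup_ubound; exists i => /=.
  apply: ge_ereal_sup => _ [g _ <-]; rewrite indicE.
  have [lt|nlt] := pselect (t%:E < EG g y); last by rewrite memNset// mule0.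
  rewrite mem_set// mule1; apply: ereal_sup_ubound; exists g => //=.
  rewrite leNgt; apply/negP => ig.
  have gm : (g < m)%R.
    by rewrite ltNge; apply/negP => mg; move: lt; rewrite ltNge (mt _ _ mg).
  apply: (first `|m - g|%N); first by rewrite /i in ig; lia.
  rewrite /Z/=; have -> : (m - `|m - g|%N%:Z = g)%R by lia.
  by rewrite /EG (Ea_ball us _ (y := y))//; apply: (us_le us _ xy); exact: ltW.
(* The values of [G] at most [t / 2] account for at most half of an average exceeding [t], so the
   truncation keeps the other half. *)
have h1 : (Q ^ i)%:E <= (2 / t)%:E * \int[mu]_(y in ball x i) (Gt y)%:E.
  have : (t * Q ^ i)%:E <= (t / 2 * Q ^ i)%:E + \int[mu]_(y in ball x i) (Gt y)%:E.
    rewrite -(int_ball_cst us x i (t / 2)) -ge0_integralD//; last 3 first.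
    - by move=> y _; rewrite lee_fin divr_ge0// ltW.
    - by move=> y _; rewrite lee_fin.
    - exact/measurable_funTS/measurable_EFinP.
    apply: (@le_trans _ _ (\int[mu]_(y in ball x i) (G y)%:E)).
      by apply: ltW; rewrite -(Ea_ltP us).
    apply: le_int => y _; first by rewrite lee_fin.
    rewrite /= -EFinD lee_fin /Gt.
    by case: ltP => h; rewrite ?addr0// ler_wpDl// divr_ge0// ltW.
  case: (\int[mu]_(y in ball x i) (Gt y)%:E) => [I| |].
  - rewrite -EFinD !lee_fin => h; rewrite -ler_pdivrMl ?divr_gt0// invf_div mulrAC.
    by move: h; rewrite -mulrA mulrCA; lra.
  - by move=> _; rewrite gt0_muley ?leey// lte_fin divr_gt0.
  - by rewrite addeNy leeNy_eq.
rewrite /H'; under [leRHS]eq_integral do rewrite EFinM.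
rewrite ge0_integralZl ?lee_fin ?divr_ge0 ?mulr_ge0 ?(ltW t0)//; last 2 first.
- exact/measurable_funTS/measurable_EFinP.
- by move=> y _; rewrite lee_fin.
rewrite (_ : 2 * K / t = K * (2 / t))%R; last by rewrite mulrA [(K * 2)%R]mulrC.
by rewrite !EFinM -muleA; apply: lee_wpmul2l; rewrite ?lee_fin.
Qed.

Let tk (k : int) : R := expR k%:~R.
Let term (k : int) x : \bar R := (expR (rho * (k%:~R + 1)))%:E * V (tk k) x.

Let term0 k x : 0 <= term k x.
Proof. by rewrite mule_ge0// lee_fin expR_ge0. Qed.

(** Layer cake over the heights [e ^ k]: an average in []e ^ k, e ^ (k + 1)]] is dominated by the
    [k]-th term. The sum over the integers is folded into a series over the naturals. *)
Let sup_le_terms x : 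
  ereal_sup [set W g x * (EG g x) `^ rho | g in [set: int]] <=
  \sum_(i <oo) (term (Posz i) x + term (Negz i) x).
Proof.
have rho0 : (rho != 0)%R by rewrite gt_eqF.
apply: ge_ereal_sup => _ [g _ <-].
have EGfin : EG g x < +oo.
  have [m mt] := EG_small (@ltr01 R).
  case: (leP m g) => [mg|gm]; first by apply: le_lt_trans (mt _ x mg) _; rewrite ltry.
  have := mt m x (lexx _); rewrite (Ea_leP us) => h.
  rewrite /EG/Ea lte_mul_pinfty// ?lee_fin ?invr_ge0 ?(ltW (Qg0 g))//.
  apply: (@le_lt_trans _ _ (1 * Q ^ m)%:E); last by rewrite ltry.
  apply: le_trans h; apply: ge0_subset_integral => //.
  - exact: measurable_funTS.
  - by move=> y _; rewrite lee_fin.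
  - exact/(us_le us)/ltW.
move: EGfin (EG0 g x); case aE : (EG g x) => [a| |]// _; rewrite lee_fin => a0.
have [->|an0] := eqVneq a 0%R.
  rewrite poweR0r// mule0; apply: nneseries_ge0 => n _ _; exact: adde_ge0.
have {an0}a0 : (0 < a)%R by rewrite lt_neqAle eq_sym an0.
(* The ceiling minus one, and not the floor: [V (tk k)] sees only averages strictly above
   [e ^ k]. *)
pose k := (Num.ceil (ln a) - 1)%R.
have /andP[k1 k2] : (k%:~R < ln a <= k%:~R + 1)%R.
  by have := ceil_itv (ln a); rewrite /k intrD/= subrK.
apply: (@le_trans _ _ (term k x)); last first.
  pose u i := term (Posz i) x + term (Negz i) x.
  have u0 i : 0 <= u i by exact: adde_ge0.
  case: k {k1 k2} => i; apply: le_trans (nneseries_ge_term i u0).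
    by rewrite leeDl.
  by rewrite leeDr.
rewrite /term muleC; apply: lee_pmul => //; first exact: poweR_ge0.
  rewrite poweR_EFin lee_fin mulrC expRM; apply: ler_powR2; [exact: ltW|exact: ltW|].
  by rewrite -[leLHS]lnK ?posrE// ler_expR.
apply: ereal_sup_ubound; exists g => //.
rewrite indicE mem_set ?mule1//= aE lte_fin -[ltRHS]lnK ?posrE//.
by rewrite ltr_expR.
Qed.

(** After [VK] a point is counted at the heights [e ^ k < 2 * G x], with coefficient proportional to
    [e ^ ((rho - 1) * k) * G x]. As [rho > 1], this geometric sum is comparable to its largest term,
    [(2 * G x) ^ (rho - 1) * G x]. *)
Lemma carleson_embedding_fixed :
  \int[mu]_x ereal_sup [set W g x * (EG g x) `^ rho | g in [set: int]] <=
  (2 * K * expR rho * (2 `^ (rho - 1) * expR (rho - 1) / (expR (rho - 1) - 1)))%:E *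
   \int[mu]_x (G x `^ rho)%:E.
Proof.
set th := expR (rho - 1); have th1 : (1 < th)%R by rewrite expR_gt1 subr_gt0.
set c := (2 * K * expR rho)%R; have c0 : (0 <= c)%R by rewrite !mulr_ge0// expR_ge0.
pose al (k : int) := (expR ((rho - 1) * k%:~R))%R.
pose s (k : int) x := (c * G x * (if al k < (2 * G x) `^ (rho - 1) then al k else 0))%R.
have al0 k : (0 < al k)%R by exact: expR_gt0.
have s0 k x : (0 <= s k x)%R.
  by rewrite mulr_ge0 ?mulr_ge0//; case: ifP => // _; exact: ltW.
have ms k : measurable_fun setT (s k).
  apply: measurable_funM; first exact: measurable_funM.
  apply: measurable_fun_ifT => //; apply: measurable_fun_ltr => //.
  by apply: (measurableT_comp (measurable_powR _)); exact: measurable_funM.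
have mterm k : measurable_fun setT (term k) by apply: measurable_funeM; exact: mV.
have ts k : \int[mu]_x term k x <= \int[mu]_x (s k x)%:E.
  rewrite /term ge0_integralZl ?lee_fin ?expR_ge0//.
  apply: (@le_trans _ _ ((expR (rho * (k%:~R + 1)))%:E *
     \int[mu]_x (2 * K / tk k * (if (tk k / 2 < G x)%R then G x else 0))%:E)).
    by apply: lee_wpmul2l; [rewrite lee_fin expR_ge0|apply: VK; exact: expR_gt0].
  rewrite -ge0_integralZl ?lee_fin ?expR_ge0//; last 2 first.
  - apply/measurable_EFinP; apply: measurable_funM => //.
    by apply: measurable_fun_ifT => //; exact: measurable_fun_ltr.
  - move=> x _; rewrite lee_fin mulr_ge0//; last by case: ifP.
    by rewrite divr_ge0 ?mulr_ge0// expR_ge0.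
  apply: le_int => x _; rewrite -?EFinM ?lee_fin.
    rewrite mulr_ge0 ?expR_ge0// mulr_ge0//; last by case: ifP.
    by rewrite divr_ge0 ?mulr_ge0// expR_ge0.
  case: ifPn => h; last by rewrite !mulr0; exact: s0.
  rewrite /s ifT; last first.
    rewrite /al mulrC expRM -/(tk k); apply: gt0_ltr_powR; rewrite ?nnegrE ?subr_gt0//.
    - exact: expR_ge0.
    - by rewrite mulr_ge0.
    - by move: h; rewrite ltr_pdivrMr// mulrC.
  rewrite le_eqVlt; apply/orP; left; apply/eqP.
  have -> : (expR (rho * (k%:~R + 1)) = expR rho * (al k * tk k))%R.
    by rewrite /al /tk -!expRD; congr expR; ring.
  by rewrite /c; field; rewrite gt_eqF// expR_gt0.
apply: (@le_trans _ _ (\int[mu]_x \sum_(i <oo) (term (Posz i) x + term (Negz i) x))).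
  apply: le_int => x _; last exact: sup_le_terms.
  apply: (@le_trans _ _ (W 0 x * EG 0%R x `^ rho)).
    by rewrite mule_ge0// poweR_ge0.
  by apply: ereal_sup_ubound; exists 0%R.
rewrite integral_nneseries//; last 2 first.
- by move=> n; exact: emeasurable_funD.
- by move=> n x _; exact: adde_ge0.
apply: (@le_trans _ _ (\sum_(i <oo) \int[mu]_x ((s (Posz i) x)%:E + (s (Negz i) x)%:E))).
  apply: lee_nneseries => [i _ _|i _].
    by apply: integral_ge0 => x _; exact: adde_ge0.
  rewrite !ge0_integralD//; try by apply/measurable_EFinP; exact: ms.
  - exact: leeD.
  - by move=> x _; rewrite lee_fin.
  - by move=> x _; rewrite lee_fin.
rewrite -integral_nneseries//; last 2 first.
- by move=> n; apply: emeasurable_funD; apply/measurable_EFinP; exact: ms.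
- by move=> n x _; rewrite -EFinD lee_fin addr_ge0.
rewrite -ge0_integralZl//; last 2 first.
- by move=> x _; rewrite lee_fin powR_ge0.
- by rewrite lee_fin mulr_ge0// divr_ge0 ?mulr_ge0 ?powR_ge0 ?expR_ge0// ltW// subr_gt0.
apply: le_int => x _.
  by apply: nneseries_ge0 => n _ _; rewrite -EFinD lee_fin addr_ge0.
apply: nneseries_le_bound => [n|n]; first by rewrite -EFinD lee_fin addr_ge0.
under eq_bigr do rewrite -EFinD.
rewrite sumEFin (sum_int_sym (s^~ x)) -EFinM lee_fin -mulr_sumr.
have -> : (G x `^ rho = G x * G x `^ (rho - 1))%R.
  by rewrite mulr_powRB1.
have -> : (c * (2 `^ (rho - 1) * th / (th - 1)) * (G x * G x `^ (rho - 1)) =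
  c * G x * ((2 * G x) `^ (rho - 1) * th / (th - 1)))%R.
  by rewrite powRM//; ring.
apply: ler_wpM2l; first exact: mulr_ge0.
apply: (@sum_geom_below _ th ((2 * G x) `^ (rho - 1)) (fun j => al (j%:Z - n%:Z)%R)) => //.
  exact: powR_ge0.
move=> j; rewrite /al /th -expRD; congr expR.
have -> : (j.+1%:Z - n%:Z = 1 + (j%:Z - n%:Z))%R by lia.
by rewrite (intrD _ 1); ring.
Qed.

End FixG.

End Carleson.

(* [core_powR] below in logarithmic form, with [u = ln A], [G = g], [L = ln Q]. *)
Lemma core_exponent {R : realType} (beta q r m rho u G L kappa C1 cq : R) :
  q^-1 = r^-1 - beta -> 0 < q -> q <= cq -> 1 <= m -> m <= r -> 0 <= beta ->
  0 <= L -> 0 <= kappa -> 0 <= C1 ->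
  rho * u + G * L <= kappa -> (G < 0 -> - G * (r - m) <= C1) ->
  q * (beta * (G * L) + u * (rho / m)) <= rho * u + cq * (kappa + L * C1).
Proof.
move=> qr q0 qcq m1 mr beta0 L0 k0 C10 uG GC.
have m0 : 0 < m by lra.
have r0 : 0 < r by lra.
have im1 : m^-1 <= 1 by rewrite invf_le1.
have ir1 : r^-1 <= 1 by rewrite invf_le1//; lra.
have im0 : 0 < m^-1 by rewrite invr_gt0.
have ir0 : 0 < r^-1 by rewrite invr_gt0.
have irm : r^-1 <= m^-1 by rewrite lef_pV2.
have qrb : q * r^-1 - q * beta = 1 by rewrite -mulrBr -qr mulfV ?gt_eqF.
have qm : 1 <= q * m^-1.
  have : q * r^-1 <= q * m^-1 by rewrite ler_pM2l.
  have : 0 <= q * beta by rewrite mulr_ge0// ltW.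
  lra.
have -> : q * (beta * (G * L) + u * (rho / m)) =
   rho * u + (q * beta * (G * L) + rho * u * (q * m^-1 - 1)) by ring.
rewrite lerD2l.
(* As [q / m >= 1], the quantity [rho * u] may be replaced by [kappa - G * L]. The terms in [G * L]
   then combine into [- G * (m^-1 - r^-1)], of favourable sign for [G >= 0] and bounded through [C1]
   for [G < 0]. *)
apply: (@le_trans _ _ (q * beta * (G * L) + (kappa - G * L) * (q * m^-1 - 1))).
  by rewrite lerD2l ler_wpM2r ?subr_ge0// lerBrDr.
have -> : q * beta * (G * L) + (kappa - G * L) * (q * m^-1 - 1) =
   kappa * (q * m^-1 - 1) + L * (q * (- G * (m^-1 - r^-1))).
  have -> : q * beta = q * r^-1 - 1 by lra.
  by ring.
rewrite [leRHS]mulrDr; apply: lerD.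
  rewrite [leRHS]mulrC ler_wpM2l//.
  have : q * m^-1 <= q * 1 by rewrite ler_pM2l.
  lra.
rewrite [leRHS]mulrCA ler_wpM2l//.
have [G0|G0] := leP 0 G.
  apply: (@le_trans _ _ 0); last by rewrite mulr_ge0// (le_trans (ltW q0)).
  apply: mulr_ge0_le0; first exact: ltW.
  by rewrite mulNr oppr_le0 mulr_ge0// subr_ge0.
apply: ler_pM => //; first exact: ltW.
  by rewrite mulr_ge0 ?subr_ge0// oppr_ge0 ltW.
apply: le_trans (GC G0).
have -> : m^-1 - r^-1 = (r - m) * (m^-1 * r^-1).
  by field; rewrite !gt_eqF.
rewrite mulrA ler_piMr//.
  by rewrite mulr_ge0 ?subr_ge0// oppr_ge0 ltW.
by rewrite -[leRHS]mulr1 ler_pM// ltW.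
Qed.

Lemma exprz_expR {R : realType} (Q : R) (g : int) : 0 < Q ->
  Q ^ g = expR (g%:~R * ln Q).
Proof. by move=> Q0; rewrite -powR_intmul 1?ltW// /powR gt_eqF. Qed.

Lemma powR_expR {R : realType} (x t : R) : (expR x) `^ t = expR (x * t).
Proof. by rewrite expRM. Qed.

(* [A] plays the role of an average over a ball of measure [Q ^ g], so that
   [A `^ rho <= expR kappa / Q ^ g] says that an [L^rho] norm is controlled. *)
Lemma core_powR {R : realType} (Q beta q r m rho A kappa C1 cq : R) (g : int) :
  1 < Q -> q^-1 = r^-1 - beta -> 0 < q -> q <= cq -> 1 <= m -> m <= r ->
  0 <= beta -> 0 <= kappa -> 0 <= C1 -> 0 < A ->
  A `^ rho * Q ^ g <= expR kappa ->
  (g < 0 -> - g%:~R * (r - m) <= C1) ->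
  ((Q ^ g) `^ beta * A `^ (rho / m)) `^ q <= expR (cq * (kappa + ln Q * C1)) * A `^ rho.
Proof.
move=> Q1 qr q0 qcq m1 mr b0 k0 C10 A0 AQ GC.
have Q0 : 0 < Q by exact: lt_trans ltr01 Q1.
have L0 : 0 <= ln Q by rewrite ln_ge0// ltW.
rewrite -{1 2}[A]lnK ?posrE// !powR_expR exprz_expR// powR_expR -expRD powR_expR.
rewrite -expRD ler_expR.
rewrite exprz_expR// -[A]lnK ?posrE// powR_expR -expRD ler_expR in AQ.
have := @core_exponent R beta q r m rho (ln A) g%:~R (ln Q) kappa C1 cq
   qr q0 qcq m1 mr b0 L0 k0 C10.
rewrite [rho * ln A]mulrC => /(_ AQ).
have GC' : g%:~R < 0 :> R -> - g%:~R * (r - m) <= C1 by rewrite ltrz0.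
move=> /(_ GC'); rewrite [_ + cq * _]addrC.
by rewrite [q * _]mulrC [beta * (_ * _)]mulrC.
Qed.

Lemma measurable_powR2 {R : realType} {d} {X : measurableType d} (f r : X -> R) :
  measurable_fun setT f -> measurable_fun setT r ->
  measurable_fun setT (fun x => f x `^ r x).
Proof.
move=> mf mr; rewrite /powR; apply: measurable_fun_ifT => //.
- by apply: measurable_fun_eqr.
- rewrite (_ : (fun t => _) = (fun t => if r t == 0 then 1 else 0)); last first.
    by apply/funext => t; case: eqP.
  by apply: measurable_fun_ifT => //; exact: measurable_fun_eqr.
apply: measurableT_comp => //; apply: measurable_funM => //.
exact: (measurableT_comp (@measurable_ln R) mf).
Qed.

(** * Power means and Hoelder's inequality on balls *)

Section Means.
Context {R : realType} {d} {X : measurableType d}.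
Variables (mu : {measure set X -> \bar R}) (ball : X -> int -> set X) (Q : R).
Hypothesis us : ultra_space mu ball Q.
Local Open Scope ereal_scope.
Let mB x g := us_meas us x g.
Notation Ea := (Ea mu ball Q).

Lemma EaD h1 h2 g x : (forall y, 0 <= h1 y) -> (forall y, 0 <= h2 y) ->
  measurable_fun setT h1 -> measurable_fun setT h2 ->
  Ea (fun y => h1 y + h2 y) g x = Ea h1 g x + Ea h2 g x.
Proof.
move=> h10 h20 mh1 mh2; rewrite /Ea ge0_integralD//; try exact: measurable_funTS.
by rewrite ge0_muleDr// integral_ge0.
Qed.

Lemma EaZ (c : R) h g x : (0 <= c)%R -> (forall y, 0 <= h y) ->
  measurable_fun setT h ->
  Ea (fun y => c%:E * h y) g x = c%:E * Ea h g x.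
Proof.
move=> c0 h0 mh; rewrite /Ea ge0_integralZl ?lee_fin//; last exact: measurable_funTS.
by rewrite muleCA.
Qed.

Lemma Ea_cst (c : R) g x : Ea (cst c%:E) g x = c%:E.
Proof.
by rewrite /Ea (int_ball_cst us) -EFinM mulrCA mulVf ?mulr1// gt_eqF// (Qg0 us).
Qed.

(** Jensen's inequality up to the factor 2, from the pointwise bound
    [h ^ s <= V ^ s + V ^ (s - t) * h ^ t]. *)
Lemma Ea_power_mean (h : X -> R) (V s t : R) g x : (0 < s)%R -> (s <= t)%R -> (0 < V)%R ->
  (forall y, (0 <= h y)%R) -> measurable_fun setT h ->
  Ea (fun y => (h y `^ t)%:E) g x <= (V `^ t)%:E ->
  Ea (fun y => (h y `^ s)%:E) g x <= (2 * V `^ s)%:E.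
Proof.
move=> s0 st V0 h0 mh hV.
have t0 : (0 < t)%R by exact: lt_le_trans st.
have Vs0 : (0 < V `^ s)%R by exact: powR_gt0.
have Vt0 : (0 < V `^ t)%R by exact: powR_gt0.
have mp u : measurable_fun setT (fun y => (h y `^ u)%:E).
  by apply/measurable_EFinP; exact: (measurableT_comp (measurable_powR _)).
apply: (@le_trans _ _ (Ea (fun y => (V `^ s)%:E +
    (V `^ s / V `^ t)%:E * (h y `^ t)%:E) g x)).
  apply: Ea_le => // y _; first by rewrite lee_fin powR_ge0.
  rewrite -EFinM -EFinD lee_fin.
  have [hV1|Vh] := leP (h y) V.
    apply: ler_wpDr; first by rewrite mulr_ge0 ?divr_ge0 ?powR_ge0.
    by apply: ler_powR2 => //; exact: ltW.
  apply: ler_wpDl; first exact: powR_ge0.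
  have hy0 : (0 < h y)%R by exact: lt_trans Vh.
  have pE (w : R) : (0 < w)%R -> (w `^ t = w `^ (t - s) * w `^ s)%R.
    by move=> w0; rewrite -powRD ?subrK// (gt_eqF w0) implybT.
  rewrite mulrAC ler_pdivlMr// !pE//.
  have -> : (h y `^ s * (V `^ (t - s) * V `^ s) = V `^ (t - s) * (h y `^ s * V `^ s))%R.
    by ring.
  have -> : (V `^ s * (h y `^ (t - s) * h y `^ s) = h y `^ (t - s) * (h y `^ s * V `^ s))%R.
    by ring.
  rewrite ler_wpM2r ?mulr_ge0 ?powR_ge0//.
  by apply: ler_powR2; [rewrite subr_ge0|exact: ltW|exact: ltW].
rewrite EaD//.
- rewrite Ea_cst EaZ//; last 2 first.
  + by rewrite divr_ge0 ?powR_ge0.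
  + by move=> y; rewrite lee_fin powR_ge0.
  apply: (@le_trans _ _ ((V `^ s)%:E + (V `^ s / V `^ t)%:E * (V `^ t)%:E)).
    by rewrite leeD2l// lee_wpmul2l// lee_fin divr_ge0 ?powR_ge0.
  by rewrite -EFinM -EFinD lee_fin divfK ?gt_eqF// mulrDl mul1r.
- by move=> y; rewrite lee_fin ltW.
- by move=> y; rewrite -EFinM lee_fin mulr_ge0 ?divr_ge0 ?powR_ge0.
- exact: measurable_funeM.
Qed.

(* Hoelder's inequality with a constant, from the pointwise bound
   [u * f <= V * (u `^ s' + (f / V) `^ s)]. *)
Lemma Ea_young (u f : X -> R) (V s s' M : R) g x : (1 < s)%R -> (s'^-1 = 1 - s^-1)%R ->
  (0 < V)%R -> (forall y, (0 <= f y)%R) -> measurable_fun setT f ->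
  (forall y, (0 <= u y)%R) -> measurable_fun setT u ->
  Ea (fun y => (u y `^ s')%:E) g x <= M%:E ->
  Ea (fun y => (f y `^ s)%:E) g x <= (2 * V `^ s)%:E ->
  Ea (fun y => (u y * f y)%:E) g x <= (V * (M + 2))%:E.
Proof.
move=> s1 ss V0 f0 mf u0 mu_ uM fV.
have s0 : (0 < s)%R by exact: lt_trans ltr01 s1.
have is1 : (s^-1 < 1)%R by rewrite invf_lt1.
have is0 : (0 < s^-1)%R by rewrite invr_gt0.
have is'0 : (0 < s'^-1)%R by rewrite ss subr_gt0.
have s'0 : (0 < s')%R by rewrite -invr_gt0.
have is'1 : (s'^-1 <= 1)%R by rewrite ss gerBl ltW.
have Vs0 : (0 < V `^ s)%R by exact: powR_gt0.
have mp (h : X -> R) v : measurable_fun setT h -> measurable_fun setT (fun y => (h y `^ v)%:E).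
  by move=> mh; apply/measurable_EFinP; exact: (measurableT_comp (measurable_powR _)).
apply: (@le_trans _ _ (Ea (fun y => V%:E * (u y `^ s')%:E +
    (V / V `^ s)%:E * (f y `^ s)%:E) g x)).
  apply: Ea_le => // y _; first by rewrite lee_fin mulr_ge0.
  rewrite -!EFinM -EFinD lee_fin.
  have -> : (u y * f y = V * (u y * (f y / V)))%R by field; rewrite gt_eqF.
  have -> : (V * u y `^ s' + V / V `^ s * f y `^ s = V * (u y `^ s' + (f y / V) `^ s))%R.
    have iV : (V^-1 `^ s = (V `^ s)^-1)%R.
      by rewrite -(powR_inv1 (ltW V0)) -powRrM mulN1r powRN.
    by rewrite powRM ?invr_ge0 ?(ltW V0)// iV; ring.
  apply: ler_wpM2l; first exact: ltW.
  apply: (le_trans (conjugate_powR (u0 y) _ s'0 s0 _)) => //.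
  - by rewrite divr_ge0// ltW.
  - by rewrite ss subrK.
  by apply: lerD; apply: ler_piMr; rewrite ?powR_ge0// ltW.
rewrite EaD//.
- rewrite !EaZ//; try by [exact: mp|move=> y; rewrite lee_fin powR_ge0|exact: ltW];
    last by rewrite divr_ge0 ?powR_ge0// ltW.
  apply: (@le_trans _ _ (V%:E * M%:E + (V / V `^ s)%:E * (2 * V `^ s)%:E)).
    apply: leeD; first by rewrite lee_wpmul2l// lee_fin ltW.
    by rewrite lee_wpmul2l// lee_fin divr_ge0 ?powR_ge0// ltW.
  rewrite -!EFinM -EFinD lee_fin mulrDr lerD2l le_eqVlt; apply/orP; left; apply/eqP.
  by field; rewrite gt_eqF.
- by move=> y; rewrite -EFinM lee_fin mulr_ge0 ?powR_ge0// ltW.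
- by move=> y; rewrite -EFinM lee_fin mulr_ge0 ?powR_ge0// divr_ge0 ?powR_ge0// ltW.
- by apply: measurable_funeM; exact: mp.
- by apply: measurable_funeM; exact: mp.
Qed.

End Means.

(** * Logarithmic distance to the origin *)

Section Level.
Context {R : realType} {d} {X : measurableType d}.
Variables (mu : {measure set X -> \bar R}) (ball : X -> int -> set X) (Q : R).
Hypothesis us : ultra_space mu ball Q.

Lemma level_exists (o : X) : exists lev : X -> nat,
  (forall x, ball o (lev x)%:Z x) /\ forall x (k : nat), ball o k%:Z x -> (lev x <= k)%N.
Proof.
have H x : exists k : nat, ball o k%:Z x /\ forall j : nat, ball o j%:Z x -> (k <= j)%N.
  have [g og] := us_join us o x.
  have ex : exists k : nat, `[< ball o k%:Z x >].
    by exists `|g|%N; apply/asboolP; apply: (us_le us _ og); rewrite abszE ler_norm.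
  exists (ex_minn ex); case: ex_minnP => k /asboolP ok kmin; split => // j oj.
  by apply: kmin; apply/asboolP.
have [f fP] := choice H.
by exists f; split => x; [have [] := fP x|move=> k; have [_] := fP x; exact].
Qed.

Variables (o : X) (lev : X -> nat).
Hypothesis lev_ball : forall x, ball o (lev x)%:Z x.
Hypothesis lev_min : forall x (k : nat), ball o k%:Z x -> (lev x <= k)%N.

Lemma lev_le_ball x y (g : int) (k : nat) : ball x g y -> (lev x <= k)%N -> g <= k%:Z ->
  (lev y <= k)%N.
Proof.
move=> xy xk gk; apply: lev_min.
have ok : ball o k%:Z x by apply: (us_le us _ (lev_ball x)); lia.
by rewrite -(us_eq us ok); exact: (us_le us gk).
Qed.

Lemma lev_lt_ball x y (g : int) : ball x g y -> g < (lev x)%:Z -> lev y = lev x.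
Proof.
move=> xy gx; have yx : (lev y <= lev x)%N by apply: (lev_le_ball xy) => //; exact: ltW.
apply/eqP; rewrite eqn_leq yx /= leqNgt; apply/negP => lt.
have yx' := us_sym us xy.
have [gy|yg] := leP g (lev y)%:Z.
  by have := lev_le_ball yx' (leqnn _) gy; lia.
have : (lev x <= `|g|)%N.
  by apply: (lev_le_ball yx'); lia.
lia.
Qed.

(** In the second case the ball contains [o]: off the origin [lev] is constant on balls, and around
    it [lev] can only vary at positive levels. *)
Lemma lev_const_or x g : (forall y, ball x g y -> lev y = lev x) \/
  (1 <= g /\ (lev x)%:Z <= g).
Proof.
have [gx|xg] := ltP g (lev x)%:Z; first by left => y xy; exact: lev_lt_ball xy gx.
have [g1|g1] := leP 1 g; [by right|left => y xy].
have l0 : lev x = 0%N by lia.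
by have := lev_le_ball (k := 0%N) xy; rewrite l0; lia.
Qed.

Lemma lev_measurable {d'} {Y : measurableType d'} (F : nat -> Y) :
  measurable_fun setT (F \o lev).
Proof.
apply: (locconst_measurable us (g := 0)) => x y xy /=; congr F.
by have [/(_ _ xy) ->//|[]] := lev_const_or x 0; lia.
Qed.

Lemma lev_max x g : exists z, ball x g z /\ forall y, ball x g y -> (lev y <= lev z)%N.
Proof.
pose P n := `[< exists y, ball x g y /\ lev y = n >].
have exP : exists n, P n.
  by exists (lev x); apply/asboolP; exists x; split => //; exact: (us_refl us).
have bP n : P n -> (n <= maxn (lev x) `|g|)%N.
  move=> /asboolP[y [xy <-]]; apply: (lev_le_ball xy); first exact: leq_maxl.
  by lia.
have [m /asboolP[z [xz <-]] mmax] := ex_maxnP exP bP.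
by exists z; split => // y xy; apply: mmax; apply/asboolP; exists y.
Qed.

Local Open Scope ereal_scope.

(** A majorant of [F (lev x) x] in which the shells of constant [lev] are enlarged to balls around
    [o], so that estimates on balls apply. *)
Definition lev_sum (F : nat -> X -> \bar R) (x : X) : \bar R :=
  \sum_(k <oo) (F k \_ (ball o k%:Z)) x.

Section LevSum.
Variable F : nat -> X -> \bar R.
Hypothesis F0 : forall k x, 0 <= F k x.
Hypothesis mF : forall k, measurable_fun setT (F k).

Let F'0 k x : 0 <= (F k \_ (ball o k%:Z)) x.
Proof. by apply: erestrict_ge0. Qed.

Let mF' k : measurable_fun setT (F k \_ (ball o k%:Z)).
Proof.
by apply/(measurable_restrictT _ (us_meas us o k)).1; exact: measurable_funTS.
Qed.

Lemma lev_sum_ge0 x : 0 <= lev_sum F x.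
Proof. exact: nneseries_ge0. Qed.

Lemma lev_sum_ge x : F (lev x) x <= lev_sum F x.
Proof.
apply: le_trans (nneseries_ge_term (lev x) _) => //.
by rewrite patchE mem_set.
Qed.

Lemma lev_sum_measurable : measurable_fun setT (lev_sum F).
Proof. exact: ge0_emeasurable_sum. Qed.

Lemma integral_lev_sum (M : R) : (0 <= M)%R ->
  (forall k : nat, \int[mu]_(x in ball o k%:Z) F k x <= (M * (Q ^+ k)^-1)%:E) ->
  \int[mu]_x lev_sum F x <= (M * (Q / (Q - 1)))%:E.
Proof.
move=> M0 FM; have Q1 := us_Q1 us; have Q0 := Q0 us.
rewrite integral_nneseries//; apply: nneseries_le_bound => [n|n].
  exact: integral_ge0.
apply: (@le_trans _ _ (\sum_(0 <= k < n) (M * (Q ^+ k)^-1)%:E)).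
  by apply: lee_sum => k _; rewrite -integral_mkcond.
rewrite sumEFin lee_fin -mulr_sumr ler_wpM2l//.
have Q10 : (0 < Q - 1)%R by rewrite subr_gt0.
have Qk k : (0 < Q ^+ k)%R by rewrite exprn_gt0.
suff -> : (\sum_(0 <= k < n) (Q ^+ k)^-1 = Q / (Q - 1) - (Q / (Q - 1)) * (Q ^+ n)^-1)%R.
  by rewrite gerBl mulr_ge0 ?divr_ge0 ?invr_ge0 ?(ltW Q10) ?(ltW Q0)// ltW.
elim: n => [|n ih]; first by rewrite big_geq// expr0 invr1 mulr1 subrr.
rewrite big_nat_recr//= ih exprS; field.
by rewrite !gt_eqF.
Qed.

End LevSum.

End Level.

(** * Variable exponents: comparison of averages at a point *)

Section Exponent.
Context {R : realType} {d} {X : measurableType d}.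
Variables (mu : {measure set X -> \bar R}) (ball : X -> int -> set X) (Q : R).
Hypothesis us : ultra_space mu ball Q.
Variables (o : X) (lev : X -> nat).
Hypothesis lev_ball : forall x, ball o (lev x)%:Z x.
Hypothesis lev_min : forall x (k : nat), ball o k%:Z x -> (lev x <= k)%N.
Variables (r q : X -> R) (a c cq beta C1 C2 rho : R).

(* [lev x] is the positive part of [log |x|], so [ge_logr] and [ge_logq] are the
   log-Hoelder condition at infinity, and [ge_log0] the local one. *)
Structure good_exponent : Prop := {
  ge_rho : 1 < rho ;
  ge_a : rho * rho <= a ;
  ge_r : forall x, a <= r x <= c ;
  ge_mr : measurable_fun setT r ;
  ge_beta : 0 < beta ;
  ge_cb : c * beta < 1 ;
  ge_q : forall x, (q x)^-1 = (r x)^-1 - beta ;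
  ge_cq : forall x, q x <= cq ;
  ge_C1 : 0 <= C1 ;
  ge_C2 : 0 <= C2 ;
  ge_log0 : {ae mu, forall x, forall g : int, g < 0 ->
    {ae mu, forall y, ball x g y -> - g%:~R * (r x - r y) <= C1}} ;
  ge_logr : forall x y, `|r x - r y| * (minn (lev x) (lev y))%:R <= C2 ;
  ge_logq : forall x y, `|q x - q y| * (minn (lev x) (lev y))%:R <= C2 }.

Hypothesis ge : good_exponent.

Let Q1 := us_Q1 us.
Let Q0 : 0 < Q := Q0 us.
Let rho1 := ge_rho ge.
Let rho0 : 0 < rho := lt_trans ltr01 rho1.
Let a1 : 1 < a.
Proof.
by apply: lt_le_trans (ge_a ge); rewrite -[ltLHS]mulr1 ltr_pM// ?ltW.
Qed.
Let ra x : a <= r x. Proof. by have /andP[] := ge_r ge x. Qed.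
Let rc x : r x <= c. Proof. by have /andP[] := ge_r ge x. Qed.
Let r1 x : 1 < r x. Proof. exact: lt_le_trans (ra x). Qed.
Let r0 x : 0 < r x. Proof. exact: lt_trans (r1 x). Qed.
Let rho_a : rho <= a.
Proof. by apply: le_trans (ge_a ge); rewrite ler_peMr// ltW. Qed.

Lemma exponent_q0 x : 0 < q x.
Proof.
rewrite -invr_gt0 (ge_q ge) subr_gt0 -[ltRHS]mul1r ltr_pdivlMr//.
apply: le_lt_trans (ge_cb ge); rewrite mulrC ler_wpM2r//; exact/ltW/(ge_beta ge).
Qed.

Lemma exponent_rq x : r x <= q x.
Proof.
rewrite -lef_pV2 ?posrE ?exponent_q0// (ge_q ge) gerBl; exact/ltW/(ge_beta ge).
Qed.
Let q0 := exponent_q0.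
Let rq := exponent_rq.

Lemma exponent_mq : measurable_fun setT q.
Proof.
have -> : q = (fun x => ((r x) `^ (-1) - beta) `^ (-1)).
  apply/funext => x; rewrite (powR_inv1 (ltW (r0 x))) -(ge_q ge).
  by rewrite powR_inv1 ?invrK// invr_ge0 ltW.
apply: (measurableT_comp (measurable_powR _)); apply: measurable_funB => //.
exact: (measurableT_comp (measurable_powR _) (ge_mr ge)).
Qed.

(* The gauge function correcting the small values of [f], as in the proof of
   Cruz-Uribe, Fiorenza and Neugebauer. *)
Definition lev_decay (x : X) : R := (Q ^+ (4 * lev x))^-1.

Definition Gf (f : X -> R) (x : X) : R := f x `^ (r x / rho) + lev_decay x.

Lemma lev_decay_gt0 x : 0 < lev_decay x.
Proof. by rewrite invr_gt0 exprn_gt0. Qed.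

Lemma lev_decay_le1 x : lev_decay x <= 1.
Proof. by rewrite invf_le1 ?exprn_gt0// exprn_ege1// ltW. Qed.

Lemma lev_decay_measurable : measurable_fun setT lev_decay.
Proof.
exact: (lev_measurable us lev_ball lev_min (fun k => (Q ^+ (4 * k))^-1)).
Qed.

Local Open Scope ereal_scope.

Lemma lev_decay_int : \int[mu]_x (lev_decay x)%:E <= (1 * (Q / (Q - 1)))%:E.
Proof.
pose F (k : nat) (_ : X) := ((Q ^+ (4 * k))^-1)%:E : \bar R.
have F0 k x : 0 <= F k x by rewrite lee_fin invr_ge0 exprn_ge0// ltW.
apply: (@le_trans _ _ (\int[mu]_x lev_sum ball o F x)).
  apply: le_int => x _; first by rewrite lee_fin ltW// lev_decay_gt0.
  exact: (lev_sum_ge lev_ball F0 x).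
have mF k : measurable_fun setT (F k) by exact: measurable_cst.
apply: (integral_lev_sum us F0 mF) => // k.
rewrite [leLHS](int_ball_cst us o k%:Z ((Q ^+ (4 * k))^-1)%R) lee_fin mul1r -exprnP.
rewrite -ler_pdivlMr ?exprn_gt0// -invfM -exprD lef_pV2 ?posrE ?exprn_gt0//.
by rewrite ler_weXn2l// ?(ltW Q1)//; lia.
Qed.

Let C3 : R := (2 `^ rho * (1 + Q / (Q - 1)))%R.
Let C3_gt0 : (0 < C3)%R.
Proof.
rewrite mulr_gt0 ?powR_gt0// ltr_pwDl// divr_ge0 ?(ltW Q0)// subr_ge0; exact: ltW.
Qed.

(** [2 ^ rho * C3] will bound [A ^ rho * Q ^ g] for every average [A] of [Gf]; the added 1 makes
    [kap] nonnegative. *)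
Let kap : R := ln (2 `^ rho * C3 + 1)%R.
Let expkap : (expR kap = 2 `^ rho * C3 + 1)%R.
Proof.
by rewrite lnK// posrE addr_gt0// mulr_gt0// powR_gt0.
Qed.
Let kap0 : (0 <= kap)%R.
Proof. by rewrite ln_ge0// lerDr mulr_ge0 ?powR_ge0// ltW. Qed.

Let C5 : R := (Q `^ (4 * C2))%R.
Let C51 : (1 <= C5)%R.
Proof.
rewrite /C5 -[leLHS](powRr0 Q); apply: ler_powR; first exact: ltW.
by apply: mulr_ge0 => //; exact: (ge_C2 ge).
Qed.
Let C50 : (0 < C5)%R := lt_le_trans ltr01 C51.
Let kap' : R := (kap + rho * ln C5)%R.
Let kap'0 : (0 <= kap')%R.
Proof. by rewrite addr_ge0// mulr_ge0 ?ln_ge0// ltW. Qed.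
Let cq0 : (0 <= cq)%R.
Proof. exact: le_trans (ltW (q0 o)) (ge_cq ge o). Qed.
Let K0 : R := expR (cq * (kap + ln Q * C1))%R.
Let K1 : R := expR (cq * (kap' + ln Q * 0))%R.
Let M1 : R := (K1 * expR kap')%R.
Let M11 : (1 <= M1)%R.
Proof.
rewrite /M1 /K1 -expRD -[leLHS]expR0 ler_expR mulr0 addr0.
by rewrite addr_ge0// mulr_ge0.
Qed.
Let M10 : (0 < M1)%R := lt_le_trans ltr01 M11.

(** Changing the exponent by [e] is harmless where [u] is not too small: for negative [e], [u ^ e]
    is at most [Q ^ (4 * l * |e|)], and the log-Hoelder condition at infinity bounds [l * |e|] by
    [C2], whence [C5]. *)
Let log_bound (u M e E : R) (l : nat) : ((Q ^+ (4 * l))^-1 < u)%R -> (u <= M)%R ->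
  (1 <= M)%R -> (`|e| <= E)%R -> (`|e| * l%:R <= C2)%R -> (u `^ e <= M `^ E * C5)%R.
Proof.
move=> lu uM M1' eE el.
have v0 : (0 < (Q ^+ (4 * l))^-1)%R by rewrite invr_gt0 exprn_gt0.
have u0 : (0 < u)%R by exact: lt_trans lu.
have E0 : (0 <= E)%R by exact: le_trans eE.
have ME : (1 <= M `^ E)%R by rewrite -(powRr0 M) ler_powR.
have [e0|e0] := leP 0%R e.
  rewrite -[leLHS]mulr1 ler_pM ?powR_ge0//.
  apply: (@le_trans _ _ (M `^ e)%R); first by apply: ler_powR2 => //; exact: ltW.
  by rewrite ler_powR// -(ger0_norm e0).
rewrite -[leLHS]mul1r ler_pM ?powR_ge0//.
rewrite -[e]opprK powRN -[leRHS]invrK lef_pV2 ?posrE ?invr_gt0// ?powR_gt0//.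
apply: (@le_trans _ _ (((Q ^+ (4 * l))^-1) `^ (- e))%R); last first.
  by apply: ler_powR2; [rewrite oppr_ge0 ltW|exact: ltW|exact: ltW].
rewrite -powR_mulrn ?(ltW Q0)// -powRN -powRrM /C5 -powRN ler_powR ?(ltW Q1)//.
rewrite mulNr lerN2 natrM -mulrA ler_wpM2l// mulrC -(ltr0_norm e0)//.
Qed.

(* Only balls containing the origin, on which [lev] is not constant, leave an
   error. *)
Definition err (g : int) (x : X) : R :=
  if (1 <= g)%R && ((lev x)%:Z <= g)%R
  then (lev_decay x `^ 2^-1 * (Q ^ g) `^ (- (2 * cq)^-1))%R else 0%R.

Let err0 g x : (0 <= err g x)%R.
Proof. by rewrite /err; case: ifP => // _; rewrite mulr_ge0 ?powR_ge0. Qed.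

Definition pointwise_const : R :=
  (4 `^ cq * (K0 + K1 * C5 `^ rho * (M1 `^ cq * C5) + 1 + M1))%R.

Section FixF.
Variable f : X -> R.
Hypothesis f0 : forall x, (0 <= f x)%R.
Hypothesis mf : measurable_fun setT f.
Hypothesis If : \int[mu]_x (f x `^ r x)%:E <= 1.

Lemma Gf_gt0 x : (0 < Gf f x)%R.
Proof. by rewrite ltr_wpDl ?powR_ge0// lev_decay_gt0. Qed.

Lemma Gf_measurable : measurable_fun setT (Gf f).
Proof.
apply: measurable_funD; last exact: lev_decay_measurable.
apply: measurable_powR2 => //; apply: measurable_funM => //; exact: (ge_mr ge).
Qed.

Lemma Gf_int : \int[mu]_x (Gf f x `^ rho)%:E <= C3%:E.
Proof.
have mfr : measurable_fun setT (fun x => (f x `^ r x)%:E).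
  by apply/measurable_EFinP; apply: measurable_powR2 => //; exact: (ge_mr ge).
have meta : measurable_fun setT (fun x => (lev_decay x)%:E).
  by apply/measurable_EFinP; exact: lev_decay_measurable.
apply: (@le_trans _ _ (\int[mu]_x ((2 `^ rho)%:E * ((f x `^ r x)%:E + (lev_decay x)%:E)))).
  apply: le_int => x _; first by rewrite lee_fin powR_ge0.
  rewrite -EFinD -EFinM lee_fin /Gf; set u := (f x `^ (r x / rho))%R; set v := lev_decay x.
  have u0 : (0 <= u)%R by exact: powR_ge0.
  have v0 : (0 <= v)%R by exact/ltW/lev_decay_gt0.
  have -> : (f x `^ r x = u `^ rho)%R.
    by rewrite /u -powRrM divfK// gt_eqF.
  have vr : (v `^ rho <= v)%R.
    by apply: ge1r_powR; [rewrite lev_decay_gt0 lev_decay_le1|exact: ltW].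
  apply: (@le_trans _ _ ((2 * Num.max u v) `^ rho)%R).
    apply: ler_powR2; [exact: ltW|exact: addr_ge0|].
    by rewrite mulr_natl mulr2n lerD// le_max lexx ?orbT.
  rewrite powRM ?le_max ?u0// ler_wpM2l ?powR_ge0//.
  case: (leP u v) => _; first by apply: (le_trans vr); rewrite lerDr powR_ge0.
  by rewrite lerDl.
rewrite ge0_integralZl//; last 2 first.
- exact: emeasurable_funD.
- by move=> x _; rewrite -EFinD lee_fin addr_ge0 ?powR_ge0// ltW// lev_decay_gt0.
rewrite /C3 EFinM lee_wpmul2l ?lee_fin ?powR_ge0//.
rewrite ge0_integralD//; last 2 first.
- by move=> x _; rewrite lee_fin powR_ge0.
- by move=> x _; rewrite lee_fin ltW// lev_decay_gt0.
rewrite EFinD; apply: leeD => //; apply: (le_trans lev_decay_int).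
by rewrite mul1r.
Qed.

(** The decay added in [Gf] bounds its averages from below: this is the last clause, from which
    positivity also follows. *)
Lemma Ea_Gf g x : exists2 A, Ea mu ball Q (fun y => (Gf f y)%:E) g x = A%:E &
  [/\ (0 < A)%R, (A `^ rho * Q ^ g <= expR kap)%R &
      forall e, (forall y, ball x g y -> (e <= lev_decay y)%R) -> (e <= A)%R].
Proof.
have Qg0 := Qg0 us g.
pose V := ((C3 / Q ^ g) `^ rho^-1)%R.
have V0 : (0 < V)%R by rewrite powR_gt0// divr_gt0.
have Vr : (V `^ rho = C3 / Q ^ g)%R.
  by rewrite /V -powRrM mulVf ?gt_eqF// powRr1// divr_ge0 ?ltW.
have h : Ea mu ball Q (fun y => (Gf f y `^ rho)%:E) g x <= (V `^ rho)%:E.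
  rewrite (Ea_leP us) Vr divfK ?gt_eqF//; apply: le_trans Gf_int.
  apply: ge0_subset_integral => //; first exact: (us_meas us).
    apply/measurable_EFinP; exact: (measurableT_comp (measurable_powR _) Gf_measurable).
  by move=> y _; rewrite lee_fin powR_ge0.
have E1 : Ea mu ball Q (fun y => (Gf f y)%:E) g x <= (2 * V)%:E.
  have := Ea_power_mean us ltr01 (ltW rho1) V0 (fun y => ltW (Gf_gt0 y)) Gf_measurable h.
  rewrite powRr1 ?(ltW V0)//; congr (_ <= _); congr (_ * _); apply: eq_integral => y _.
  by rewrite powRr1// ltW// Gf_gt0.
have E0 : 0 <= Ea mu ball Q (fun y => (Gf f y)%:E) g x.
  by apply: (Ea_ge0 us) => y; rewrite lee_fin ltW// Gf_gt0.
case AE : (Ea mu ball Q _ g x) E0 E1 => [A| |]//; rewrite !lee_fin => A0 A2.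
have Ae e : (forall y, ball x g y -> (e <= lev_decay y)%R) -> (e <= A)%R.
  move=> ey; have [e0|e0] := leP e 0%R; first exact: le_trans A0.
  rewrite -lee_fin -AE -(Ea_cst us e g x); apply: (Ea_le us) => y xy.
    by rewrite lee_fin ltW.
  by rewrite lee_fin /Gf (le_trans (ey _ xy))// lerDr powR_ge0.
exists A => //; split => //.
- have [z [xz zm]] := lev_max us lev_ball lev_min x g.
  apply: lt_le_trans (lev_decay_gt0 z) _; apply: Ae => y /zm yz.
  rewrite lef_pV2 ?posrE ?exprn_gt0// ler_weXn2l// ?(ltW Q1)//.
  by rewrite leq_mul2l.
- rewrite expkap; apply: (@le_trans _ _ ((2 * V) `^ rho * Q ^ g)%R).
    by rewrite ler_pM2r//; apply: ler_powR2 => //; exact: ltW.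
  rewrite powRM ?(ltW V0)// Vr -mulrA divfK ?gt_eqF//.
  by rewrite lerDl.
Qed.

(** Making the exponent of [f y ^ (r y / rho)] constant on a ball loses differently on large and on
    small values, whence the cut of [f] at height 1. The local log-Hoelder condition serves the
    large values, the one at infinity the small ones. *)
Lemma pointwise_estimate : {ae mu, forall x, forall g, exists V, [/\ (0 < V)%R,
  Ea mu ball Q (fun y => (f y `^ rho)%:E) g x <= (2 * V `^ rho)%:E &
  ((((Q ^ g) `^ beta * V) `^ q x)%:E <= pointwise_const%:E *
    ((Ea mu ball Q (fun y => (Gf f y)%:E) g x) `^ rho + (err g x)%:E))]}.
Proof.
have := ge_log0 ge; apply: filterS => x hx g.
have Qg0 := Qg0 us g; have mBg := us_meas us x g.
have beta0 : (0 <= beta)%R by exact/ltW/(ge_beta ge).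
have mpow (h : X -> R) v : measurable_fun setT h -> measurable_fun setT (fun y => (h y `^ v)%R).
  by move=> mh; exact: (measurableT_comp (measurable_powR _)).
have [A AE [A0 AQ Ae]] := Ea_Gf g x.
have Ar0 : (0 < A `^ rho)%R by exact: powR_gt0.
rewrite AE poweR_EFin -EFinD -EFinM.
(* Where [f > 1], [r] may be replaced by its infimum [m] over the ball, which is
   within [C1 / - g] of [r x] on small balls. *)
have [m [am mr' mae gC]] : exists m, [/\ (a <= m)%R, (m <= r x)%R,
    {ae mu, forall y, ball x g y -> (m <= r y)%R} &
    (g < 0)%R -> (- g%:~R * (r x - m) <= C1)%R].
  have [g0|g0] := leP 0%R g.
    by exists a; split => //; apply: aeW => y _.
  have ng0 : (0 < - g%:~R :> R)%R by rewrite oppr_gt0 ltrz0.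
  exists (Num.max a (r x - C1 / - g%:~R))%R; split.
  - by rewrite le_max lexx.
  - rewrite ge_max ra/= gerBl divr_ge0 ?(ltW ng0)//; exact: (ge_C1 ge).
  - have := hx g g0; apply: filterS => y + xy => /(_ xy).
    rewrite ge_max ra/= lerBlDr -lerBlDl ler_pdivlMr// mulrC.
    by [].
  - move=> _; rewrite mulrC -ler_pdivlMr// lerBlDl -lerBlDr.
    by rewrite le_max lexx orbT.
have m1 : (1 <= m)%R by exact: le_trans (ltW a1) am.
have m0 : (0 < m)%R by exact: lt_le_trans ltr01 m1.
(* Here [rho * rho <= a] enters: the [rho]-mean of [f] is controlled by the mean of [f ^ (v / rho)],
   a power comparable with the one in [Gf]. *)
have rho_mr v : (a <= v)%R -> (rho <= v / rho)%R.
  by move=> av; rewrite ler_pdivlMr// (le_trans (ge_a ge)).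
pose f1 y := (if (1 < f y)%R then f y else 0)%R.
pose f2 y := (if (1 < f y)%R then 0 else f y)%R.
have f10 y : (0 <= f1 y)%R by rewrite /f1; case: ifP.
have f20 y : (0 <= f2 y)%R by rewrite /f2; case: ifP.
have f21 y : (f2 y <= 1)%R by rewrite /f2; case: ltP.
have mf1 : measurable_fun setT f1.
  by apply: measurable_fun_ifT => //; exact: measurable_fun_ltr.
have mf2 : measurable_fun setT f2.
  by apply: measurable_fun_ifT => //; exact: measurable_fun_ltr.
have rhoN0 : (rho != 0)%R by rewrite gt_eqF.
pose V1 := (A `^ (rho / m))%R.
have V10 : (0 < V1)%R by exact: powR_gt0.
have V1f : Ea mu ball Q (fun y => (f1 y `^ rho)%:E) g x <= (2 * V1 `^ rho)%:E.
  apply: (Ea_power_mean us rho0 (rho_mr _ am) V10 f10 mf1).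
  rewrite -powRrM mulrA divfK ?gt_eqF// divff// powRr1 ?(ltW A0)// -AE.
  apply: lee_wpmul2l; first by rewrite lee_fin invr_ge0 ltW.
  apply: le_int_ae => //.
  - by move=> y _; rewrite lee_fin powR_ge0.
  - by move=> y _; rewrite lee_fin ltW// Gf_gt0.
  - by apply: measurable_funTS; apply/measurable_EFinP; exact: Gf_measurable.
  apply: filterS mae => y my /my mry; rewrite lee_fin /f1 /Gf.
  case: ifPn => [fy|_]; last first.
    rewrite powR0 ?addr_ge0 ?powR_ge0 ?ltW ?lev_decay_gt0//.
    by rewrite mulf_neq0 ?invr_neq0 ?gt_eqF.
  apply: ler_wpDr; first exact/ltW/lev_decay_gt0.
  by rewrite ler_powR ?(ltW fy)// ler_pM2r ?invr_gt0.
pose D1 := ((Q ^ g) `^ beta * V1)%R.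
have D10 : (0 < D1)%R by rewrite mulr_gt0// powR_gt0.
have D1q : (D1 `^ q x <= K0 * A `^ rho)%R.
  by apply: (core_powR Q1 (ge_q ge x)) => //; [exact: (ge_cq ge)|exact: (ge_C1 ge)].
(* Where [f <= 1], [r] is replaced by its value at the point [z] of the ball
   farthest from the origin, which costs a constant wherever [f > lev_decay]. *)
have [z [xz zm]] := lev_max us lev_ball lev_min x g.
have f2G y : ball x g y -> (f2 y `^ (r z / rho) <= C5 * Gf f y)%R.
  move=> xy; have rz1 : (1 <= r z / rho)%R.
    by rewrite ler_pdivlMr// mul1r (le_trans rho_a).
  have eG : (lev_decay y <= Gf f y)%R by rewrite lerDr powR_ge0.
  have G0 := Gf_gt0 y.
  rewrite /f2; case: ltP => f1y.
    by rewrite powR0 ?mulr_ge0 ?(ltW C50)// ?ltW// gt_eqF// (lt_le_trans ltr01).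
  have [fe|ef] := leP (f y) (lev_decay y).
    apply: (@le_trans _ _ (lev_decay y)).
      apply: (@le_trans _ _ (lev_decay y `^ (r z / rho))%R).
        by apply: ler_powR2 => //; exact: le_trans rz1.
      by apply: ge1r_powR => //; rewrite lev_decay_gt0 lev_decay_le1.
    by apply: (le_trans eG); rewrite ler_peMl// ltW.
  have fy0 : (0 < f y)%R by apply: lt_trans ef; exact: lev_decay_gt0.
  have -> : (r z / rho = r y / rho + (r z - r y) / rho)%R by ring.
  rewrite powRD ?(gt_eqF fy0) ?implybT// mulrC; apply: ler_pM; rewrite ?powR_ge0//.
    have := @log_bound (f y) 1%R ((r z - r y) / rho)%R `|(r z - r y) / rho|%R (lev y) ef f1y
      (lexx _) (lexx _).
    rewrite powR1 mul1r; apply.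
    rewrite normrM (gtr0_norm (x := rho^-1)) ?invr_gt0//.
    apply: le_trans (ge_logr ge z y); rewrite minnC (minn_idPl (zm _ xy)).
    by rewrite ler_wpM2r// ler_piMr// invf_le1// ltW.
  by rewrite lerDl ltW// lev_decay_gt0.
pose CA := (C5 * A)%R; have CA0 : (0 < CA)%R by exact: mulr_gt0.
pose V2 := (CA `^ (rho / r z))%R.
have V20 : (0 < V2)%R by exact: powR_gt0.
(* As [f2 <= 1], the value 1 is also admissible; the cap is what bounds [D2] on balls of level at
   most 0. *)
pose V := Num.min V2 1%R.
have V0 : (0 < V)%R by rewrite lt_min V20 ltr01.
have VV2 : (V <= V2)%R by rewrite ge_min lexx.
have V1' : (V <= 1)%R by rewrite ge_min lexx orbT.
have V2f : Ea mu ball Q (fun y => (f2 y `^ rho)%:E) g x <= (2 * V `^ rho)%:E.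
  rewrite /V; case: (leP V2 1%R) => h21.
    apply: (Ea_power_mean us rho0 (rho_mr _ (ra z)) V20 f20 mf2).
    rewrite /V2 -powRrM mulrA divfK ?gt_eqF// divff// powRr1 ?(ltW CA0)//.
    rewrite /CA EFinM -AE -(EaZ us) ?(ltW C50)//; last 2 first.
    - by move=> y; rewrite lee_fin ltW// Gf_gt0.
    - by apply/measurable_EFinP; exact: Gf_measurable.
    apply: (Ea_le us) => y xy; first by rewrite lee_fin powR_ge0.
    by rewrite -EFinM lee_fin f2G.
  rewrite powR1 mulr1 -(Ea_cst us 2 g x); apply: (Ea_le us) => y _.
    by rewrite lee_fin powR_ge0.
  rewrite lee_fin (@le_trans _ _ 1%R) ?ler1n//.
  have e1 : (1 `^ rho = 1 :> R)%R by rewrite powR1.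
  rewrite -[leRHS]e1; apply: ler_powR2 => //; exact: ltW.
pose D2 := ((Q ^ g) `^ beta * V)%R.
have D20 : (0 < D2)%R by rewrite mulr_gt0// powR_gt0.
have CAk : (CA `^ rho * Q ^ g <= expR kap')%R.
  have e5 : (expR (rho * ln C5) = C5 `^ rho)%R by rewrite mulrC expRM lnK.
  rewrite powRM ?(ltW C50) ?(ltW A0)// -mulrA /kap' expRD e5 mulrC.
  by rewrite ler_wpM2r ?powR_ge0.
have D2q : (D2 `^ q z <= K1 * CA `^ rho)%R.
  apply: (@le_trans _ _ (((Q ^ g) `^ beta * V2) `^ q z)%R).
    apply: ler_powR2; [exact: ltW|exact: ltW|].
    by rewrite ler_wpM2l ?powR_ge0.
  apply: (core_powR Q1 (ge_q ge z)) => //; [exact: (ge_cq ge)|exact: ltW|].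
  by rewrite subrr mulr0.
have D2Q : (D2 `^ q z <= M1 / Q ^ g)%R.
  rewrite ler_pdivlMr//; apply: (@le_trans _ _ (K1 * CA `^ rho * Q ^ g)%R).
    by rewrite ler_wpM2r// ltW.
  by rewrite -mulrA ler_wpM2l// ltW// expR_gt0.
have q1 y : (1 <= q y)%R by apply: (le_trans (ltW (r1 y))); exact: rq.
have D2M : (D2 <= M1)%R.
  have [g0|g0] := leP g 0%R.
    apply: le_trans M11; rewrite -[leRHS]mulr1; apply: ler_pM; rewrite ?powR_ge0 ?(ltW V0)//.
    have e1 : (1 `^ beta = 1 :> R)%R by rewrite powR1.
    rewrite -[leRHS]e1; apply: ler_powR2 => //; first exact: ltW.
    by rewrite -(expr0z Q); apply: ler_weXz2l g0; exact: ltW.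
  have [D21|D21] := leP D2 1%R; first exact: le_trans M11.
  apply: (@le_trans _ _ (D2 `^ q z)%R); first by rewrite le1r_powR// ltW.
  apply: (le_trans D2Q); rewrite ler_pdivrMr// ler_peMr ?(ltW M10)//.
  by rewrite -(expr0z Q); apply: ler_weXz2l (ltW g0); exact: ltW.
(* Passage from the exponent [q z] to [q x]. While [D2] exceeds the decay at [x], the log-Hoelder
   condition for [q] applies. Below it, [D2] is bounded by the decay, hence by the average [A] if
   [lev] is constant on the ball, and only then is [err] needed for the remaining balls. *)
have D2x : (D2 `^ q x <= (K1 * C5 `^ rho * (M1 `^ cq * C5) + 1) * A `^ rho + M1 * err g x)%R.
  have KC0 : (0 <= K1 * C5 `^ rho * (M1 `^ cq * C5))%R.
    by rewrite !mulr_ge0 ?powR_ge0 ?expR_ge0// ltW.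
  have [De|eD] := leP D2 (lev_decay x); last first.
    apply: ler_wpDr; first by rewrite mulr_ge0// ltW.
    rewrite mulrDl mul1r; apply: ler_wpDr; first exact: ltW.
    rewrite -[q x](subrKC (q z)) powRD ?(gt_eqF D20) ?implybT//.
    rewrite mulrAC; apply: ler_pM; rewrite ?powR_ge0//.
      by rewrite -mulrA -powRM ?(ltW C50) ?(ltW A0).
    apply: (@log_bound D2 M1 (q x - q z)%R cq (lev x) eD D2M M11).
      have := ge_cq ge x; have := ge_cq ge z; have := q0 x; have := q0 z.
      by move=> ? ? ? ?; rewrite ler_norml; apply/andP; split; lra.
    by apply: le_trans (ge_logq ge x z); rewrite (minn_idPl (zm _ (us_refl us x g))).
  have D21 : (D2 <= 1)%R by apply: (le_trans De); exact: lev_decay_le1.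
  have [lc|[g1 xg]] := lev_const_or us lev_ball lev_min x g.
    apply: ler_wpDr; first by rewrite mulr_ge0// ltW.
    rewrite mulrDl mul1r; apply: ler_wpDl; first by rewrite mulr_ge0// ltW.
    apply: (@le_trans _ _ (lev_decay x `^ rho)%R); last first.
      apply: ler_powR2; [exact: ltW|exact/ltW/lev_decay_gt0|].
      by apply: Ae => y /lc yx; rewrite /lev_decay yx.
    apply: (@le_trans _ _ (lev_decay x `^ q x)%R).
      by apply: ler_powR2 => //; [exact/ltW/q0|exact: ltW].
    apply: ger_powR; first by rewrite lev_decay_gt0 lev_decay_le1.
    exact: le_trans rho_a (le_trans (ra x) (rq x)).
  apply: ler_wpDl; first by rewrite mulr_ge0 ?addr_ge0// ltW.
  rewrite /err g1 xg/=; apply: (@le_trans _ _ D2).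
    by apply: ge1r_powR => //; rewrite D20.
  (* One square root is spent on the decay at [x], for integrability in [x]; the other on a negative
     power of [Q ^ g], to absorb the growth of the weights in [g]. *)
  have -> : (D2 = D2 `^ 2^-1 * D2 `^ 2^-1)%R.
    rewrite -powRD ?(gt_eqF D20) ?implybT//.
    have -> : (2^-1 + 2^-1 = 1 :> R)%R by field.
    by rewrite powRr1// ltW.
  rewrite mulrCA; apply: ler_pM; rewrite ?powR_ge0//.
    by apply: ler_powR2 => //; exact: ltW.
  have -> : (D2 `^ 2^-1 = (D2 `^ q z) `^ (2 * q z)^-1)%R.
    by rewrite -powRrM invfM mulrCA divff ?mulr1// gt_eqF// q0.
  apply: (@le_trans _ _ ((M1 / Q ^ g) `^ (2 * q z)^-1)%R).
    by apply: ler_powR2; rewrite ?powR_ge0// invr_ge0 mulr_ge0// ltW// q0.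
  rewrite powRM ?(ltW M10) ?invr_ge0 ?(ltW Qg0)//; apply: ler_pM; rewrite ?powR_ge0//.
    rewrite -[leRHS](powRr1 (ltW M10)) ler_powR// invf_le1 ?mulr_gt0 ?q0//.
    by rewrite -[leLHS]mul1r ler_pM// ler1n.
  rewrite -powR_inv1 ?(ltW Qg0)// -powRrM mulN1r ler_powR//.
    by rewrite -(expr0z Q); apply: ler_weXz2l; [exact: ltW|exact: le_trans g1].
  rewrite lerN2 lef_pV2 ?posrE ?mulr_gt0 ?q0//.
    by rewrite ler_pM2l// (ge_cq ge).
  exact: lt_le_trans (q0 x) (ge_cq ge x).
exists (2 * (V1 + V))%R; split.
- by rewrite mulr_gt0// addr_gt0.
- apply: (@le_trans _ _ (Ea mu ball Q (fun y => (f1 y `^ rho)%:E + (f2 y `^ rho)%:E) g x)).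
    apply: (Ea_le us) => y _; first by rewrite lee_fin powR_ge0.
    rewrite -EFinD lee_fin /f1 /f2; case: ifP => _; last by rewrite lerDr powR_ge0.
    by rewrite lerDl powR_ge0.
  rewrite (EaD us); last 4 first.
  + by move=> y; rewrite lee_fin powR_ge0.
  + by move=> y; rewrite lee_fin powR_ge0.
  + by apply/measurable_EFinP; exact: mpow.
  + by apply/measurable_EFinP; exact: mpow.
  apply: (le_trans (leeD V1f V2f)); rewrite -EFinD lee_fin -mulrDr ler_wpM2l//.
  rewrite powRM ?addr_ge0 ?(ltW V10) ?(ltW V0)//.
  apply: (@le_trans _ _ (2 * (V1 + V) `^ rho)%R).
    rewrite mulr_natl mulr2n; apply: lerD; apply: ler_powR2; rewrite ?(ltW V10) ?(ltW V0) ?(ltW rho0)//.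
      by rewrite lerDl ltW.
    by rewrite lerDr ltW.
  rewrite ler_wpM2r ?powR_ge0// -[leLHS]powRr1// ler_powR ?ler1n//; exact: ltW.
- rewrite lee_fin.
  have -> : ((Q ^ g) `^ beta * (2 * (V1 + V)) = 2 * (D1 + D2))%R by rewrite /D1 /D2; ring.
  have qx0 := ltW (q0 x).
  apply: (@le_trans _ _ ((4 * Num.max D1 D2) `^ q x)%R).
    apply: ler_powR2 => //; first by rewrite mulr_ge0// addr_ge0// ltW.
    have -> : (4 = 2 * 2 :> R)%R by ring.
    rewrite -mulrA ler_wpM2l// mulr_natl mulr2n.
    by rewrite lerD// le_max lexx ?orbT.
  rewrite powRM//; last by rewrite le_max ltW.
  rewrite /pointwise_const -[leRHS]mulrA; apply: ler_pM; rewrite ?powR_ge0//.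
    by rewrite ler_powR ?ler1n// (ge_cq ge).
  have K00 : (0 <= K0)%R by exact: expR_ge0.
  have e0 := err0 g x.
  have MA : (0 <= M1 * A `^ rho)%R by rewrite mulr_ge0// ltW.
  have ME : (0 <= M1 * err g x)%R by rewrite mulr_ge0// ltW.
  set CC := (K1 * C5 `^ rho * (M1 `^ cq * C5))%R in D2x *.
  have CC0 : (0 <= CC)%R by rewrite !mulr_ge0 ?powR_ge0 ?expR_ge0// ltW.
  have CE : (0 <= CC * err g x)%R by rewrite mulr_ge0.
  have CAr : (0 <= CC * A `^ rho)%R by rewrite mulr_ge0// ltW.
  have KE : (0 <= K0 * err g x)%R by rewrite mulr_ge0.
  have KA : (0 <= K0 * A `^ rho)%R by rewrite mulr_ge0// ltW.
  case: (leP D1 D2) => _.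
    apply: (le_trans D2x).
    rewrite !mulrDl !mulrDr !mul1r; lra.
  apply: (le_trans D1q).
  rewrite !mulrDl !mulrDr !mul1r; lra.
Qed.

End FixF.

End Exponent.

(** * The key estimate *)

Section Key.
Context {R : realType} {d} {X : measurableType d}.
Variables (mu : {measure set X -> \bar R}) (ball : X -> int -> set X) (Q : R).
Hypothesis us : ultra_space mu ball Q.
Variables (o : X) (lev : X -> nat).
Hypothesis lev_ball : forall x, ball o (lev x)%:Z x.
Hypothesis lev_min : forall x (k : nat), ball o k%:Z x -> (lev x <= k)%N.
Variables (r q : X -> R) (a c cq beta C1 C2 rho : R).
Hypothesis ge : good_exponent mu ball lev r q a c cq beta C1 C2 rho.
Variables (b : X -> R) (K : R).
Hypothesis mb : measurable_fun setT b.
Hypothesis ib : forall x g, mu.-integrable (ball x g) (EFin \o b).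
Hypothesis K0 : 0 < K.
Hypothesis bK : forall x g, (bosc mu ball Q b g g x <= K%:E)%E.

Local Open Scope ereal_scope.
Notation bavg := (bavg mu ball Q b).
Notation bweight := (bweight mu ball Q b).

Let Q1 := us_Q1 us.
Let Q0 : (0 < Q)%R := Q0 us.
Let QK0 : (0 <= Q * K)%R. Proof. by rewrite mulr_ge0// ltW. Qed.
Let cq1 : (1 <= cq)%R.
Proof.
apply: le_trans (ge_cq ge o); apply: le_trans (exponent_rq ge o).
have /andP[ar _] := ge_r ge o; apply: le_trans ar; apply: le_trans (ge_a ge).
by rewrite -[leLHS]mulr1 ler_pM// ltW// (ge_rho ge).
Qed.
Let cq0 : (0 < cq)%R := lt_le_trans ltr01 cq1.

Lemma bavg_growth (l n : nat) x :
  (`|bavg l%:Z x - bavg (l + n)%N%:Z x| <= n%:R * (Q * K))%R.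
Proof.
elim: n => [|n ih]; first by rewrite addn0 subrr normr0 mul0r.
have h : (`|bavg (l + n)%N%:Z x - bavg (l + n.+1)%N%:Z x| <= Q * K)%R.
  rewrite -lee_fin; apply: (le_trans (bavg_dist us mb ib _ x _)).
  apply: (le_trans (Ea_parent us _ _ _ _)).
  - by move=> y; rewrite lee_fin.
  - apply/measurable_EFinP; apply: measurableT_comp => //.
    exact: measurable_funB.
  have -> : ((l + n)%N%:Z + 1 = (l + n.+1)%N%:Z)%R by lia.
  by rewrite EFinM lee_wpmul2l ?lee_fin ?(ltW Q0)//; exact: bK.
rewrite -natr1 mulrDl mul1r (le_trans _ (lerD ih h))//.
by rewrite (le_trans _ (ler_normD _ _))// addrA subrK.
Qed.

(** Moving the mean of [b] from level [g] to level [lev x] costs a multiple of [g - lev x], hence a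
    power of it in the weight. The negative power of [Q ^ g] in [err] absorbs this, leaving a bound
    independent of [g]. *)
Lemma bweight_err : exists2 C, (0 <= C)%R & forall g x,
  bweight cq g x * (err Q lev cq g x)%:E <=
  bweight cq (lev x)%:Z x * (C * (Q ^+ (2 * lev x))^-1)%:E.
Proof.
pose de := ((2 * cq)^-1)%R.
have de0 : (0 < de)%R by rewrite invr_gt0 mulr_gt0.
have th1 : (1 < Q `^ de)%R.
  have := @gt0_ltr_powR R de de0 1%R Q; rewrite powR1; apply; rewrite ?nnegrE//.
  exact: ltW.
set th := (Q `^ de)%R in th1; have th0 : (0 < th)%R by exact: lt_trans th1.
have A0 : (0 <= 1 + Q * K)%R by rewrite addr_ge0.
have [C' C'0 C'P] := powR_le_exp th1 A0 cq0.
exists (C' * th)%R; first by rewrite mulr_ge0// ltW.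
move=> g x; rewrite /bweight -2!EFinM lee_fin /err; set l := lev x.
case: ifPn => [/andP[g1 lg]|_]; last first.
  by rewrite mulr0 !mulr_ge0 ?powR_ge0 ?invr_ge0 ?exprn_ge0// ltW.
pose n := (`|g|%N - l)%N; have gE : g = (l + n)%N%:Z.
  by rewrite /n; move: g1 lg; clear; lia.
set u := (`|b x - bavg l%:Z x|)%R.
have u0 : (0 <= u)%R by exact: normr_ge0.
have nQK : (0 <= n%:R * (Q * K))%R by rewrite mulr_ge0.
have h1 : (1 + `|b x - bavg g x| <= (1 + u) * ((1 + Q * K) * n.+1%:R))%R.
  have h : (`|b x - bavg g x| <= u + n%:R * (Q * K))%R.
    rewrite gE; apply: (le_trans _ (lerD (lexx u) (bavg_growth l n x))).
    by rewrite (le_trans _ (ler_normD _ _))// addrA subrK.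
  apply: (@le_trans _ _ ((1 + u) * (1 + n%:R * (Q * K)))%R).
    have : (0 <= u * (n%:R * (Q * K)))%R by rewrite mulr_ge0.
    have -> : ((1 + u) * (1 + n%:R * (Q * K)) =
      1 + (u + n%:R * (Q * K)) + u * (n%:R * (Q * K)))%R by ring.
    move=> p; rewrite -[leLHS]addr0 lerD// lerD2l.
    exact: h.
  rewrite ler_wpM2l ?addr_ge0// -natr1 -subr_ge0.
  have -> : ((1 + Q * K) * (n%:R + 1) - (1 + n%:R * (Q * K)) = n%:R + Q * K)%R by ring.
  exact: addr_ge0.
(* The exponent 4 of the decay was chosen for this: its square root [Q ^ (- 2 * l)] beats the
   measure [Q ^ l] of the ball around [o] and leaves a summable [Q ^ (- l)]. *)
have h2 : ((lev_decay Q lev x) `^ 2^-1 = (Q ^+ (2 * l))^-1)%R.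
  have -> : (lev_decay Q lev x = ((Q ^+ (2 * l))^-1) ^+ 2)%R.
    have l4 : (4 * lev x = 2 * l * 2)%N by rewrite -/l mulnAC.
    by rewrite /lev_decay l4 exprM exprVn.
  by rewrite powR12_sqrt ?sqr_ge0// sqrtr_sqr ger0_norm// invr_ge0 exprn_ge0// ltW.
have h3 : ((Q ^ g) `^ (- de) <= (th ^+ n)^-1)%R.
  have thn : (0 < th ^+ n)%R by rewrite exprn_gt0.
  rewrite powRN lef_pV2 ?posrE ?powR_gt0 ?(Qg0 us)//.
  have -> : (th ^+ n = (Q ^+ n) `^ de)%R.
    by rewrite -(powR_mulrn n (ltW th0)) -(powR_mulrn n (ltW Q0)) /th powRAC.
  apply: ler_powR2; [exact: ltW|by rewrite exprn_ge0// ltW|].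
  by rewrite gE -exprnP ler_weXn2l ?(ltW Q1)// leq_addl.
rewrite -/de h2.
apply: (@le_trans _ _ (((1 + u) `^ cq * (C' * th ^+ n.+1)) *
    ((Q ^+ (2 * l))^-1 * (th ^+ n)^-1))%R).
  have il0 : (0 <= (Q ^+ (2 * l))^-1)%R by rewrite invr_ge0 exprn_ge0// ltW.
  apply: ler_pM; [exact: powR_ge0|by apply: mulr_ge0 => //; exact: powR_ge0| |].
    apply: (@le_trans _ _ (((1 + u) * ((1 + Q * K) * n.+1%:R)) `^ cq)%R).
      by apply: ler_powR2 => //; exact: ltW.
    by rewrite powRM ?addr_ge0 ?mulr_ge0 ?addr_ge0// ler_wpM2l ?powR_ge0.
  exact: ler_wpM2l.
rewrite exprS le_eqVlt; apply/orP; left; apply/eqP; field.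
by rewrite !expf_neq0// gt_eqF.
Qed.

(* Every integral operator of the theorem is dominated by the supremum over
   [g] of the left-hand side. *)
Lemma key_estimate : exists2 C : R, (0 <= C)%R & forall f : X -> R,
  (forall x, (0 <= f x)%R) -> measurable_fun setT f ->
  \int[mu]_x (f x `^ r x)%:E <= 1 ->
  exists Psi : X -> \bar R, [/\ forall x, 0 <= Psi x, measurable_fun setT Psi,
    \int[mu]_x Psi x <= C%:E &
    {ae mu, forall x g, (((Q ^ g) `^ beta)%:E *
      Ea mu ball Q (fun y => ((1 + `|b x - b y|) * f y)%:E) g x) `^ (q x) <= Psi x}].
Proof.
have rho1 := ge_rho ge; have rho0 : (0 < rho)%R by exact: lt_trans rho1.
have irho1 : (0 < 1 - rho^-1)%R by rewrite subr_gt0 invf_lt1.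
(* The exponent conjugate to [rho]. [MP] will be used for one ball at a time, as a bound for the
   mean of [(1 + |b - b_B|) ^ s']. *)
pose s' := ((1 - rho^-1)^-1)%R.
have s'1 : (1 <= s')%R by rewrite /s' invf_ge1// gerBl invr_ge0 ltW.
have [M M0 MP] := carleson_bmo us mb ib K0 bK s'1.
have [Kc Kc0 KcP] := carleson_bmo us mb ib K0 bK cq1.
have [Ce Ce0 CeP] := bweight_err.
pose CP := pointwise_const Q cq C1 C2 rho.
pose cc := ((M + 2) `^ cq * `|CP|)%R.
have cc0 : (0 <= cc)%R by rewrite mulr_ge0// powR_ge0.
have W0 g x : 0 <= bweight cq g x by rewrite lee_fin powR_ge0.
have mW g : measurable_fun setT (bweight cq g) by exact: bweight_measurable.
pose CE := (2 * Kc * expR rho * (2 `^ (rho - 1) * expR (rho - 1) / (expR (rho - 1) - 1)))%R.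
have CE0 : (0 <= CE)%R.
  apply: mulr_ge0; first by rewrite !mulr_ge0// expR_ge0.
  apply: divr_ge0; first by rewrite mulr_ge0 ?powR_ge0 ?expR_ge0.
  by rewrite subr_ge0 ltW// expR_gt1 subr_gt0.
pose C3 := (2 `^ rho * (1 + Q / (Q - 1)))%R.
have QQ : (0 <= Q / (Q - 1))%R by rewrite divr_ge0 ?(ltW Q0)// subr_ge0 ltW.
have C30 : (0 <= C3)%R by rewrite mulr_ge0 ?powR_ge0 ?addr_ge0.
exists (cc * (CE * C3 + Ce * Kc * (Q / (Q - 1))))%R.
  by apply: mulr_ge0 => //; apply: addr_ge0; apply: mulr_ge0 => //; exact: mulr_ge0.
move=> f f0 mf If.
pose EG g x := Ea mu ball Q (fun y => (Gf Q lev r rho f y)%:E) g x.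
pose S x := ereal_sup [set bweight cq g x * (EG g x) `^ rho | g in [set: int]].
pose F k x := bweight cq k%:Z x * (Ce * (Q ^+ (2 * k))^-1)%:E.
have F0 k x : 0 <= F k x.
  by rewrite mule_ge0// lee_fin mulr_ge0// invr_ge0 exprn_ge0// ltW.
have mF k : measurable_fun setT (F k) by apply: emeasurable_funM => //; exact: measurable_cst.
have mG := Gf_measurable us lev_ball lev_min ge mf.
have S0 x : 0 <= S x.
  apply: (@le_trans _ _ (bweight cq 0%R x * EG 0%R x `^ rho)).
    by rewrite mule_ge0// poweR_ge0.
  by apply: ereal_sup_ubound; exists 0%R.
have mS : measurable_fun setT S.
  apply: measurable_ereal_sup_int => g _; apply: emeasurable_funM => //.
  apply: (measurableT_comp (measurable_poweR rho)); exact: Ea_measurable.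
have L0 x : 0 <= lev_sum ball o F x by exact: lev_sum_ge0.
have mL : measurable_fun setT (lev_sum ball o F) by exact: (lev_sum_measurable us).
exists (fun x => cc%:E * (S x + lev_sum ball o F x)); split.
- by move=> x; rewrite mule_ge0// adde_ge0.
- by apply: measurable_funeM; exact: emeasurable_funD.
- rewrite ge0_integralZl ?lee_fin//; last 2 first.
  + exact: emeasurable_funD.
  + by move=> x _; exact: adde_ge0.
  rewrite ge0_integralD// [leRHS]EFinM; apply: lee_wpmul2l; first by rewrite lee_fin.
  rewrite EFinD; apply: leeD.
    have IG := Gf_int us lev_ball lev_min ge mf If.
    apply: (le_trans (carleson_embedding_fixed us W0 mW Kc0 rho1 KcP _ mG _)).
    + by move=> x; rewrite ltW// (Gf_gt0 us).
    + by apply: le_lt_trans IG _; rewrite ltry.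
    + by rewrite [leRHS]EFinM; apply: lee_wpmul2l; rewrite ?lee_fin.
  apply: (integral_lev_sum us F0 mF); first exact: mulr_ge0.
  move=> k; rewrite /F.
  have cE : (0 <= Ce * (Q ^+ (2 * k))^-1)%R.
    by rewrite mulr_ge0// invr_ge0 exprn_ge0// ltW.
  rewrite ge0_integralZr//; last 2 first.
  + exact: (us_meas us).
  + exact: measurable_funTS.
  apply: (@le_trans _ _ ((Kc * Q ^ k%:Z)%:E * (Ce * (Q ^+ (2 * k))^-1)%:E)).
    rewrite lee_wpmul2r ?lee_fin//; apply: le_trans (KcP o k%:Z).
    apply: le_int => x _ //; apply: ereal_sup_ubound; exists k%:Z => /=//.
  rewrite -EFinM lee_fin -exprnP mul2n -addnn exprD le_eqVlt; apply/orP; left; apply/eqP.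
  by field; rewrite expf_neq0// gt_eqF.
have := pointwise_estimate us lev_ball lev_min ge f0 mf If.
apply: filterS => x hx g; have [V [V0 fV DV]] := hx g.
have qx0 := exponent_q0 ge x.
set w := (1 + `|b x - bavg g x|)%R.
have w1 : (1 <= w)%R by rewrite lerDl.
have w0 : (0 <= w)%R by exact: le_trans w1.
pose u y := (1 + `|b y - bavg g x|)%R.
have u0 y : (0 <= u y)%R by rewrite addr_ge0.
have mu_ : measurable_fun setT u.
  apply: measurable_funD => //; apply: measurableT_comp => //.
  exact: measurable_funB.
have uM : Ea mu ball Q (fun y => (u y `^ s')%:E) g x <= M%:E.
  rewrite (Ea_leP us); apply: le_trans (MP x g); apply: le_int => y xy.
    by rewrite lee_fin powR_ge0.
  apply: ereal_sup_ubound; exists g => //=.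
  by rewrite /bweight /u (bavg_ball us b xy).
have ss : (s'^-1 = 1 - rho^-1)%R by rewrite invrK.
have Eu := Ea_young us rho1 ss V0 f0 mf u0 mu_ uM fV.
have Qgb0 : (0 <= (Q ^ g) `^ beta)%R by exact: powR_ge0.
have h : ((Q ^ g) `^ beta)%:E *
    Ea mu ball Q (fun y => ((1 + `|b x - b y|) * f y)%:E) g x <=
    (w * (M + 2) * ((Q ^ g) `^ beta * V))%:E.
  have -> : (w * (M + 2) * ((Q ^ g) `^ beta * V) =
    (Q ^ g) `^ beta * (w * (V * (M + 2))))%R by ring.
  rewrite EFinM; apply: lee_wpmul2l; first by rewrite lee_fin.
  apply: (@le_trans _ _ (w%:E * Ea mu ball Q (fun y => (u y * f y)%:E) g x)).
    rewrite -(EaZ us)//; last 2 first.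
    + by move=> y; rewrite lee_fin mulr_ge0.
    + by apply/measurable_EFinP; exact: measurable_funM.
    apply: (Ea_le us) => y _; first by rewrite lee_fin mulr_ge0// addr_ge0.
    rewrite -EFinM lee_fin mulrA ler_wpM2r//.
    (* The kernel is bounded by a product of a function of [x] and one of [y], from
       [1 + s + t <= (1 + s) * (1 + t)]. *)
    have t : (`|b x - b y| <= `|b x - bavg g x| + `|b y - bavg g x|)%R.
      rewrite [X in (_ <= _ + X)%R]distrC (le_trans _ (ler_normD _ _))//.
      by rewrite addrA subrK.
    have p : (0 <= `|b x - bavg g x| * `|b y - bavg g x|)%R by rewrite mulr_ge0.
    have -> : (w * u y = 1 + (`|b x - bavg g x| + `|b y - bavg g x|) +
        `|b x - bavg g x| * `|b y - bavg g x|)%R by rewrite /w /u; ring.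
    by rewrite -[leLHS]addr0 lerD// lerD2l.
  by rewrite EFinM lee_wpmul2l// lee_fin.
have E0 : 0 <= ((Q ^ g) `^ beta)%:E *
    Ea mu ball Q (fun y => ((1 + `|b x - b y|) * f y)%:E) g x.
  rewrite mule_ge0 ?lee_fin//; apply: (Ea_ge0 us) => y.
  by rewrite lee_fin mulr_ge0// addr_ge0.
have M20 : (0 <= M + 2)%R by rewrite addr_ge0.
have D0 : (0 <= (Q ^ g) `^ beta * V)%R by rewrite mulr_ge0// ltW.
apply: (@le_trans _ _ ((w * (M + 2) * ((Q ^ g) `^ beta * V))%:E `^ q x)).
  apply: gt0_ler_poweR; rewrite ?in_itv/= ?leey ?andbT//; first exact: ltW.
  by rewrite lee_fin !mulr_ge0// ltW.
rewrite poweR_EFin (powRM (q x) (mulr_ge0 w0 M20) D0) (powRM (q x) w0 M20).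
have EGr0 : 0 <= EG g x `^ rho by exact: poweR_ge0.
have er0 : 0 <= (err Q lev cq g x)%:E.
  by rewrite lee_fin /err; case: ifP => // _; rewrite mulr_ge0 ?powR_ge0.
have DV' : (((Q ^ g) `^ beta * V) `^ q x)%:E <= `|CP|%:E * (EG g x `^ rho + (err Q lev cq g x)%:E).
  apply: (le_trans DV); rewrite lee_wpmul2r ?adde_ge0// lee_fin ler_norm//.
apply: (@le_trans _ _ ((w `^ cq * (M + 2) `^ cq)%:E *
    (`|CP|%:E * (EG g x `^ rho + (err Q lev cq g x)%:E)))).
  rewrite [leLHS]EFinM; apply: lee_pmul.
  - by rewrite lee_fin mulr_ge0 ?powR_ge0.
  - by rewrite lee_fin powR_ge0.
  - rewrite lee_fin; apply: ler_pM; rewrite ?powR_ge0//; apply: ler_powR => //; try exact: (ge_cq ge).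
    by rewrite ler_wpDl// ler1n.
  - exact: DV'.
rewrite muleA -EFinM.
have -> : (w `^ cq * (M + 2) `^ cq * `|CP| = cc * w `^ cq)%R by rewrite /cc; ring.
rewrite EFinM -muleA; apply: lee_wpmul2l; first by rewrite lee_fin.
rewrite ge0_muleDr//; apply: leeD.
  by apply: ereal_sup_ubound; exists g.
apply: (le_trans (CeP g x)); exact: (lev_sum_ge lev_ball F0 x).
Qed.

End Key.

(** * The p-adic balls form an ultrametric space *)

Section PadicBalls.
Context {R : realType} {p n : nat}.
Hypothesis p1 : (1 < p)%N.
Local Notation X := (QpnT R p n).

Let pR1 : 1 < p%:R :> R. Proof. by rewrite ltr1n. Qed.
Let pR0 : 0 < p%:R :> R. Proof. exact: lt_trans ltr01 pR1. Qed.

Lemma qp_agree_exists (x y : Qp p) : exists M : nat, qp_agree x y M%:Z.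
Proof.
have [_ [mx xm]] := digitP x; have [_ [my ym]] := digitP y.
exists (`|mx| + `|my|)%N => k kM; rewrite xm ?ym//; move: kM; clear; lia.
Qed.

(** The infimum runs over powers of [p]: if agreement fails for [g], all competing powers are at
    least [p ^ (g + 1)]. *)
Lemma padic_dist_le (x y : Qp p) (g : int) :
  padic_dist R x y <= (p%:R : R) ^ g <-> qp_agree x y g.
Proof.
set S := [set (p%:R : R) ^ g | g in [set g : int | qp_agree x y g]].
have lb : has_lbound S by exists 0 => _ [k _ <-]; rewrite exprz_ge0// ltW.
split; last by move=> gxy; apply: ge_inf => //; exists g.
move=> dg; apply: contrapT => ng.
have : (p%:R : R) ^ (g + 1) <= (p%:R : R) ^ g.
  apply: le_trans dg; apply: lb_le_inf.
    by have [M xyM] := qp_agree_exists x y; exists (p%:R ^ M%:Z); exists M%:Z.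
  move=> _ [k xyk <-]; apply: ler_weXz2l; first exact: ltW.
  rewrite leNgt; apply/negP => kg; apply: ng => j jg; apply: xyk.
  by move: kg jg; clear; lia.
rewrite leNgt => /negP; apply; rewrite expfzDr ?gt_eqF// expr1z.
by rewrite ltr_pMr// exprz_gt0.
Qed.

Lemma pballP (x y : Qpn p n) g :
  pball R x g y <-> forall j (k : int), k < - g -> digit (y j) k = digit (x j) k.
Proof.
have p0 : 0 <= (p%:R : R) ^ g by rewrite exprz_ge0// ltW.
rewrite /pball/= /qpn_dist; split.
  move=> /bigmax_leP[_ h] j k kg; have /padic_dist_le := h j isT; exact.
by move=> h; apply/bigmax_leP; split => // j _; apply/padic_dist_le => k; exact: h.
Qed.

(** A ball of level [g] depends only on the digits of index below [- g]. These vanish below some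
    [- M], so [M] and finitely many digits per coordinate encode the ball. *)
Lemma pball_countable : exists c : int -> nat -> Qpn p n,
  forall g x, exists i, pball R (c g i) g x.
Proof.
pose T := (nat * {ffun 'I_n -> seq nat})%type.
pose P (g : int) (t : T) : set (Qpn p n) := [set x : Qpn p n | forall j (k : int), k < - g ->
  digit (x j) k = if k < - t.1%:Z then 0%N else nth 0%N (t.2 j) (absz (k + t.1%:Z))].
pose o : Qpn p n := fun _ => Qp0 p.
exists (fun g i => if (unpickle i : option T) is Some t then xget o (P g t) else o).
move=> g x.
have [M xM] : exists M : nat, forall j (k : int), k < - M%:Z -> digit (x j) k = 0%N.
  have /choice[f fP] : forall j, exists M : nat, qp_agree (x j) (Qp0 p) M%:Z.
    by move=> j; exact: qp_agree_exists.
  exists (\max_j f j)%N => j k kM; rewrite (fP j)//.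
  by have := leq_bigmax (F := f) j; move: kM; clear; lia.
pose t : T := (M, [ffun j => mkseq (fun i => digit (x j) (i%:Z - M%:Z)) (`|g| + M)%N]).
have Px : P g t x.
  move=> j k kg /=; case: ifPn => [kM|]; first exact: xM.
  rewrite -leNgt => Mk; rewrite ffunE nth_mkseq; last by move: kg Mk; clear; lia.
  by congr (digit _ _); move: Mk; clear; lia.
exists (pickle t); rewrite pickleK; apply/pballP => j k kg.
have := xgetPex o (ex_intro _ x Px) => /(_ j k kg) ->.
exact: Px.
Qed.

Variable mu : {measure set X -> \bar R}.
Hypothesis mu_ball : forall (x : X) (g : int),
  mu (qball x g) = ((p%:R : R) ^ (n%:Z * g))%:E.
Hypothesis n0 : (0 < n)%N.

Lemma padic_ultra_space : ultra_space mu (@qball R p n) (p%:R ^+ n).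
Proof.
have sym (x y : X) g : qball x g y -> qball y g x.
  by move=> /pballP h; apply/pballP => j k kg; rewrite h.
have sub (x y : X) g : qball x g y -> qball y g `<=` qball x g.
  by move=> /pballP h z /pballP h'; apply/pballP => j k kg; rewrite h'// h.
split.
- by rewrite exprn_egt1// -lt0n.
- by move=> x g; apply/pballP.
- by move=> x y g xy; apply/seteqP; split; apply: sub => //; exact: sym.
- move=> x g g' gg' y /pballP h; apply/pballP => j k kg; apply: h.
  by move: kg gg'; clear; lia.
- by move=> x g; apply: sub_sigma_algebra; exists x, g.
- by move=> x g; rewrite mu_ball exprnP exprz_exp.
- exact: pball_countable.
- move=> x y; have /choice[f fP] : forall j, exists M : nat, qp_agree (y j) (x j) M%:Z.
    by move=> j; exact: qp_agree_exists.
  exists (\max_j f j)%N%:Z; apply/pballP => j k kM; apply: fP.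
  by have := leq_bigmax (F := f) j; move: kM; clear; lia.
- by [].
Qed.

Variable lev : X -> nat.
Hypothesis lev_ball : forall x, qball (fun _ => Qp0 p : Qp p) (lev x)%:Z x.
Hypothesis lev_min : forall x (k : nat), qball (fun _ => Qp0 p : Qp p) k%:Z x -> (lev x <= k)%N.

(** With [m] the smaller level, both norms are at least [p ^ (m - 1)], and [m - 1 >= m / 2] once
    [m >= 3]. For [m <= 2] the summand [p] already makes the logarithm at least 1. *)
Lemma log_norm_ge (x y : X) : (minn (lev x) (lev y))%:R / 2 <=
  ln (p%:R + Num.min (qpn_norm R x) (qpn_norm R y)) / ln p%:R.
Proof.
set m := minn _ _; have lnp0 : 0 < ln p%:R :> R by rewrite ln_gt0.
have nn z : 0 <= qpn_norm R z by rewrite /qpn_norm /qpn_dist; exact: bigmax_ge_id.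
have m0 : 0 <= Num.min (qpn_norm R x) (qpn_norm R y) by rewrite le_min !nn.
have l1 : 1 <= ln (p%:R + Num.min (qpn_norm R x) (qpn_norm R y)) / ln p%:R.
  by rewrite ler_pdivlMr// mul1r ler_ln ?posrE ?ltr_wpDr// lerDl.
have [m1|m1] := leqP m 2.
  apply: le_trans l1; rewrite ler_pdivrMr// mul1r.
  by rewrite ler_nat.
have lt z : (m <= lev z)%N -> p%:R ^+ m.-1 <= qpn_norm R z.
  move=> mz; rewrite leNgt; apply/negP => /ltW h.
  have : (lev z <= m.-1)%N by apply: lev_min; rewrite /qball /pball/= -exprnP.
  by move: mz m1; clear; lia.
apply: (@le_trans _ _ (m.-1%:R)).
  rewrite ler_pdivrMr// -natrM ler_nat.
  by move: m1; clear; lia.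
rewrite ler_pdivlMr// mulr_natl -lnXn// ler_ln ?posrE ?exprn_gt0 ?ltr_wpDr//.
by rewrite ler_wpDl ?(ltW pR0)// le_min !lt// ?geq_minl ?geq_minr.
Qed.

Lemma Cloginf_lev (r : X -> R) : Cloginf r ->
  exists2 C, 0 <= C & forall x y, `|r x - r y| * (minn (lev x) (lev y))%:R <= C.
Proof.
move=> [C rC]; exists (2 * `|C|) => [|x y]; first exact: mulr_ge0.
have := rC x y; have := log_norm_ge x y.
set L := ln _ / _; set m : R := (minn _ _)%:R => mL h.
have m0 : 0 <= m by rewrite /m.
have [me|me] := eqVneq m 0; first by rewrite me mulr0 mulr_ge0.
have L0 : 0 < L.
  by apply: lt_le_trans mL; rewrite divr_gt0// lt_neqAle eq_sym me.
rewrite ler_pdivlMr// in h.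
apply: (@le_trans _ _ (`|r x - r y| * (2 * L))).
  by rewrite ler_wpM2l// mulrC -ler_pdivrMr.
by rewrite mulrCA ler_wpM2l// (le_trans h)// ler_norm.
Qed.

End PadicBalls.

(** * Almost everywhere comparison and variable powers *)

Section AlmostEverywhere.
Context {R : realType} {d} {X : measurableType d} (mu : {measure set X -> \bar R}).
Local Open Scope ereal_scope.

(** Counterpart of [le_int_ae] with measurability on the smaller side, by removing the null set from
    its integral. It serves for a larger function built from [frac_max_in]. *)
Lemma le_int_ae_l (D : set X) (f1 f2 : X -> \bar R) : measurable D ->
  (forall x, D x -> 0 <= f1 x) -> (forall x, D x -> 0 <= f2 x) ->
  measurable_fun D f1 -> {ae mu, forall x, D x -> f1 x <= f2 x} ->
  \int[mu]_(x in D) f1 x <= \int[mu]_(x in D) f2 x.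
Proof.
move=> mD f10 f20 mf1 [N [mN N0 subN]].
rewrite (ge0_negligible_integral mN)//.
rewrite [leLHS]integral_mkcond [leRHS]integral_mkcond.
apply: le_int => x _; first by apply: erestrict_ge0 => y [Dy _]; exact: f10.
rewrite !patchE; case: ifPn => [|_].
  rewrite inE => -[Dx Nx]; rewrite mem_set//.
  by apply: contrapT => h; apply: Nx; apply: subN => /= /(_ Dx).
by case: ifPn => // xD; rewrite f20//; exact/set_mem.
Qed.

Lemma ae_witness (A : set X) (P : X -> Prop) : measurable A -> mu A != 0 ->
  {ae mu, forall x, P x} -> exists x, A x /\ P x.
Proof.
move=> mA A0 [N [mN N0 subN]]; apply: contrapT => h.
move/eqP : A0; apply; apply: (subset_measure0 _ mN _ N0) => // x Ax.
by apply: subN => Px; apply: h; exists x.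
Qed.

Lemma measurable_funV (f : X -> R) : measurable_fun setT f ->
  measurable_fun setT (fun x => (f x)^-1)%R.
Proof.
move=> mf; have -> : (fun x => (f x)^-1)%R = (fun x => f x * `|f x| `^ (- 2%:R))%R.
  apply/funext => x; rewrite powR_invn// real_normK ?num_real//.
  have [->|fx] := eqVneq (f x) 0%R; first by rewrite invr0 mul0r.
  by field.
apply: measurable_funM => //; apply: (measurableT_comp (measurable_powR _)).
exact: measurableT_comp.
Qed.

Lemma measurable_poweR2 (F : X -> \bar R) (q : X -> R) :
  measurable_fun setT F -> measurable_fun setT q ->
  measurable_fun setT (fun x => F x `^ q x).
Proof.
move=> mF mq.
have -> : (fun x => F x `^ q x) = (fun x =>
    if F x == +oo then (if q x == 0%R then 1 else +oo) else
    if F x == -oo then (if q x == 0%R then 1 else 0) else (fine (F x) `^ q x)%:E).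
  apply/funext => x; case: (F x) => [y| |] //=.
have mq0 : measurable_fun setT (fun x => q x == 0%R) by exact: measurable_fun_eqr.
have me y : measurable_fun setT (fun x => F x == y).
  apply: (@measurable_fun_bool _ _ _ _ true).
  rewrite (_ : _ @^-1` _ = F @^-1` [set y]); last first.
    by apply/seteqP; split => x /= /eqP.
  by rewrite setTI -[X in measurable X]setTI; exact: mF.
apply: measurable_fun_ifT => //; first exact: measurable_fun_ifT.
apply: measurable_fun_ifT => //; first exact: measurable_fun_ifT.
apply/measurable_EFinP; apply: measurable_powR2 => //.
exact: measurableT_comp.
Qed.

End AlmostEverywhere.

(** * Essential bounds of exponents *)

Section EssentialBounds.
Context {R : realType} {p n : nat}.
Local Notation X := (QpnT R p n).
Variable mu : {measure set X -> \bar R}.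
Local Open Scope ereal_scope.

Lemma esup_onE (A : set X) (q : X -> R) :
  esup_on mu A q = ess_sup mu (fun x => if `[< A x >] then (q x)%:E else -oo).
Proof.
congr ereal_inf; apply/seteqP; split => y /=; apply: filterS => x.
  by case: asboolP => [Ax h|_ _]; [exact: h|rewrite leNye].
by case: asboolP.
Qed.

Lemma einf_onE (A : set X) (q : X -> R) :
  einf_on mu A q = ess_inf mu (fun x => if `[< A x >] then (q x)%:E else +oo).
Proof.
congr ereal_sup; apply/seteqP; split => y /=; apply: filterS => x.
  by case: asboolP => [Ax h|_ _]; [exact: h|rewrite leey].
by case: asboolP.
Qed.

Lemma esup_on_ge (A : set X) (q : X -> R) :
  {ae mu, forall x, A x -> (q x)%:E <= esup_on mu A q}.
Proof.
rewrite esup_onE; have := ess_sup_ge mu (fun x => if `[< A x >] then (q x)%:E else -oo).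
by apply: filterS => x + Ax; rewrite asboolT.
Qed.

Lemma einf_on_le (A : set X) (q : X -> R) :
  {ae mu, forall x, A x -> einf_on mu A q <= (q x)%:E}.
Proof.
rewrite einf_onE; have := ess_inf_le mu (fun x => if `[< A x >] then (q x)%:E else +oo).
by apply: filterS => x + Ax; rewrite asboolT.
Qed.

Lemma modular_ae (r r' : X -> R) (F : X -> \bar R) (e : R) :
  measurable_fun setT r -> measurable_fun setT r' -> measurable_fun setT F ->
  {ae mu, forall x, r x = r' x} -> modular mu r F e = modular mu r' F e.
Proof.
move=> mr mr' mF rr'.
have mI s : measurable_fun setT s -> measurable_fun setT (fun x => (`|F x| * (e^-1)%:E) `^ s x).
  move=> ms; apply: measurable_poweR2 => //; apply: emeasurable_funM => //.
  exact: measurableT_comp.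
apply: ge0_ae_eq_integral => //; try exact: mI; try by move=> x _; exact: poweR_ge0.
by apply: filterS rr' => x rx _; rewrite rx.
Qed.

End EssentialBounds.

(** * From admissible exponents to clamped ones *)

Section Admissible.
Context {R : realType} {p n : nat}.
Local Notation X := (QpnT R p n).
Variables (alpha : R) (mu : {measure set X -> \bar R}).
Hypothesis p1 : (1 < p)%N.
Hypothesis mu_ball : forall (x : X) (g : int),
  mu (qball x g) = ((p%:R : R) ^ (n%:Z * g))%:E.
Hypothesis n0 : (0 < n)%N.
Hypothesis alpha0 : 0 < alpha.
Hypothesis alphan : alpha < n%:R.
Local Notation Q := ((p%:R : R) ^+ n).
Let us := padic_ultra_space p1 mu_ball n0.
Variable lev : X -> nat.
Hypothesis lev_ball : forall x, qball (fun _ => Qp0 p : Qp p) (lev x)%:Z x.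
Hypothesis lev_min : forall x (k : nat), qball (fun _ => Qp0 p : Qp p) k%:Z x -> (lev x <= k)%N.

(** Almost every [x] satisfies [r x <= esup] on all balls around it at once, because each level has
    only countably many balls. An infinite essential bound is excluded since [g < 0] would turn the
    product into [+oo]. *)
Lemma Clog0_ae (r : X -> R) : Clog0 mu r -> exists2 C, 0 <= C &
  {ae mu, forall x, forall g : int, g < 0 ->
    {ae mu, forall y, qball x g y -> - g%:~R * (r x - r y) <= C}}.
Proof.
move=> [C rC]; exists `|C| => //.
have [c cP] := us_count us.
have H : {ae mu, forall x, forall (k i : nat), qball (c (- k.+1%:Z) i) (- k.+1%:Z) x ->
    ((r x)%:E <= esup_on mu (qball (c (- k.+1%:Z)%R i) (- k.+1%:Z)%R) r)%E}.
  by apply: ae_foralln => k; apply: ae_foralln => i; exact: esup_on_ge.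
apply: filterS H => x hx g g0.
have rx : ((r x)%:E <= esup_on mu (qball x g) r)%E.
  have gE : g = - (`|g|%N.-1).+1%:Z by move: g0; clear; lia.
  have [i ci] := cP g x; have := hx `|g|%N.-1 i; rewrite -gE => /(_ ci).
  by rewrite (us_eq us ci).
apply: filterS (einf_on_le mu (qball x g) r) => y + xy => /(_ xy) ry.
have {rC} := rC g x.
case: (einf_on mu (qball x g) r) ry => [E| |]//; rewrite ?leNye ?leye_eq//.
- rewrite lee_fin => ry.
  case: (esup_on mu (qball x g) r) rx => [S| |]//; rewrite ?lee_fin.
    move=> rx h; apply: (le_trans _ (ler_norm C)); apply: le_trans h.
    have g0' : (g%:~R : R) <= 0 by rewrite lerz0 ltW.
    rewrite -subr_ge0.
    have -> : g%:~R * (E - S) - - g%:~R * (r x - r y) = g%:~R * ((E - r y) + (r x - S)) :> R.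
      by ring.
    by rewrite mulr_le0// -[leRHS]addr0 lerD// subr_le0.
  by move=> _; rewrite addeNy lt0_muleNy ?leye_eq// lte_fin ltrz0.
- by move=> _; rewrite addNye lt0_muleNy ?leye_eq// lte_fin ltrz0.
Qed.

Lemma clamp_lipschitz (a c x y : R) : a <= c ->
  `|Num.max a (Num.min x c) - Num.max a (Num.min y c)| <= `|x - y|.
Proof.
move=> ac.
have E v : [\/ Num.max a (Num.min v c) = a /\ v <= a,
    Num.max a (Num.min v c) = v /\ a <= v <= c | Num.max a (Num.min v c) = c /\ c <= v].
  have [vc|cv] := leP v c; last first.
    by apply: Or33; rewrite ?(max_idPr ac); split => //; exact: ltW.
  have [va|av] := leP v a; first by apply: Or31; rewrite ?(max_idPl va).
  by apply: Or32; rewrite ?(max_idPr (ltW av)) (ltW av).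
have := ler_norm (x - y); have := ler_norm (y - x); rewrite distrC.
move=> h1 h2; rewrite ler_norml; apply/andP.
by case: (E x) => -[-> h3]; case: (E y) => -[-> h4]; split; lra.
Qed.

Let beta := alpha / n%:R.
Let beta0 : 0 < beta. Proof. by rewrite divr_gt0// ltr0n. Qed.

(** Uniform bounds on [r] hold only almost everywhere, while [good_exponent] asks for them
    everywhere. Clamping [r] changes it on a null set and, being 1-Lipschitz, keeps the log-Hoelder
    bounds at every point. *)
Lemma admissible_good (r q : X -> R) : admissible mu alpha r q ->
  exists (r' q' : X -> R) (a c cq C1 C2 rho : R),
   [/\ good_exponent mu (@qball R p n) lev r' q' a c cq (alpha / n%:R) C1 C2 rho,
     {ae mu, forall x, r x = r' x /\ q x = q' x},
     measurable_fun setT r & measurable_fun setT q].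
Proof.
move=> [[r0 rinf] _ [mr r1 einf _] esup qr].
have [a [a1 ar]] : exists a, 1 < a /\ {ae mu, forall x, a <= r x}.
  move: einf => /ereal_sup_gt[[y| |]// yr].
  - rewrite lte_fin => y1; exists y; split => //.
    by apply: filterS yr => x /(_ I); rewrite lee_fin.
  - move=> _; exists 2; split; first by rewrite ltr1n.
    by apply: filterS yr => x /(_ I); rewrite leye_eq.
have [c [ac cn rc]] : exists c, [/\ a <= c, c < n%:R / alpha & {ae mu, forall x, r x <= c}].
  move: esup => /ereal_inf_lt[y yr yn].
  have aeP : {ae mu, forall x, a <= r x /\ ((r x)%:E <= y)%E}.
    by apply: filterS2 ar yr => x xa /(_ I).
  pose o : X := fun _ => Qp0 p.
  have mo : mu (qball o 0) != 0%E by rewrite (us_mu us) expr0z eqe oner_neq0.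
  have [x [_ [xa xy]]] := ae_witness (us_meas us o 0) mo aeP.
  case: y yr yn xy {aeP} => [y| |] yr yn; rewrite ?leeNy_eq// lee_fin => xy.
  exists y; split; [exact: le_trans xy|by rewrite -lte_fin|].
  by apply: filterS yr => z /(_ I); rewrite lee_fin.
pose r' x := Num.max a (Num.min (r x) c).
have ra' x : a <= r' x by rewrite le_max lexx.
have rc' x : r' x <= c by rewrite ge_max ac/= ge_min lexx orbT.
have a0 : 0 < a by exact: lt_trans ltr01 a1.
have c0 : 0 < c by exact: lt_le_trans ac.
have rp' x : 0 < r' x by exact: lt_le_trans (ra' x).
have rr' : {ae mu, forall x, r x = r' x}.
  by apply: filterS2 ar rc => x xa xc; rewrite /r' (min_idPl xc) (max_idPr xa).
have cb : c * beta < 1.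
  by rewrite /beta mulrA ltr_pdivrMr ?ltr0n// mul1r -ltr_pdivlMr.
have icb : 0 < c^-1 - beta by rewrite subr_gt0 -[ltRHS]mul1r ltr_pdivlMr// mulrC.
pose q' x := ((r' x)^-1 - beta)^-1.
pose cq := (c^-1 - beta)^-1.
have ir' x : c^-1 - beta <= (r' x)^-1 - beta by rewrite lerD2r lef_pV2 ?posrE.
have q'cq x : q' x <= cq.
  by rewrite lef_pV2 ?posrE//; exact: lt_le_trans (ir' x).
have q'0 x : 0 < q' x by rewrite invr_gt0; exact: lt_le_trans (ir' x).
have cq0 : 0 <= cq by rewrite invr_ge0 ltW.
have mr' : measurable_fun setT r'.
  by apply: measurable_maxr => //; exact: measurable_minr.
have [C1 C10 C1P] := Clog0_ae r0.
have [C C0 CP] := Cloginf_lev p1 lev_min rinf.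
(* [sqrt a] is the largest [rho] with [rho * rho <= a]. The factor [cq * cq] comes from
   [q' x - q' y], which is [r' x - r' y] times [q' x * q' y / (r' x * r' y)]. *)
exists r', q', a, c, cq, C1, (C * (1 + cq * cq)), (Num.sqrt a); split => //; last 2 first.
- apply: filterS rr' => x rx; split => //.
  by rewrite /q' -rx -qr invrK.
- have -> : q = (fun x => ((r x)^-1 - beta)^-1).
    by apply/funext => x; rewrite -qr invrK.
  apply: measurable_funV; apply: measurable_funB => //; exact: measurable_funV.
have Cr x y : `|r' x - r' y| * (minn (lev x) (lev y))%:R <= C.
  apply: le_trans (CP x y); apply: ler_wpM2r => //; exact: clamp_lipschitz.
split => //.
- by rewrite -(sqrtr1 R) ltr_sqrt.
- by rewrite -expr2 sqr_sqrtr// ltW.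
- by move=> x; rewrite ra' rc'.
- by move=> x; rewrite invrK.
- by rewrite mulr_ge0// addr_ge0// mulr_ge0.
- have rr2 := rr'; apply: filterS2 C1P rr' => x hx rx g g0.
  by apply: filterS2 (hx g g0) rr2 => y + ry; rewrite -rx -ry.
- move=> x y; apply: (le_trans (Cr x y)); rewrite ler_peMr// lerDl mulr_ge0//.
- move=> x y; have -> : q' x - q' y = (q' x * q' y * (r' x)^-1 * (r' y)^-1) * (r' x - r' y).
    have -> : q' x - q' y = q' x * q' y * ((q' y)^-1 - (q' x)^-1).
      by field; rewrite !gt_eqF.
    rewrite !invrK; field; by rewrite !gt_eqF.
  have i1 z : (r' z)^-1 <= 1 by rewrite invf_le1// (le_trans (ltW a1)).
  have i0 z : 0 <= (r' z)^-1 by rewrite invr_ge0 ltW.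
  have q00 z : 0 <= q' z by exact: ltW.
  set co := q' x * q' y * (r' x)^-1 * (r' y)^-1.
  have co0 : 0 <= co by rewrite !mulr_ge0.
  have co1 : co <= cq * cq.
    rewrite -[leRHS]mulr1; apply: ler_pM => //; first by rewrite !mulr_ge0.
    rewrite -[leRHS]mulr1; apply: ler_pM => //; first by rewrite !mulr_ge0.
    by apply: ler_pM.
  rewrite normrM (ger0_norm co0) -[leLHS]mulrA.
  apply: (@le_trans _ _ (cq * cq * C)).
    by apply: ler_pM => //; rewrite mulr_ge0.
  by rewrite [leLHS]mulrC ler_wpM2l// lerDr.
Qed.

End Admissible.

(** * The fractional maximal function and its commutator *)

Section Commutator.
Context {R : realType} {p n : nat}.
Local Notation X := (QpnT R p n).
Variables (alpha : R) (mu : {measure set X -> \bar R}).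
Hypothesis p1 : (1 < p)%N.
Hypothesis mu_ball : forall (x : X) (g : int),
  mu (qball x g) = ((p%:R : R) ^ (n%:Z * g))%:E.
Hypothesis n0 : (0 < n)%N.
Hypothesis alpha0 : 0 < alpha.
Hypothesis alphan : alpha < n%:R.
Local Notation Q := ((p%:R : R) ^+ n).
Local Notation Ea := (Ea mu (@qball R p n) Q).
Let us := padic_ultra_space p1 mu_ball n0.
Let beta := alpha / n%:R.
Let beta0 : 0 < beta. Proof. by rewrite divr_gt0// ltr0n. Qed.
Local Open Scope ereal_scope.

Lemma hmeas_ball (x : X) g : hmeas mu (qball x g) = (Q ^ g)%R.
Proof. by rewrite /hmeas (us_mu us). Qed.

Lemma locint_measurable (b : X -> R) : qp_locint mu b -> measurable_fun setT b.
Proof.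
move=> ib; pose o : X := fun _ => Qp0 p.
have -> : [set: X] = \bigcup_(k : nat) qball o k%:Z.
  apply/seteqP; split => // x _; have [g og] := us_join us o x.
  by exists `|g|%N => //; apply: (us_le us _ og); rewrite abszE ler_norm.
apply/measurable_fun_bigcup; first by move=> k; exact: (us_meas us).
by move=> k; apply/measurable_EFinP; case/integrableP: (ib o k%:Z).
Qed.

Definition fmean (f : X -> R) (g : int) (x : X) : \bar R :=
  ((Q ^ g) `^ beta)%:E * Ea (fun y => `|f y|%:E) g x.

Lemma frac_coefE g (I : \bar R) :
  ((Q ^ g) `^ (alpha / n%:R - 1))%:E * I = ((Q ^ g) `^ beta)%:E * (((Q ^ g)^-1)%:E * I).
Proof.
rewrite muleA -EFinM powRD; last by rewrite (gt_eqF (Qg0 us g)) implybT.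
by rewrite powR_inv1// ltW// (Qg0 us).
Qed.

Lemma frac_maxE f x : frac_max mu alpha f x = ereal_sup [set fmean f g x | g in [set: int]].
Proof.
congr ereal_sup; apply/seteqP; split => _ [g _ <-]; exists g => //;
  by rewrite hmeas_ball /fmean /Ea frac_coefE.
Qed.

Lemma frac_max_inE B f x : frac_max_in mu alpha B f x =
  ereal_sup [set fmean f g x | g in [set g : int | qball x g `<=` B]].
Proof.
congr ereal_sup; apply/seteqP; split => _ [g gB <-]; exists g => //;
  by rewrite hmeas_ball /fmean /Ea frac_coefE.
Qed.

Lemma fmean_ge0 f g x : 0 <= fmean f g x.
Proof. by rewrite mule_ge0 ?lee_fin ?powR_ge0//; exact: (Ea_ge0 us). Qed.

Lemma frac_max_measurable (f : X -> R) : measurable_fun setT (frac_max mu alpha f).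
Proof.
rewrite (_ : frac_max mu alpha f = fun x => ereal_sup [set fmean f g x | g in [set: int]]).
  apply: measurable_ereal_sup_int => g _; apply: measurable_funeM.
  exact: Ea_measurable.
by apply/funext => x; exact: frac_maxE.
Qed.

Lemma commutator_measurable (b f : X -> R) : measurable_fun setT b ->
  measurable_fun setT (commutator mu alpha b f).
Proof.
move=> mb; apply: emeasurable_funB; last exact: frac_max_measurable.
by apply: emeasurable_funM; [exact/measurable_EFinP|exact: frac_max_measurable].
Qed.

Lemma modular_EFin (r f : X -> R) e : (0 < e)%R ->
  modular mu r (EFin \o f) e = \int[mu]_x ((`|f x| / e) `^ r x)%:E.
Proof. by []. Qed.

Lemma modular_integrand_measurable (r : X -> R) (F : X -> \bar R) e : measurable_fun setT r ->
  measurable_fun setT F ->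
  measurable_fun setT (fun x => (`|F x| * (e^-1)%:E) `^ r x).
Proof.
move=> mr mF; apply: measurable_poweR2 => //; apply: emeasurable_funM => //.
exact: measurableT_comp.
Qed.

Lemma BMO_bosc (b : X -> R) : in_BMO mu b ->
  exists2 K : R, (0 < K)%R & forall x g, bosc mu (@qball R p n) Q b g g x <= K%:E.
Proof.
move=> [ib bb].
have le x g : bosc mu (@qball R p n) Q b g g x <= bmo_seminorm mu b.
  apply: ereal_sup_ubound; exists x => //; exists g => //.
  by rewrite /bosc /Ea /avg hmeas_ball.
have b0 : 0 <= bmo_seminorm mu b.
  by apply: le_trans (le (fun _ => Qp0 p) 0%R); exact: (Ea_ge0 us).
exists (fine (bmo_seminorm mu b) + 1)%R.
  by rewrite ltr_wpDl// fine_ge0.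
move=> x g; apply: (le_trans (le x g)); rewrite EFinD fineK; last by rewrite ge0_fin_numE.
by rewrite leeDl.
Qed.

Lemma Linfty_bound (f : X -> R) : in_Linfty mu f ->
  exists2 B : R, (0 <= B)%R & {ae mu, forall x, (`|f x| <= B)%R}.
Proof.
move=> [mf]; set s := ess_sup _ _ => sy.
exists `|fine s|%R => //.
have : \forall x \ae mu, (`|f x|)%:E <= s by apply: ess_sup_ge.
apply: filterS => x; case: s sy => [s| |]//= _.
by rewrite lee_fin => /le_trans; apply; exact: ler_norm.
Qed.

(* The pointwise step of the commutator bound: [u] and [v] are the means of
   [f] and of [b f], [T] is the common bound of [u] and of the means of
   [|b x - b| f]. *)
Lemma commutator_sup_le (t B T : R) (u v : int -> \bar R) :
  (`|Num.min t 0| <= B)%R -> (0 <= T)%R ->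
  (forall g, 0 <= u g) -> (forall g, 0 <= v g) -> (forall g, u g <= T%:E) ->
  (forall g, v g <= `|t|%:E * u g + T%:E) -> (forall g, `|t|%:E * u g <= v g + T%:E) ->
  `|t%:E * ereal_sup [set u g | g in [set: int]] - ereal_sup [set v g | g in [set: int]]|
    <= ((1 + 2 * B) * T)%:E.
Proof.
move=> tB T0 u0 v0 uT vu uv.
set U := ereal_sup [set u g | g in _]; set V := ereal_sup [set v g | g in _].
have uU g : u g <= U by apply: ereal_sup_ubound; exists g.
have vV g : v g <= V by apply: ereal_sup_ubound; exists g.
have U0 : 0 <= U by apply: le_trans (uU 0%R).
have V0 : 0 <= V by apply: le_trans (vV 0%R).
have UT : U <= T%:E by apply: ge_ereal_sup => _ [g _ <-].
have VU : V <= `|t|%:E * U + T%:E.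
  apply: ge_ereal_sup => _ [g _ <-]; apply: (le_trans (vu g)).
  by rewrite leeD2r// lee_wpmul2l.
have UV : `|t|%:E * U <= V + T%:E.
  have [->|t0] := eqVneq t 0%R; first by rewrite normr0 mul0e adde_ge0// lee_fin.
  have at0 : (0 < `|t|)%R by rewrite normr_gt0.
  rewrite -lee_pdivlMl//; apply: ge_ereal_sup => _ [g _ <-].
  by rewrite lee_pdivlMl// (le_trans (uv g))// leeD2r.
case: U U0 UT VU UV {uU} => [U| |]//; rewrite !lee_fin => U0 UT.
case: V V0 {vV} => [V| |]//.
rewrite -!EFinM -!EFinD /= !lee_fin => V0 VU UV.
(* [t * U - V] is [|t| * U - V] minus [(|t| - t) * U]; the last coefficient is twice the negative
   part of [t], and only here does its bound [B] matter. *)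
have tt : (`|t| - t <= 2 * B)%R.
  move: tB; have [t0|t0] := leP 0%R t.
    rewrite normr0 => Bge0.
    by rewrite ger0_norm// subrr mulr_ge0.
  by rewrite !ltr0_norm// => h; lra.
have t2 : (0 <= `|t| - t)%R by rewrite subr_ge0 ler_norm.
have tU : ((`|t| - t) * U <= 2 * B * T)%R by exact: ler_pM tt UT.
have tU0 : (0 <= (`|t| - t) * U)%R by exact: mulr_ge0.
have BT : ((1 + 2 * B) * T = T + 2 * B * T)%R by ring.
rewrite BT ler_norml; apply/andP; move: tU tU0; rewrite mulrBl => tU tU0.
by split; lra.
Qed.

End Commutator.

(** * Boundedness of the commutator for [b] in BMO with bounded negative part *)

Section Sufficiency.
Context {R : realType} {p n : nat}.
Local Notation X := (QpnT R p n).
Variables (alpha : R) (mu : {measure set X -> \bar R}).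
Hypothesis p1 : (1 < p)%N.
Hypothesis mu_ball : forall (x : X) (g : int),
  mu (qball x g) = ((p%:R : R) ^ (n%:Z * g))%:E.
Hypothesis n0 : (0 < n)%N.
Hypothesis alpha0 : 0 < alpha.
Hypothesis alphan : alpha < n%:R.
Local Notation Q := ((p%:R : R) ^+ n).
Local Notation Ea := (Ea mu (@qball R p n) Q).
Let us := padic_ultra_space p1 mu_ball n0.
Let beta := alpha / n%:R.
Let beta0 : 0 < beta. Proof. by rewrite divr_gt0// ltr0n. Qed.
Local Open Scope ereal_scope.
Local Notation fmean := (fmean alpha mu).

Lemma poweR_le_root (T Y : \bar R) (q : R) : (0 < q)%R -> 0 <= T -> 0 <= Y ->
  T `^ q <= Y -> T <= Y `^ q^-1.
Proof.
move=> q0 T0 Y0 TY.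
have -> : T = (T `^ q) `^ q^-1 by rewrite -poweRrM mulfV ?gt_eqF// poweRe1.
apply: gt0_ler_poweR => //; rewrite ?in_itv/= ?leey ?andbT// ?poweR_ge0//.
by rewrite invr_ge0 ltW.
Qed.

Lemma finite_ae (Psi : X -> \bar R) : (forall x, 0 <= Psi x) -> measurable_fun setT Psi ->
  \int[mu]_x Psi x < +oo -> {ae mu, forall x, Psi x \is a fin_num}.
Proof.
move=> P0 mP PI; have iP : mu.-integrable setT Psi.
  apply/integrableP; split => //; apply: le_lt_trans PI.
  by apply: le_int => x _; rewrite ?gee0_abs.
by have := integrable_ae measurableT iP; apply: filterS => x /(_ I).
Qed.

(** The integrands [|f y|] and [|b x - b y| * |f y|] are both below [(1 + |b x - b y|) * |f y|], so
    one bound [Th] supplies every hypothesis of [commutator_sup_le]. *)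
Lemma commutator_pointwise (b f : X -> R) (e B : R) (Th : \bar R) x :
  measurable_fun setT b -> measurable_fun setT f -> (0 < e)%R ->
  (`|negpart b x| <= B)%R -> 0 <= Th -> Th \is a fin_num ->
  (forall g, ((Q ^ g) `^ beta)%:E *
      Ea (fun y => ((1 + `|b x - b y|) * (`|f y| / e))%:E) g x <= Th) ->
  `|commutator mu alpha b f x| <= ((1 + 2 * B) * e)%:E * Th.
Proof.
move=> mb mf e0 bB Th0 Thfin TTh.
have mfa : measurable_fun setT (fun y => `|f y|%:E : \bar R).
  by apply/measurable_EFinP; exact: measurableT_comp.
pose w y := (`|b x - b y| * `|f y|)%R.
have mw : measurable_fun setT (fun y => (w y)%:E : \bar R).
  apply/measurable_EFinP; apply: measurable_funM; last exact: measurableT_comp.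
  by apply: measurableT_comp => //; exact: measurable_funB.
have mbf : measurable_fun setT (fun y => `|b y * f y|%:E : \bar R).
  by apply/measurable_EFinP; apply: measurableT_comp => //; exact: measurable_funM.
have w0 y : 0 <= (w y)%:E by rewrite lee_fin mulr_ge0.
have f0 y : 0 <= `|f y|%:E by rewrite lee_fin.
pose c g := ((Q ^ g) `^ beta)%:E.
have c0 g : 0 <= c g by rewrite lee_fin powR_ge0.
have eT g (h : X -> R) : (forall y, (0 <= h y)%R) -> measurable_fun setT h ->
    (forall y, (h y <= e * ((1 + `|b x - b y|) * (`|f y| / e)))%R) ->
    c g * Ea (fun y => (h y)%:E) g x <= e%:E * Th.
  move=> h0 mh hle; apply: (@le_trans _ _ (c g * (e%:E *
      Ea (fun y => ((1 + `|b x - b y|) * (`|f y| / e))%:E) g x))).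
    rewrite lee_wpmul2l// -(EaZ us) ?(ltW e0)//.
    - by apply: (Ea_le us) => y _; rewrite -?EFinM lee_fin.
    - by move=> y; rewrite lee_fin mulr_ge0 ?addr_ge0 ?divr_ge0// ltW.
    - apply/measurable_EFinP; apply: measurable_funM.
        apply: measurable_funD => //; apply: measurableT_comp => //.
        exact: measurable_funB.
      by apply: measurable_funM => //; exact: measurableT_comp.
  by rewrite muleCA lee_wpmul2l ?lee_fin ?(ltW e0)//; exact: TTh.
have scal y : (e * ((1 + `|b x - b y|) * (`|f y| / e)) = (1 + `|b x - b y|) * `|f y|)%R.
  by field; rewrite gt_eqF.
have wT g : c g * Ea (fun y => (w y)%:E) g x <= e%:E * Th.
  apply: eT => [y||y]; [exact: mulr_ge0|exact/measurable_EFinP|].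
  by rewrite scal ler_wpM2r// lerDr.
case: Th Th0 Thfin TTh eT wT => [th| |]// th0 _ TTh eT wT.
rewrite lee_fin in th0.
rewrite /commutator !(frac_maxE alpha p1 mu_ball n0).
have -> : ((1 + 2 * B) * e)%:E * th%:E = ((1 + 2 * B) * (e * th))%:E.
  by rewrite -EFinM mulrA.
have EaM g : `|b x|%:E * fmean f g x = c g * Ea (fun y => `|b x|%:E * `|f y|%:E) g x.
  by rewrite (EaZ us)// muleCA.
apply: commutator_sup_le.
- by move: bB; rewrite /negpart normrN.
- by rewrite mulr_ge0// ltW.
- by move=> g; exact: (fmean_ge0 alpha p1 mu_ball n0).
- by move=> g; exact: (fmean_ge0 alpha p1 mu_ball n0).
- move=> g; rewrite EFinM; apply: eT => [y||y]; [by []|exact: measurableT_comp|].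
  by rewrite scal ler_peMl// lerDl.
- move=> g; rewrite EaM EFinM; apply: le_trans (leeD2l _ (wT g)).
  rewrite -ge0_muleDr; last 2 first.
  + by apply: (Ea_ge0 us) => y; rewrite mule_ge0// lee_fin.
  + exact: (Ea_ge0 us).
  apply: (@lee_wpmul2l _ (c g)) => //.
  apply: (@le_trans _ _ (Ea (fun y => `|b x|%:E * `|f y|%:E + (w y)%:E) g x)); last first.
    by rewrite (EaD us)//; exact: measurable_funeM.
  apply: (Ea_le us) => y _; first by rewrite lee_fin.
  rewrite -EFinM -EFinD lee_fin normrM /w -mulrDl ler_wpM2r//.
  by rewrite -lerBlDl distrC lerB_dist.
- move=> g; rewrite EaM EFinM; apply: le_trans (leeD2l _ (wT g)).
  rewrite -ge0_muleDr; last 2 first.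
  + by apply: (Ea_ge0 us) => y; rewrite lee_fin.
  + exact: (Ea_ge0 us).
  apply: (@lee_wpmul2l _ (c g)) => //.
  apply: (@le_trans _ _ (Ea (fun y => `|b y * f y|%:E + (w y)%:E) g x)); last first.
    by rewrite (EaD us)// => y; rewrite lee_fin.
  apply: (Ea_le us) => y _; first by rewrite mule_ge0// lee_fin.
  rewrite -EFinM -EFinD lee_fin normrM /w -mulrDl ler_wpM2r//.
  by rewrite -lerBlDl lerB_dist.
Qed.

Lemma commutator_modular (b r q : X -> R) :
  in_BMO mu b -> in_Linfty mu (negpart b) -> admissible mu alpha r q ->
  exists2 C : R, (0 < C)%R & forall f : X -> R, measurable_fun setT f ->
    forall e : R, (0 < e)%R -> modular mu r (EFin \o f) e <= 1 ->
      modular mu q (commutator mu alpha b f) (C * e) <= 1.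
Proof.
move=> bmo bneg adm.
have ib : qp_locint mu b by case: bmo.
have mb := locint_measurable p1 mu_ball n0 ib.
have [K K0 bK] := BMO_bosc p1 mu_ball n0 bmo.
have [B B0 bB] := Linfty_bound bneg.
have [lev [lev_ball lev_min]] := level_exists us (fun _ => Qp0 p).
have [r' [q' [a [c [cq [C1 [C2 [rho [ge rq' mr mq]]]]]]]]] :=
  admissible_good p1 mu_ball n0 alpha0 lev_min adm.
have [C0 C00 key] := key_estimate us lev_ball lev_min ge mb ib K0 bK.
have C10 : (0 < 1 + C0)%R by rewrite ltr_wpDr.
have B20 : (0 < 1 + 2 * B)%R by rewrite ltr_wpDr// mulr_ge0.
(* The key estimate bounds the modular by [C0] only. Dividing the function by [1 + C0] divides the
   modular by at least as much, because the exponent is at least 1. *)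
exists ((1 + 2 * B) * (1 + C0))%R; first exact: mulr_gt0.
move=> f mf e e0 fe.
pose ft x := (`|f x| / e)%R.
have ft0 x : (0 <= ft x)%R by rewrite divr_ge0// ltW.
have mft : measurable_fun setT ft.
  by apply: measurable_funM => //; exact: measurableT_comp.
have fI : \int[mu]_x (ft x `^ r' x)%:E <= 1.
  rewrite -(modular_EFin _ r' f e0) -(modular_ae e mr (ge_mr ge))//; first exact/measurable_EFinP.
  by apply: filterS rq' => x [].
have [Psi [Psi0 mPsi PsiI PsiP]] := key ft ft0 mft fI.
have Pfin : {ae mu, forall x, Psi x \is a fin_num}.
  by apply: finite_ae => //; apply: le_lt_trans PsiI _; rewrite ltry.
apply: (@le_trans _ _ (\int[mu]_x ((1 + C0)^-1%:E * Psi x))); last first.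
  rewrite ge0_integralZl ?lee_fin ?invr_ge0 ?(ltW C10)//.
  rewrite lee_pdivrMl// mule1 (le_trans PsiI)// lee_fin lerDr//.
apply: le_int_ae => //.
- by move=> x _; exact: poweR_ge0.
- by move=> x _; rewrite mule_ge0// lee_fin invr_ge0 ltW.
- exact: measurable_funeM.
have H : {ae mu, forall x, (Psi x \is a fin_num) /\ (`|negpart b x| <= B)%R}.
  by apply: filterS2 Pfin bB.
apply: filterS3 PsiP H rq' => x Px [Pf bx] [_ qx] _; rewrite qx.
have q0 := exponent_q0 ge x.
have q1 : (1 <= q' x)%R.
  apply: le_trans (exponent_rq ge x); have /andP[+ _] := ge_r ge x.
  apply: le_trans; apply: le_trans (ge_a ge).
  by rewrite -[leLHS]mulr1 ler_pM// ltW// (ge_rho ge).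
pose Th := Psi x `^ (q' x)^-1.
have Th0 : 0 <= Th by exact: poweR_ge0.
have Thf : Th \is a fin_num by exact: fin_num_poweR.
have TT g := poweR_le_root q0 _ (Psi0 x) (Px g).
have cle : `|commutator mu alpha b f x| <= ((1 + 2 * B) * e)%:E * Th.
  apply: commutator_pointwise => // g; apply: TT => {}g.
  rewrite mule_ge0 ?lee_fin ?powR_ge0//; apply: (Ea_ge0 us) => y.
  by rewrite lee_fin mulr_ge0// addr_ge0.
have BC : (0 < (1 + 2 * B) * (1 + C0) * e)%R by rewrite !mulr_gt0.
apply: (@le_trans _ _ (((1 + C0)^-1%:E * Th) `^ q' x)).
  apply: gt0_ler_poweR; rewrite ?in_itv/= ?leey ?andbT//.
  - exact: ltW.
  - by rewrite mule_ge0// lee_fin invr_ge0 ltW.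
  - by rewrite mule_ge0// lee_fin invr_ge0 ltW.
  rewrite muleC lee_pdivrMl// muleA -EFinM.
  have -> : ((1 + 2 * B) * (1 + C0) * e * (1 + C0)^-1 = (1 + 2 * B) * e)%R.
    by field; rewrite gt_eqF.
  exact: cle.
rewrite poweRM ?lee_fin ?invr_ge0 ?(ltW C10)// -poweRrM mulVf ?gt_eqF// poweRe1//.
rewrite lee_wpmul2r// poweR_EFin lee_fin ge1r_powR// invr_gt0 C10 invf_le1//.
by rewrite lerDl.
Qed.

Lemma Lvar_norm_le (r q : X -> R) (F G : X -> \bar R) (C : R) : (0 < C)%R ->
  (forall e : R, (0 < e)%R -> modular mu r F e <= 1 -> modular mu q G (C * e) <= 1) ->
  Lvar_norm mu q G <= C%:E * Lvar_norm mu r F.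
Proof.
move=> C0 H; rewrite muleC -lee_pdivrMr//.
apply: le_ereal_inf_tmp => _ [e [e0 Fe] <-].
rewrite lee_pdivrMr// -EFinM; apply: ereal_inf_lbound; exists (e * C)%R => //.
by split; [rewrite mulr_gt0|rewrite mulrC; exact: H].
Qed.

(** For [t >= 1] and exponents at least 1, [t ^ (- r x) <= t^-1], so enlarging the scale by one plus
    the modular suffices. *)
Lemma modular_le1 (r f : X -> R) : measurable_fun setT r -> {ae mu, forall x, (1 <= r x)%R} ->
  in_Lvar mu r (EFin \o f) -> exists2 e : R, (0 < e)%R & modular mu r (EFin \o f) e <= 1.
Proof.
move=> mr r1 [mf [e [e0 fe]]]; set I := modular _ _ _ _ in fe.
have I0 : 0 <= I by apply: integral_ge0 => x _; exact: poweR_ge0.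
have Ifin : I \is a fin_num by rewrite ge0_fin_numE.
pose t := (1 + fine I)%R; have It0 : (0 <= fine I)%R by exact: fine_ge0.
have t1 : (1 <= t)%R by rewrite lerDl.
have t0 : (0 < t)%R by exact: lt_le_trans t1.
have mI := modular_integrand_measurable e mr mf.
exists (t * e)%R; first exact: mulr_gt0.
apply: (@le_trans _ _ (t^-1%:E * I)); last first.
  by rewrite lee_pdivrMl// mule1 -(fineK Ifin) lee_fin lerDr.
rewrite -ge0_integralZl ?lee_fin ?invr_ge0 ?(ltW t0)//; last first.
  by move=> x _; exact: poweR_ge0.
apply: le_int_ae => //.
- by move=> x _; exact: poweR_ge0.
- by move=> x _; rewrite mule_ge0 ?poweR_ge0// lee_fin invr_ge0 ltW.
- exact: measurable_funeM.
apply: filterS r1 => x rx _ /=.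
rewrite -?EFinM lee_fin invfM mulrCA powRM ?invr_ge0 ?divr_ge0 ?(ltW t0) ?(ltW e0)//.
by rewrite ler_wpM2r ?powR_ge0// ge1r_powR// invr_gt0 t0 invf_le1.
Qed.

Lemma comm_bounded_of_BMO (b r q : X -> R) :
  in_BMO mu b -> in_Linfty mu (negpart b) -> admissible mu alpha r q ->
  comm_bounded mu alpha b r q.
Proof.
move=> bmo bneg adm.
have [C C0 CP] := commutator_modular bmo bneg adm.
have ib : qp_locint mu b by case: bmo.
have mb := locint_measurable p1 mu_ball n0 ib.
exists C; split => [|f fL]; first exact: ltW.
have mf : measurable_fun setT f by apply/measurable_EFinP; case: fL.
case: adm => _ _ [mr r1 _ _] _ _.
split.
  split; first exact: commutator_measurable.
  have [e e0 fe] := modular_le1 mr (aeW mu (fun x => ltW (r1 x))) fL.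
  exists (C * e)%R; split; first exact: mulr_gt0.
  by apply: le_lt_trans (CP f mf e e0 fe) _; rewrite ltry.
by apply: Lvar_norm_le => // e e0 fe; exact: CP.
Qed.

End Sufficiency.

(** * The star condition from boundedness of the commutator *)

Section StarCondition.
Context {R : realType} {p n : nat}.
Local Notation X := (QpnT R p n).
Variables (alpha : R) (mu : {measure set X -> \bar R}).
Hypothesis p1 : (1 < p)%N.
Hypothesis mu_ball : forall (x : X) (g : int),
  mu (qball x g) = ((p%:R : R) ^ (n%:Z * g))%:E.
Hypothesis n0 : (0 < n)%N.
Hypothesis alpha0 : 0 < alpha.
Hypothesis alphan : alpha < n%:R.
Local Notation Q := ((p%:R : R) ^+ n).
Local Notation Ea := (Ea mu (@qball R p n) Q).
Let us := padic_ultra_space p1 mu_ball n0.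
Let beta := alpha / n%:R.
Let beta0 : 0 < beta. Proof. by rewrite divr_gt0// ltr0n. Qed.
Local Open Scope ereal_scope.
Local Notation fmean := (fmean alpha mu).

Let beta1 : (beta < 1)%R.
Proof. by rewrite /beta ltr_pdivrMr ?ltr0n// mul1r. Qed.

Let Qg0 g : (0 < Q ^ g)%R := Qg0 us g.

Lemma qball_le (x y : X) (g g0 : int) : qball x g0 y -> (g <= g0)%R ->
  qball y g `<=` qball x g0.
Proof. by move=> xy gg0; rewrite -(us_eq us xy); exact: (us_le us). Qed.

Lemma qball_sub_le (x y : X) (g g0 : int) : qball y g `<=` qball x g0 -> (g <= g0)%R.
Proof.
move=> sub; rewrite leNgt; apply/negP => lt.
have : mu (qball y g) <= mu (qball x g0).
  by apply: le_measure; rewrite ?inE//; exact: (us_meas us).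
rewrite !(us_mu us) lee_fin leNgt => /negP; apply.
by rewrite ltr_eXz2l// (us_Q1 us).
Qed.

Lemma fmean_indic (f : X -> R) (x0 y : X) (g g0 : int) : qball y g `<=` qball x0 g0 ->
  fmean (fun t => f t * \1_(qball x0 g0) t)%R g y = fmean f g y.
Proof.
move=> sub; congr (_ * (_ * _)); apply: eq_integral => t /set_mem yt.
by rewrite indicE mem_set ?mulr1//; exact: sub.
Qed.

Lemma fmean_indic_le (f : X -> R) (x0 y : X) (g g0 : int) : measurable_fun setT f ->
  qball x0 g0 y -> (g0 <= g)%R ->
  fmean (fun t => f t * \1_(qball x0 g0) t)%R g y <= fmean f g0 y.
Proof.
move=> mf xy gg; rewrite /fmean /Ea -!(frac_coefE alpha p1 mu_ball n0).
have mfa : measurable_fun setT (fun y => `|f y|%:E : \bar R).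
  by apply/measurable_EFinP; exact: measurableT_comp.
apply: lee_pmul; first by rewrite lee_fin powR_ge0.
- by apply: integral_ge0 => t _; rewrite lee_fin.
- rewrite lee_fin -/beta -[(beta - 1)%R]opprK opprB !powRN lef_pV2 ?posrE ?powR_gt0//.
  apply: ler_powR2; [by rewrite subr_ge0 ltW|exact: ltW|].
  by apply: ler_weXz2l gg; exact: ltW (us_Q1 us).
rewrite (us_eq us xy).
under eq_integral => t _.
  have -> : `|(f t * \1_(qball x0 g0) t)%R|%:E = ((fun y => `|f y|%:E) \_ (qball x0 g0)) t.
    rewrite patchE indicE; case: ifPn => _; first by rewrite mulr1.
    by rewrite mulr0 normr0.
  over.
rewrite -integral_mkcondr; apply: ge0_subset_integral => //.
- by apply: measurableI; exact: (us_meas us).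
- exact: (us_meas us).
- exact: measurable_funTS.
Qed.

(** A ball around a point of [B] lies inside [B] or contains it. A larger ball sees the same
    integral with the smaller coefficient [|B_g| ^ (beta - 1)], as [beta < 1], so it never beats [B]
    itself. *)
Lemma frac_max_indic (f : X -> R) (x0 y : X) (g0 : int) : measurable_fun setT f ->
  qball x0 g0 y ->
  frac_max mu alpha (fun t => f t * \1_(qball x0 g0) t)%R y =
  frac_max_in mu alpha (qball x0 g0) f y.
Proof.
move=> mf xy; rewrite (frac_maxE alpha p1 mu_ball n0) (frac_max_inE alpha p1 mu_ball n0).
apply/eqP; rewrite eq_le; apply/andP; split; apply: ge_ereal_sup => _ [g gS <-].
  have [gg|/ltW gg] := leP g g0.
    apply: ereal_sup_ubound; exists g; first exact: qball_le.
    by rewrite fmean_indic//; exact: qball_le.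
  apply: (le_trans (fmean_indic_le mf xy gg)); apply: ereal_sup_ubound.
  by exists g0 => //; exact: qball_le.
by rewrite -(fmean_indic f gS); apply: ereal_sup_ubound; exists g.
Qed.

Lemma frac_max_in1 (x0 y : X) (g0 : int) : qball x0 g0 y ->
  frac_max_in mu alpha (qball x0 g0) (fun=> 1%R) y = ((Q ^ g0) `^ beta)%:E.
Proof.
move=> xy; rewrite (frac_max_inE alpha p1 mu_ball n0).
have fE g : fmean (fun=> 1%R) g y = ((Q ^ g) `^ beta)%:E.
  rewrite /fmean normr1 (_ : (fun=> 1%:E) = cst 1%:E)// (Ea_cst us).
  by rewrite mule1.
apply/eqP; rewrite eq_le; apply/andP; split; last first.
  by rewrite -fE; apply: ereal_sup_ubound; exists g0 => //; exact: qball_le.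
apply: ge_ereal_sup => _ [g /= /qball_sub_le gg <-]; rewrite fE lee_fin.
apply: ler_powR2; [exact: ltW|exact: ltW|].
by apply: ler_weXz2l gg; exact: ltW (us_Q1 us).
Qed.

Lemma star_commutator (b : X -> R) (x0 y : X) (g0 : int) : measurable_fun setT b ->
  qball x0 g0 y ->
  (b y)%:E - ((hmeas mu (qball x0 g0)) `^ (- alpha / n%:R))%:E *
    frac_max_in mu alpha (qball x0 g0) b y =
  ((Q ^ g0) `^ (- beta))%:E * commutator mu alpha b (\1_(qball x0 g0)) y.
Proof.
move=> mb xy; rewrite /commutator.
have -> : frac_max mu alpha (\1_(qball x0 g0)) y = ((Q ^ g0) `^ beta)%:E.
  rewrite -(frac_max_in1 xy) -frac_max_indic//; congr frac_max.
  by apply/funext => t; rewrite mul1r.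
rewrite frac_max_indic// muleBr//.
rewrite (hmeas_ball p1 mu_ball n0) mulNr -/beta -!EFinM; congr (_%:E - _).
by rewrite mulrCA powRN mulVf ?mulr1// gt_eqF// powR_gt0.
Qed.

(** Hoelder's inequality [|f|_r <= 2 |B| ^ beta |f|_q] on a ball, in modular form: Young's
    inequality with exponents [q y / r y] and [1 / (beta * r y)], conjugate at each [y], turns the
    second factor into [1 / |B|]. The 2 makes room for two modulars at most 1. *)
Lemma holder_ball (lev : X -> nat) (r q : X -> R) a c cq C1 C2 rho (f : X -> R) x0 g0 :
  good_exponent mu (@qball R p n) lev r q a c cq beta C1 C2 rho ->
  (forall y, (0 <= f y)%R) -> measurable_fun setT f ->
  (forall y, ~ qball x0 g0 y -> f y = 0%R) ->
  \int[mu]_y (f y `^ q y)%:E <= 1 ->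
  \int[mu]_y ((f y / (2 * (Q ^ g0) `^ beta)) `^ r y)%:E <= 1.
Proof.
move=> ge f0 mf fB If.
have rge1 y : (1 <= r y)%R.
  have /andP[ar _] := ge_r ge y; apply: le_trans ar; apply: le_trans (ge_a ge).
  by rewrite -[leLHS]mulr1 ler_pM// ltW// (ge_rho ge).
have r0 y : (0 < r y)%R by exact: lt_le_trans (rge1 y).
have q0 y : (0 < q y)%R by exact: (exponent_q0 ge).
pose B := qball x0 g0; have mB : measurable B by exact: (us_meas us).
have mq := exponent_mq ge.
pose M := ((Q ^ g0) `^ beta)%R; have M0 : (0 < M)%R by exact: powR_gt0.
have mfq : measurable_fun setT (fun y => (f y `^ q y)%:E).
  by apply/measurable_EFinP; exact: measurable_powR2.
have m1 : measurable_fun setT (fun y => ((Q ^ g0)^-1)%:E * (\1_B y)%:E).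
  by apply: measurable_funeM; apply/measurable_EFinP; exact: measurable_indic.
have iQ : (0 <= (Q ^ g0)^-1)%R by rewrite invr_ge0 ltW.
apply: (@le_trans _ _ (\int[mu]_y (2^-1%:E *
    ((f y `^ q y)%:E + ((Q ^ g0)^-1)%:E * (\1_B y)%:E)))).
  apply: le_int => y _; first by rewrite lee_fin powR_ge0.
  have [By|nBy] := pselect (B y); last first.
    rewrite fB// mul0r !powR0 ?gt_eqF//.
    apply: mule_ge0; first by rewrite lee_fin.
    by apply: adde_ge0; [|apply: mule_ge0; rewrite lee_fin].
  rewrite indicE mem_set// -[X in _ + X]EFinM -EFinD -EFinM lee_fin mulr1.
  have fM : (f y / (2 * M) = 2^-1 * (f y * M^-1))%R by rewrite invfM; ring.
  have iM0 : (0 <= M^-1)%R by rewrite invr_ge0 ltW.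
  rewrite fM (powRM _ _ (mulr_ge0 (f0 y) iM0))//; apply: ler_pM; rewrite ?powR_ge0//.
    by apply: ge1r_powR => //; apply/andP; split; [lra|lra].
  rewrite powRM//.
  have rq : (0 < q y / r y)%R by rewrite divr_gt0.
  have br0 : (0 < (beta * r y)^-1)%R by rewrite invr_gt0 mulr_gt0.
  have conj : ((q y / r y)^-1 + ((beta * r y)^-1)^-1 = 1)%R.
    rewrite invf_div invrK (ge_q ge) mulrBr mulfV ?gt_eqF//.
    by rewrite mulrC subrK.
  apply: (le_trans (conjugate_powR (powR_ge0 _ _) (powR_ge0 _ _) rq br0 conj)).
  have e1 : ((f y `^ r y) `^ (q y / r y) = f y `^ q y)%R.
    by rewrite -powRrM mulrCA divff ?mulr1// gt_eqF.
  have e2 : ((M^-1 `^ r y) `^ (beta * r y)^-1 = (Q ^ g0)^-1)%R.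
    rewrite -powRrM invfM mulrCA divff ?gt_eqF// mulr1.
    rewrite -(powR_inv1 (ltW M0)) -powRrM /M -powRrM mulN1r mulrN divff ?gt_eqF//.
    by rewrite powR_inv1// ltW.
  rewrite e1 e2; apply: lerD.
    rewrite ler_piMr ?powR_ge0// invf_le1// ler_pdivlMr// mul1r.
    exact: (exponent_rq ge).
  rewrite invrK ler_piMr//.
  have /andP[_ rc] := ge_r ge y.
  apply: (@le_trans _ _ (c * beta)%R); last exact/ltW/(ge_cb ge).
  by rewrite mulrC ler_wpM2r// ltW.
rewrite ge0_integralZl//; last 2 first.
- exact: emeasurable_funD.
- by move=> y _; apply: adde_ge0; [rewrite lee_fin powR_ge0|apply: mule_ge0; rewrite lee_fin].
rewrite ge0_integralD//; last 2 first.
- by move=> y _; rewrite lee_fin powR_ge0.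
- by move=> y _; apply: mule_ge0; rewrite lee_fin.
rewrite ge0_integralZl//; last by apply/measurable_EFinP; exact: measurable_indic.
rewrite integral_indic// setIT (us_mu us) -EFinM mulVf ?gt_eqF//.
rewrite lee_pdivrMl// mule1 (_ : 2%:E = 1 + 1)//.
exact: leeD2r.
Qed.

Lemma Lvar_norm_ge0 (q : X -> R) (F : X -> \bar R) : 0 <= Lvar_norm mu q F.
Proof. by apply: le_ereal_inf_tmp => _ [e [e0 _] <-]; rewrite lee_fin ltW. Qed.

(** Boundedness is tested on [1_B]. The factor [|B| ^ beta] lost in comparing its norms in [L^r] and
    [L^q] cancels the normalization [|B| ^ (- beta)]. *)
Lemma comm_bounded_star (b r q : X -> R) : qp_locint mu b ->
  admissible mu alpha r q -> comm_bounded mu alpha b r q -> star_condition mu alpha b q.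
Proof.
move=> ib adm [C [C0 CP]].
have mb := locint_measurable p1 mu_ball n0 ib.
have [lev [lev_ball lev_min]] := level_exists us (fun _ => Qp0 p).
have [r' [q' [a [c [cq [C1 [C2 [rho [ge rq' mr mq]]]]]]]]] :=
  admissible_good p1 mu_ball n0 alpha0 lev_min adm.
have rr' : {ae mu, forall x, r x = r' x} by apply: filterS rq' => x [].
have qq' : {ae mu, forall x, q x = q' x} by apply: filterS rq' => x [].
apply: (@le_lt_trans _ _ (2 * C)%:E); last by rewrite ltry.
apply: ge_ereal_sup => _ [x0 _ [g0 _ <-]]; rewrite /star_quantity.
set B := qball x0 g0; have mB : measurable B by exact: (us_meas us).
set h := (X in Lvar_norm mu q X * _); set N := Lvar_norm mu q (fun y => (\1_B y)%:E).
have m1 : measurable_fun setT (\1_B : X -> R) by exact: measurable_indic.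
have mc := commutator_measurable alpha p1 mu_ball n0 (\1_B) mb.
have fL : in_Lvar mu r (EFin \o \1_B).
  split; first exact/measurable_EFinP.
  exists 1%R; split => //; apply: (@le_lt_trans _ _ (\int[mu]_y (\1_B y)%:E)).
    apply: le_int => y _; first exact: poweR_ge0.
    rewrite invr1 mule1 /= lee_fin indicE; case: (y \in B) => /=.
      by rewrite normr1 powR1.
    rewrite normr0 powR0//; case: adm => _ _ [_ r1 _ _] _ _.
    by rewrite gt_eqF// (lt_trans ltr01).
  by rewrite integral_indic// setIT (us_mu us) ltry.
have [_ CN] := CP _ fL.
have Qb : (0 < (Q ^ g0) `^ (- beta))%R by exact: powR_gt0.
have hN : Lvar_norm mu q h <=
    ((Q ^ g0) `^ (- beta))%:E * Lvar_norm mu q (commutator mu alpha b (\1_B)).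
  apply: Lvar_norm_le => // e e0 ce; apply: le_trans ce.
  apply: le_int_ae => //.
  - by move=> y _; exact: poweR_ge0.
  - by move=> y _; exact: poweR_ge0.
  - exact: modular_integrand_measurable.
  apply: filterS qq' => y qy _; rewrite qy.
  apply: gt0_ler_poweR; rewrite ?in_itv/= ?leey ?andbT//.
  - exact/ltW/(exponent_q0 ge).
  - by rewrite mule_ge0// lee_fin invr_ge0 mulr_ge0// ltW.
  - by rewrite mule_ge0// lee_fin invr_ge0 ltW.
  rewrite /h; case: asboolP => By; last first.
    by rewrite abse0 mul0e mule_ge0// lee_fin invr_ge0 ltW.
  rewrite star_commutator// abseM gee0_abs ?lee_fin ?(ltW Qb)//.
  rewrite muleAC -EFinM invfM mulrA divff ?mul1r ?gt_eqF//.
  by rewrite muleC.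
have rN : Lvar_norm mu r (EFin \o \1_B) <= (2 * (Q ^ g0) `^ beta)%:E * N.
  apply: Lvar_norm_le; first by rewrite mulr_gt0// powR_gt0.
  move=> e e0 qe.
  have m1' : measurable_fun setT (EFin \o (\1_B : X -> R)) by exact/measurable_EFinP.
  have M0 : (0 < 2 * (Q ^ g0) `^ beta * e)%R by rewrite !mulr_gt0// powR_gt0.
  rewrite (modular_ae _ mr (ge_mr ge) m1' rr') (modular_EFin mu r' \1_B M0).
  have qe' : modular mu q' (EFin \o \1_B) e <= 1.
    by rewrite -(modular_ae _ mq (exponent_mq ge) m1' qq').
  rewrite (modular_EFin mu q' \1_B e0) in qe'.
  have := @holder_ball lev r' q' a c cq C1 C2 rho (fun y => `|\1_B y| / e)%R x0 g0 ge.
  move=> /(_ _ _ _ qe') H; apply: le_trans (H _ _ _).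
  - by apply: le_int => y _; rewrite lee_fin ?powR_ge0// [X in (_ / X)%R]mulrC invfM mulrA.
  - by move=> y; rewrite divr_ge0// ltW.
  - by apply: measurable_funM => //; exact: measurableT_comp.
  - by move=> y By; rewrite indicE memNset// normr0 mul0r.
have N0 : 0 <= N by exact: Lvar_norm_ge0.
have hN2 : Lvar_norm mu q h <= (2 * C)%:E * N.
  apply: (le_trans hN); apply: (@le_trans _ _ (((Q ^ g0) `^ (- beta))%:E *
      (C%:E * ((2 * (Q ^ g0) `^ beta)%:E * N)))).
    rewrite lee_wpmul2l ?lee_fin ?(ltW Qb)//; apply: (le_trans CN).
    by rewrite lee_wpmul2l.
  rewrite !muleA -!EFinM lee_wpmul2r// lee_fin powRN le_eqVlt; apply/orP; left; apply/eqP.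
  by field; rewrite gt_eqF// powR_gt0.
have iN : 0 <= ((fine N)^-1)%:E by rewrite lee_fin invr_ge0 fine_ge0.
apply: (le_trans (lee_wpmul2r iN hN2)).
rewrite -muleA -[leRHS]mule1; apply: lee_wpmul2l; first by rewrite lee_fin mulr_ge0.
(* If the norm is [0] or [+oo], [fine] and the convention for the inverse of 0 make the quotient
   0. *)
case: N N0 {iN rN hN2} => [N| |]//=; last by rewrite invr0 mule0.
move=> _; rewrite -EFinM lee_fin; have [->|N0] := eqVneq N 0%R; first by rewrite mul0r.
by rewrite divff.
Qed.

End StarCondition.

(** * Recovering BMO and the bounded negative part *)

Section Necessity.
Context {R : realType} {p n : nat}.
Local Notation X := (QpnT R p n).
Variables (alpha : R) (mu : {measure set X -> \bar R}).
Hypothesis p1 : (1 < p)%N.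
Hypothesis mu_ball : forall (x : X) (g : int),
  mu (qball x g) = ((p%:R : R) ^ (n%:Z * g))%:E.
Hypothesis n0 : (0 < n)%N.
Hypothesis alpha0 : 0 < alpha.
Hypothesis alphan : alpha < n%:R.
Local Notation Q := ((p%:R : R) ^+ n).
Local Notation Ea := (Ea mu (@qball R p n) Q).
Let us := padic_ultra_space p1 mu_ball n0.
Let beta := alpha / n%:R.
Let beta0 : 0 < beta. Proof. by rewrite divr_gt0// ltr0n. Qed.
Local Open Scope ereal_scope.
Local Notation fmean := (fmean alpha mu).
Let Qg0 g : (0 < Q ^ g)%R := Qg0 us g.

Lemma indic_in_Lvar (r : X -> R) x0 g0 : (forall y, (0 < r y)%R) ->
  in_Lvar mu r (EFin \o \1_(qball x0 g0)).
Proof.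
move=> r0; have mB : measurable (qball x0 g0 : set X) by exact: (us_meas us).
split; first by apply/measurable_EFinP; exact: measurable_indic.
exists 1%R; split => //.
apply: (@le_lt_trans _ _ (\int[mu]_y (\1_(qball x0 g0) y)%:E)).
  apply: le_int => y _; first exact: poweR_ge0.
  rewrite invr1 mule1 /= lee_fin indicE; case: (y \in _) => /=.
    by rewrite normr1 powR1.
  by rewrite normr0 powR0// gt_eqF.
by rewrite integral_indic// setIT (us_mu us) ltry.
Qed.

(** A crude bound, whose purpose is to know that the denominator in the star condition is
    positive. *)
Lemma Lvar_norm_indic_gt0 (r : X -> R) x0 g0 : measurable_fun setT r ->
  (forall y, (1 <= r y)%R) ->
  (Num.min 1 (Q ^ g0))%:E <= Lvar_norm mu r (fun y => (\1_(qball x0 g0) y)%:E).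
Proof.
move=> mr r1; have mB : measurable (qball x0 g0 : set X) by exact: (us_meas us).
apply: le_ereal_inf_tmp => _ [e [e0 me] <-]; rewrite lee_fin ge_min.
have [//|e1] := leP 1%R e; rewrite orFb -lee_fin.
have : \int[mu]_y ((e^-1)%:E * (\1_(qball x0 g0) y)%:E) <= 1.
  apply: le_trans me; apply: le_int => y _.
    by apply: mule_ge0; rewrite lee_fin ?invr_ge0 ?(ltW e0).
  rewrite indicE; case: (y \in _) => /=; last by rewrite mule0 lee_fin powR_ge0.
  rewrite normr1 !mul1r mule1 lee_fin.
  apply: le_trans (ler_powR _ (r1 y)); first by rewrite powRr1// invr_ge0 ltW.
  by rewrite invf_ge1// ltW.
rewrite ge0_integralZl//; last 2 first.
- by apply/measurable_EFinP; exact: measurable_indic.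
- by rewrite lee_fin invr_ge0 ltW.
by rewrite integral_indic// setIT (us_mu us) lee_pdivrMl// mule1.
Qed.

Lemma Lvar_norm_lb (q : X -> R) (F : X -> \bar R) (e : R) : (0 < e)%R ->
  modular mu q F e <= 1 -> Lvar_norm mu q F <= e%:E.
Proof. by move=> e0 me; apply: ereal_inf_lbound; exists e. Qed.

Lemma Lvar_norm_ae (q q' : X -> R) (F : X -> \bar R) :
  measurable_fun setT q -> measurable_fun setT q' -> measurable_fun setT F ->
  {ae mu, forall x, q x = q' x} -> Lvar_norm mu q F = Lvar_norm mu q' F.
Proof.
move=> mq mq' mF qq'; congr ereal_inf; apply/seteqP.
by split => _ [e [e0 me] <-]; exists e => //; split => //; rewrite (modular_ae _ mq mq')// in me *.
Qed.

Lemma defect_le (m t : R) (T : \bar R) : m%:E <= T ->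
  (Num.max 0 (m - t))%:E <= `|t%:E - T|.
Proof.
case: T => [T| |] /=; [|by move=> _; rewrite leey|by rewrite leeNy_eq].
rewrite !lee_fin => mT; rewrite ge_max normr_ge0/= distrC.
by apply: le_trans (ler_norm _); rewrite lerD2r.
Qed.

Definition defect (b : X -> R) (x0 : X) (g0 : int) (y : X) : R :=
  Num.max 0%R (fine (Ea (fun t => `|b t|%:E) g0 x0) - b y)%R.

Lemma defect_measurable b x0 g0 : measurable_fun setT b ->
  measurable_fun setT (defect b x0 g0).
Proof. by move=> mb; apply: measurable_maxr => //; exact: measurable_funB. Qed.

Lemma Ea_abs_fin (b : X -> R) x0 g0 : qp_locint mu b ->
  Ea (fun t => `|b t|%:E) g0 x0 \is a fin_num.
Proof.
move=> ib; apply: fin_numM => //.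
have /integrableP[_ bI] := ib x0 g0.
by rewrite ge0_fin_numE//; apply: integral_ge0 => y _; rewrite lee_fin.
Qed.

(** [B] competes in the supremum defining [frac_max_in], so the normalized maximal function is at
    least the mean of [|b|] over [B]. *)
Lemma star_defect_le (b : X -> R) x0 g0 y : qp_locint mu b -> qball x0 g0 y ->
  (defect b x0 g0 y)%:E <= `|(b y)%:E - ((hmeas mu (qball x0 g0)) `^ (- alpha / n%:R))%:E *
    frac_max_in mu alpha (qball x0 g0) b y|.
Proof.
move=> ib xy; apply: defect_le; rewrite (hmeas_ball p1 mu_ball n0) mulNr -/beta.
rewrite fineK ?Ea_abs_fin// (frac_max_inE alpha p1 mu_ball n0).
apply: (@le_trans _ _ (((Q ^ g0) `^ (- beta))%:E * fmean b g0 y)).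
  rewrite /fmean muleA -EFinM powRN mulVf ?gt_eqF ?powR_gt0// mul1e.
  by rewrite (Ea_ball us _ xy).
rewrite lee_wpmul2l ?lee_fin ?powR_ge0//; apply: ereal_sup_ubound; exists g0 => //=.
by rewrite -(us_eq us xy).
Qed.

(** The mean [A] of the defect over [B] is bounded by duality in the classical argument. Here the
    averaging operator, applied to a normalized multiple of the defect, takes one constant value [T]
    on [B]; its modular bound limits the norm of [T * 1_B], and the star condition bounds the norm
    of the defect by that of [1_B], which cancels. *)
Lemma star_defect (b r q : X -> R) : qp_locint mu b -> admissible mu alpha r q ->
  star_condition mu alpha b q ->
  exists2 C : R, (0 <= C)%R & forall x0 g0, Ea (fun y => (defect b x0 g0 y)%:E) g0 x0 <= C%:E.
Proof.
move=> ib adm star.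
have mb := locint_measurable p1 mu_ball n0 ib.
have [lev [lev_ball lev_min]] := level_exists us (fun _ => Qp0 p).
have [r' [q' [a [c [cq [C1 [C2 [rho [ge rq' mr mq]]]]]]]]] :=
  admissible_good p1 mu_ball n0 alpha0 lev_min adm.
have qq' : {ae mu, forall x, q x = q' x} by apply: filterS rq' => x [].
have q'0 := exponent_q0 ge.
have q'1 y : (1 <= q' y)%R.
  apply: le_trans (exponent_rq ge y); have /andP[+ _] := ge_r ge y.
  apply: le_trans; apply: le_trans (ge_a ge).
  by rewrite -[leLHS]mulr1 ler_pM// ltW// (ge_rho ge).
have mq' := exponent_mq ge.
pose z (_ : X) : R := 0%R.
have iz : qp_locint mu z by move=> x g; exact: integrable0.
have mz : measurable_fun setT z by exact: measurable_cst.
have zK x g : bosc mu (@qball R p n) Q z g g x <= 1%:E.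
  rewrite /bosc /bavg; under [X in fine X]eq_integral do rewrite /z.
  rewrite integral0 mulr0 /Ea; under eq_integral do rewrite subrr normr0.
  by rewrite integral0 mule0.
have [C0 C00 key] := key_estimate us lev_ball lev_min ge mz iz ltr01 zK.
move: star; rewrite /star_condition; set Sup := ereal_sup _ => star.
have C10 : (0 < 1 + C0)%R by rewrite ltr_wpDr.
exists (2 * (`|fine Sup| + 1) * (1 + C0))%R.
  by rewrite !mulr_ge0// ltW// ltr_wpDl.
move=> x0 g0; set B : set X := qball x0 g0; have mB : measurable B by exact: (us_meas us).
have Sle : star_quantity mu alpha b q x0 g0 <= `|fine Sup|%:E.
  apply: (@le_trans _ _ Sup); first by apply: ereal_sup_ubound; exists x0 => //; exists g0.
  case: Sup star => [s| |]// _; last by rewrite leNye.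
  by rewrite lee_fin ler_norm.
move: Sle; rewrite /star_quantity -/B.
set h := (X in Lvar_norm mu q X * _); set N := Lvar_norm mu q (fun y => (\1_B y)%:E).
move=> Sle; have m1 : measurable_fun setT (EFin \o (\1_B : X -> R)).
  by apply/measurable_EFinP; exact: measurable_indic.
have NE : N = Lvar_norm mu q' (EFin \o \1_B) by exact: Lvar_norm_ae.
have := Lvar_norm_indic_gt0 x0 g0 mq' q'1; rewrite -[X in _ <= X]NE.
have [e1 e10 e1P] := modular_le1 mq' (aeW mu q'1) (indic_in_Lvar x0 g0 q'0).
have Ne1 : N <= e1%:E by rewrite NE; exact: Lvar_norm_lb e10 e1P.
have m0 : (0 < Num.min 1 (Q ^ g0))%R by rewrite lt_min ltr01 Qg0.
case: N NE Ne1 Sle => [nu| |]// NE _; rewrite lee_fin => Sle nu0.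
have {m0}nu0 : (0 < nu)%R by exact: lt_le_trans nu0.
set S := `|fine Sup|%R in Sle *.
have S1 : (0 < S + 1)%R by rewrite /S ltr_wpDl.
(* The norm is an infimum that need not be attained; the slack in [S + 1] provides a scale [eta] at
   which the modular is at most 1. *)
have [_ [eta [eta0 hP] <-]] : exists2 y, [set eta%:E | eta in
    [set eta : R | (0 < eta)%R /\ (modular mu q h eta <= 1)%E]] y & y < ((S + 1) * nu)%:E.
  have : Lvar_norm mu q h < ((S + 1) * nu)%:E.
    rewrite lee_pdivrMr//= in Sle; apply: le_lt_trans Sle _.
    by rewrite -EFinM lte_fin ltr_pM2r// ltrDl.
  by move/ereal_inf_lt => [y yP lt]; exists y.
rewrite lte_fin => etaS.
pose k y := (defect b x0 g0 y * \1_B y)%R.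
have k0 y : (0 <= k y)%R by rewrite mulr_ge0// le_max lexx.
have mk : measurable_fun setT k.
  by apply: measurable_funM; [exact: defect_measurable|exact: measurable_indic].
have kI : \int[mu]_y ((k y / eta) `^ q' y)%:E <= 1.
  apply: le_trans hP; apply: le_int_ae_l => //.
  - by move=> y _; rewrite lee_fin powR_ge0.
  - by move=> y _; exact: poweR_ge0.
  - apply/measurable_EFinP; apply: measurable_powR2 => //.
    exact: measurable_funM.
  apply: filterS qq' => y -> _; rewrite -poweR_EFin EFinM.
  apply: gt0_ler_poweR; rewrite ?in_itv/= ?leey ?andbT//.
  - exact: ltW.
  - by rewrite lee_fin divr_ge0// ltW.
  - by rewrite mule_ge0// lee_fin invr_ge0 ltW.
  apply: lee_wpmul2r; first by rewrite lee_fin invr_ge0 ltW.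
  rewrite /k /h; case: asboolP => By; last first.
    by rewrite indicE memNset// mulr0 abse0.
  by rewrite indicE mem_set// mulr1; exact: star_defect_le.
pose M := ((Q ^ g0) `^ beta)%R; have M0 : (0 < M)%R by exact: powR_gt0.
pose v y := (k y / eta / (2 * M))%R.
have v0 y : (0 <= v y)%R by rewrite !divr_ge0// ?mulr_ge0// ltW.
have mv : measurable_fun setT v by do 2 apply: measurable_funM => //.
have vI : \int[mu]_y (v y `^ r' y)%:E <= 1.
  apply: (holder_ball p1 mu_ball n0 alpha0 (g0 := g0) (x0 := x0) ge _ _ _ kI).
  - by move=> y; rewrite divr_ge0// ltW.
  - exact: measurable_funM.
  - by move=> y By; rewrite /k indicE memNset// mulr0 mul0r.
have [Psi [Psi0 mPsi PsiI PsiP]] := key v v0 mv vI.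
have md := defect_measurable x0 g0 mb.
have d0 y : 0 <= (defect b x0 g0 y)%:E by rewrite lee_fin le_max lexx.
have Afin : Ea (fun y => (defect b x0 g0 y)%:E) g0 x0 \is a fin_num.
  have mEb := Ea_abs_fin x0 g0 ib.
  rewrite ge0_fin_numE ?(Ea_ge0 us)//.
  set m := fine (Ea (fun t => `|b t|%:E) g0 x0).
  have m0 : (0 <= m)%R by apply: fine_ge0; exact: (Ea_ge0 us).
  apply: (@le_lt_trans _ _ (Ea (fun y => cst m%:E y + `|b y|%:E) g0 x0)).
    apply: (Ea_le us) => y _ //; rewrite -EFinD lee_fin ge_max addr_ge0//=.
    by rewrite lerD2l -normrN ler_norm.
  rewrite (EaD us)//; last by apply/measurable_EFinP; exact: measurableT_comp.
  by rewrite (Ea_cst us) lte_add_pinfty ?ltry// ltey_eq mEb.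
rewrite -(fineK Afin) lee_fin; set A := fine _.
have A0 : (0 <= A)%R by apply: fine_ge0; exact: (Ea_ge0 us).
(* The value on [B] of the fractional mean of [v], since [v] is the defect divided by
   [eta * (2 * M)] there. *)
pose T := (A / (2 * eta))%R.
have AT : (A = 2 * (eta * T))%R by rewrite /T; field; rewrite gt_eqF.
have [T0|T0] := leP T 0%R.
  apply: (@le_trans _ _ 0%R); last by rewrite !mulr_ge0// ltW.
  by rewrite AT mulr_ge0_le0// pmulr_rle0.
have kT y : B y -> M%:E * Ea (fun t => ((1 + `|z y - z t|) * v t)%:E) g0 y = T%:E.
  move=> By; rewrite -(Ea_ball us _ By).
  have -> : Ea (fun t => ((1 + `|z y - z t|) * v t)%:E) g0 x0 =
      Ea (fun t => ((eta * (2 * M))^-1)%:E * (defect b x0 g0 t)%:E) g0 x0.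
    congr (_ * _); apply: eq_integral => t tB.
    by rewrite -EFinM /z subrr normr0 addr0 mul1r /v /k indicE tB mulr1 -mulrA -invfM mulrC.
  rewrite (EaZ us)//; last 2 first.
  - by rewrite invr_ge0 !mulr_ge0// ltW.
  - exact/measurable_EFinP.
  rewrite -(fineK Afin) -/A -!EFinM; congr EFin.
  by rewrite /T; field; rewrite !gt_eqF.
have nuT : (nu <= (1 + C0) / T)%R.
  rewrite -lee_fin NE; apply: Lvar_norm_lb; first exact: divr_gt0.
  apply: (@le_trans _ _ (\int[mu]_y ((1 + C0)^-1%:E * Psi y))); last first.
    rewrite ge0_integralZl ?lee_fin ?invr_ge0 ?(ltW C10)//.
    by rewrite lee_pdivrMl// mule1 (le_trans PsiI)// lee_fin lerDr.
  apply: le_int_ae => //.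
  - by move=> y _; exact: poweR_ge0.
  - by move=> y _; rewrite mule_ge0// lee_fin invr_ge0 ltW.
  - exact: measurable_funeM.
  apply: filterS PsiP => y Py _.
  have [By|nBy] := pselect (B y); last first.
    rewrite /= indicE memNset// normr0 mul0r powR0 ?gt_eqF//.
    by rewrite mule_ge0// lee_fin invr_ge0 ltW.
  rewrite /= indicE mem_set// normr1 mul1r invf_div.
  rewrite powRM ?invr_ge0 ?(ltW T0) ?(ltW C10)// muleC EFinM.
  apply: lee_pmul; rewrite ?lee_fin ?powR_ge0//.
    by have := Py g0; rewrite (kT y By) poweR_EFin.
  by rewrite ge1r_powR// invr_gt0 C10 invf_le1// lerDl.
rewrite AT -!mulrA ler_pM2l//.
rewrite ler_pdivlMr// in nuT.
apply: (@le_trans _ _ ((S + 1) * (nu * T))%R).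
  by rewrite [leRHS]mulrA ler_wpM2r// ltW.
by rewrite ler_wpM2l// ltW.
Qed.

Lemma Ea_cancel (m C : R) (f h : X -> R) x g : (0 <= m)%R ->
  measurable_fun setT f -> measurable_fun setT h ->
  (forall y, (0 <= f y)%R) -> (forall y, (0 <= h y)%R) ->
  Ea (fun y => (h y)%:E) g x <= (m + C)%:E ->
  (forall y, (f y + m <= h y)%R) -> Ea (fun y => (f y)%:E) g x <= C%:E.
Proof.
move=> m0 mf mh f0 h0 hC fh; rewrite -(@leeD2rE _ m%:E)//.
rewrite -[X in _ + X](Ea_cst us m g x) -(EaD us)//; last exact/measurable_EFinP.
rewrite -EFinD addrC; apply: le_trans hC; apply: (Ea_le us) => y _.
  by rewrite -EFinD lee_fin addr_ge0.
by rewrite -EFinD lee_fin.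
Qed.

Section FromDefect.
Variables (b : X -> R) (C : R).
Hypothesis ib : qp_locint mu b.
Hypothesis C0 : (0 <= C)%R.
Hypothesis bC : forall x0 g0, Ea (fun y => (defect b x0 g0 y)%:E) g0 x0 <= C%:E.
Let mb : measurable_fun setT b := locint_measurable p1 mu_ball n0 ib.
Let m x0 g0 := fine (Ea (fun t => `|b t|%:E) g0 x0).
Let m0 x0 g0 : (0 <= m x0 g0)%R.
Proof. by apply: fine_ge0; exact: (Ea_ge0 us). Qed.

Let abs_defect (t : R) x0 g0 : (0 <= t)%R ->
  Ea (fun y => (`|b y| + t * defect b x0 g0 y)%:E) g0 x0 <= (m x0 g0 + t * C)%:E.
Proof.
move=> t0; have d0 y : (0 <= defect b x0 g0 y)%R by rewrite le_max lexx.
rewrite [leLHS](_ : _ = Ea (fun y => `|b y|%:E + t%:E * (defect b x0 g0 y)%:E) g0 x0)//.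
rewrite (EaD us)//; last 3 first.
- by move=> y; rewrite -EFinM lee_fin mulr_ge0.
- by apply/measurable_EFinP; exact: measurableT_comp.
- by apply/measurable_funeM/measurable_EFinP; exact: defect_measurable.
rewrite (EaZ us)//; last by apply/measurable_EFinP; exact: defect_measurable.
rewrite EFinD EFinM /m fineK ?Ea_abs_fin//; apply: leeD2l.
by rewrite lee_wpmul2l.
Qed.

Lemma BMO_of_defect : in_BMO mu b.
Proof.
split => //; apply: (@le_lt_trans _ _ (2 * C + 2 * C)%:E); last by rewrite ltry.
apply: ge_ereal_sup => _ [x _ [g _ <-]]; rewrite (hmeas_ball p1 mu_ball n0).
have avgE : avg mu (qball x g) b = bavg mu (@qball R p n) Q b g x.
  by rewrite /avg (hmeas_ball p1 mu_ball n0).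
rewrite avgE.
have mm : Ea (fun y => `|b y - m x g|%:E) g x <= (2 * C)%:E.
  apply: (@Ea_cancel (m x g) _ _ (fun y => `|b y| + 2 * defect b x g y)%R) => //.
  - by apply: measurableT_comp => //; exact: measurable_funB.
  - apply: measurable_funD; first exact: measurableT_comp.
    by apply: measurable_funM => //; exact: defect_measurable.
  - by move=> y; rewrite addr_ge0// mulr_ge0// le_max lexx.
  - exact: abs_defect.
  move=> y; have d0 : (0 <= defect b x g y)%R by rewrite le_max lexx.
  have dm : (m x g - b y <= defect b x g y)%R by rewrite le_max lexx orbT.
  have := ler_norm (b y); have [h|h] := lerP (m x g) (b y).
    by lra.
  by lra.
(* Replacing the mean of [|b|] by the mean of [b] costs their distance, which is again at most
   [2 * C]. *)
apply: (le_trans (Ea_shift us mb g x (m x g) _)).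
rewrite EFinD; apply: leeD => //.
by rewrite distrC; apply: le_trans mm; exact: bavg_dist.
Qed.

Lemma Linfty_of_defect : in_Linfty mu (negpart b).
Proof.
have mn : measurable_fun setT (negpart b).
  by apply: measurableT_comp => //; exact: measurable_minr.
split => //; apply: (@le_lt_trans _ _ C%:E); last by rewrite ltry.
apply/ess_supP.
have : {ae mu, forall x, (`|b x| - b x)%:E <= C%:E}.
  apply: (ae_le_of_balls us C0).
  - by move=> x; rewrite lee_fin subr_ge0 ler_norm.
  - by apply/measurable_EFinP; apply: measurable_funB => //; exact: measurableT_comp.
  move=> x g; rewrite -(Ea_leP us).
  apply: (@Ea_cancel (m x g) _ _ (fun y => `|b y| + 1 * defect b x g y)%R) => //.
  - by apply: measurable_funB => //; exact: measurableT_comp.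
  - apply: measurable_funD; first exact: measurableT_comp.
    by apply: measurable_funM => //; exact: defect_measurable.
  - by move=> y; rewrite subr_ge0 ler_norm.
  - by move=> y; rewrite addr_ge0// mul1r le_max lexx.
  - by have := @abs_defect 1 x g; rewrite mul1r; exact.
  move=> y; have dm : (m x g - b y <= defect b x g y)%R by rewrite le_max lexx orbT.
  lra.
apply: filterS => x; rewrite !lee_fin /negpart normrN; apply: le_trans.
have [h|h] := leP 0%R (b x); first by rewrite normr0 subr_ge0 ler_norm.
by rewrite ltr0_norm//; lra.
Qed.

End FromDefect.

Lemma BMO_of_star (b r q : X -> R) : qp_locint mu b -> admissible mu alpha r q ->
  star_condition mu alpha b q -> in_BMO mu b /\ in_Linfty mu (negpart b).
Proof.
move=> ib adm star; have [C C0 bC] := star_defect ib adm star.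
by split; [exact: BMO_of_defect bC|exact: Linfty_of_defect C0 bC].
Qed.

End Necessity.

(** * Constant admissible exponents and the equivalence *)

Section ConstantExponent.
Context {R : realType} {p n : nat}.
Local Notation X := (QpnT R p n).
Variables (alpha : R) (mu : {measure set X -> \bar R}).
Hypothesis p1 : (1 < p)%N.
Hypothesis mu_ball : forall (x : X) (g : int),
  mu (qball x g) = ((p%:R : R) ^ (n%:Z * g))%:E.
Hypothesis n0 : (0 < n)%N.
Hypothesis alpha0 : 0 < alpha.
Hypothesis alphan : alpha < n%:R.
Let us := padic_ultra_space p1 mu_ball n0.
Local Open Scope ereal_scope.

Let ball_ae (x : X) g (P : X -> Prop) : {ae mu, forall y, P y} -> exists y, qball x g y /\ P y.
Proof.
by apply: ae_witness; [exact: (us_meas us)|rewrite (us_mu us) gt_eqF// lte_fin (Qg0 us)].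
Qed.

(** Containing a ball gives [A] positive measure; on a null set the essential supremum would be
    [-oo]. *)
Lemma esup_on_cst (A : set X) x g (c : R) : qball x g `<=` A -> esup_on mu A (cst c) = c%:E.
Proof.
move=> xA; apply/eqP; rewrite eq_le; apply/andP; split.
  by apply: ereal_inf_lbound; apply: aeW.
by apply: le_ereal_inf_tmp => y /(@ball_ae x g)[z [/xA Az]]; exact.
Qed.

Lemma einf_on_cst (A : set X) x g (c : R) : qball x g `<=` A -> einf_on mu A (cst c) = c%:E.
Proof.
move=> xA; apply/eqP; rewrite eq_le; apply/andP; split.
  by apply: ge_ereal_sup => y /(@ball_ae x g)[z [/xA Az]]; exact.
by apply: ereal_sup_ubound; apply: aeW.
Qed.

Lemma Clog_cst (c : R) : Clog mu (cst c).
Proof.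
split; exists 0%R; [move=> g x|move=> x y]; last by rewrite subrr normr0 mul0r.
by rewrite (@esup_on_cst _ x g)// (@einf_on_cst _ x g)// subee// mule0.
Qed.

(** One admissible pair must exist for the assertions about all pairs to imply anything; the
    midpoint of [1] and [n / alpha] is a constant choice. *)
Lemma admissible_cst : exists r q : X -> R, admissible mu alpha r q.
Proof.
have n0R : (0 < n%:R :> R)%R by rewrite ltr0n.
have na : (1 < n%:R / alpha)%R by rewrite ltr_pdivlMr// mul1r.
pose c := ((1 + n%:R / alpha) / 2)%R.
have c1 : (1 < c)%R by rewrite /c; lra.
have cn : (c < n%:R / alpha)%R by rewrite /c; lra.
pose o : X := fun _ => Qp0 p.
exists (cst c), (cst (c^-1 - alpha / n%:R)^-1)%R; split.
- exact: Clog_cst.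
- exact: Clog_cst.
- split => //; first by rewrite (@einf_on_cst _ o 0)// lte_fin.
  by rewrite (@esup_on_cst _ o 0)// ltry.
- by rewrite (@esup_on_cst _ o 0)// lte_fin.
- by move=> x; rewrite /= invrK.
Qed.

End ConstantExponent.

Theorem theorem1 (R : realType) (p n : nat) (alpha : R)
  (mu : {measure set (QpnT R p n) -> \bar R}) (b : QpnT R p n -> R) :
  prime p ->
  (forall (x : QpnT R p n) (g : int),
      mu (qball x g) = ((p%:R : R) ^ (n%:Z * g))%:E) ->
  0 < alpha -> alpha < n%:R ->
  qp_locint mu b ->
  [<-> in_BMO mu b /\ in_Linfty mu (negpart b);
       forall r q, admissible mu alpha r q -> comm_bounded mu alpha b r q;
       exists r q, admissible mu alpha r q /\ comm_bounded mu alpha b r q;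
       exists r q, admissible mu alpha r q /\ star_condition mu alpha b q;
       forall r q, admissible mu alpha r q -> star_condition mu alpha b q].
Proof.
move=> /prime_gt1 p1 mu_ball alpha0 alphan ib.
have n0 : (0 < n)%N by rewrite -(ltr0n R); exact: lt_trans alphan.
have [r0 [q0 adm0]] := admissible_cst p1 mu_ball n0 alpha0 alphan.
tfae.
- by move=> [bmo neg] r q; exact: comm_bounded_of_BMO.
- by move=> H; exists r0, q0; split => //; exact: H.
- move=> [r [q [adm H]]]; exists r, q; split => //.
  exact: (comm_bounded_star p1 mu_ball n0 alpha0 alphan ib adm H).
(* Two admissible pairs are not compared directly: the first one yields BMO and the bound on the
   negative part, which no longer mention exponents. *)
- move=> [r [q [adm H]]] r' q' adm'.
  have [bmo neg] := BMO_of_star p1 mu_ball n0 alpha0 ib adm H.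
  apply: (comm_bounded_star p1 mu_ball n0 alpha0 alphan ib adm').
  exact: comm_bounded_of_BMO.
- by move=> H; exact: (BMO_of_star p1 mu_ball n0 alpha0 ib adm0 (H _ _ adm0)).
Qed.
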